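(* Let $X$ be a real analytic vector field in a neighborhood $U$ of the origin $O\in\mathbb{R}^2$. Assume that $X(O)=0$ and that $DX(O)$ generates a rotation. Assume that there are a transverse segment $\Sigma$ to $X$, a number $k\in\mathbb{N}$ and a sequence of orbits $\gamma_\nu\subset U\setminus\{O\}$, $\nu\in\mathbb{N}$, of $X$ such that: (1) each $\gamma_\nu$ has order bounded by $k$ with respect to $\Sigma$; (2) $\gamma_\nu\to O$ as $\nu\to\infty$ (in the sense of the Hausdorff topology). Then $X$ has a center type singularity at the origin. In particular, $X$ admits a real analytic first integral in a neighborhood of the origin.
   Context: A real $2\times 2$ matrix $A$ generates a rotation if all the orbits of the one-parameter group $\exp(tA)$, $t\in\mathbb{R}$, outside the origin of $\mathbb{R}^2$ are periodic and nontrivial; equivalently, the eigenvalues of $A$ are $\pm i\omega$ with $\omega\in\mathbb{R}\setminus\{0\}$. A transverse segment to $X$ is a set $\Sigma=\phi((0,\epsilon))\subset U$, where $\phi\colon[0,\epsilon)\to\mathbb{R}^2$ is a continuous injective map such that $\phi(0)=O$, $\phi|_{(0,\epsilon)}$ is a smooth immersion, and $\phi$ is transverse to $X$ at every point off the origin. For $p\in\Sigma$ let $\gamma_p$ be the trajectory (orbit in $U$) of $X$ through $p$. The point $p$, and likewise the orbit $\gamma_p$, has order bounded by $k\in\mathbb{N}$ with respect to $\Sigma$ if $\sharp(\gamma_p\cap\Sigma)\le k$. An isolated singularity of a smooth planar vector field is a center (center type singularity) if it has a neighborhood consisting only of the singularity and periodic orbits (diffeomorphic to $S^1$). A real analytic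 first integral is a non-constant real analytic function $f$ near $O$ with $X(f)=0$. Convergence $\gamma_\nu\to O$ means that for every neighborhood $W$ of $O$ one has $\gamma_\nu\subset W$ for all large $\nu$. *)

(* Defs.v *)
From HB Require Import structures.
From mathcomp Require Import all_boot all_order all_algebra.
From mathcomp Require Import all_classical all_reals all_analysis.

Set Implicit Arguments.
Unset Strict Implicit.
Unset Printing Implicit Defensive.

Import Order.TTheory GRing.Theory Num.Theory.
Import numFieldNormedType.Exports.

Local Open Scope classical_set_scope.
Local Open Scope ring_scope.

(* Points and vectors of the plane are row vectors 'rV[R]_2.  A vector field on
   an open set U is a total function of which only the values on U matter. *)

(* f is, near p, the sum of an absolutely convergent double power series.
   Square partial sums are used; absolute convergence for `|h_0|, `|h_1| <= r
   makes the order of summation irrelevant. *)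
Definition analytic_at (R : realType) (f : 'rV[R]_2 -> R) (p : 'rV[R]_2) : Prop :=
  exists (a : nat -> nat -> R) (r : R),
    [/\ 0 < r,
        exists M : R, forall n : nat,
          \sum_(i < n) \sum_(j < n) `|a i j| * r ^+ (i + j) <= M
      & forall h : 'rV[R]_2, `|h| < r ->
          (\sum_(i < n) \sum_(j < n) a i j * h 0 0 ^+ i * h 0 1 ^+ j)
            @[n --> \oo] --> f (p + h)].

Definition analytic_vector_field (R : realType) (U : set 'rV[R]_2)
    (X : 'rV[R]_2 -> 'rV[R]_2) : Prop :=
  forall p, U p -> forall j : 'I_2, analytic_at (fun q => X q 0 j) p.

Definition expmx (R : realType) (A : 'M[R]_2) : 'M[R]_2 :=
  limn (series (fun n : nat => (n`!%:R)^-1 *: A ^+ n)).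

Definition generates_rotation (R : realType) (A : 'M[R]_2) : Prop :=
  forall v : 'cV[R]_2, v != 0 ->
    (exists T : R, 0 < T /\
       forall t : R, expmx ((t + T) *: A) *m v = expmx (t *: A) *m v) /\
    (exists t : R, expmx (t *: A) *m v != v).

(* [jacobian] acts on row vectors from the right, so the usual matrix of partial
   derivatives, with entries d X_i / d x_j, is its transpose. *)
Definition DX (R : realType) (X : 'rV[R]_2 -> 'rV[R]_2) (p : 'rV[R]_2)
  : 'M[R]_2 := (jacobian X p)^T.

Definition integral_curve (R : realType) (U : set 'rV[R]_2)
    (X : 'rV[R]_2 -> 'rV[R]_2) (D : set R) (c : R -> 'rV[R]_2) : Prop :=
  forall t, D t -> U (c t) /\ is_derive t (1 : R) c (X (c t)).

(* The orbit of p in U, i.e. the image of the maximal integral curve through p,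
   is the union of the images of all the integral curves in U through p. *)
Definition orbit_in (R : realType) (U : set 'rV[R]_2)
    (X : 'rV[R]_2 -> 'rV[R]_2) (p : 'rV[R]_2) : set 'rV[R]_2 :=
  [set q | exists (a b : R) (c : R -> 'rV[R]_2),
     [/\ a < 0 < b, integral_curve U X `]a, b[ c, c 0 = p
       & exists2 t, t \in `]a, b[ & c t = q]].

Definition is_orbit (R : realType) (U : set 'rV[R]_2)
    (X : 'rV[R]_2 -> 'rV[R]_2) (gamma : set 'rV[R]_2) : Prop :=
  exists2 p, U p & gamma = orbit_in U X p.

Definition transverse_segment (R : realType) (U : set 'rV[R]_2)
    (X : 'rV[R]_2 -> 'rV[R]_2) (Sigma : set 'rV[R]_2) : Prop :=
  exists (eps : R) (phi : R -> 'rV[R]_2),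
    [/\ 0 < eps,
        [/\ {within `[0 : R, eps[%classic, continuous phi},
           {in `[0, eps[ &, injective phi}
          & phi 0 = 0],
        forall t, t \in `]0, eps[ ->
          (forall n : nat, derivable (derive1n n phi) t 1) /\ derive1 phi t != 0,
        forall t, t \in `]0, eps[ ->
          row_free (col_mx (derive1 phi t) (X (phi t)))
      & Sigma `<=` U /\ Sigma = phi @` `]0, eps[].

Definition order_bounded (R : realType) (Sigma : set 'rV[R]_2) (k : nat)
    (gamma : set 'rV[R]_2) : Prop :=
  (gamma `&` Sigma #<= `I_k)%card.

Definition orbits_tend_to (R : realType) (gamma : nat -> set 'rV[R]_2)
    (p : 'rV[R]_2) : Prop :=
  forall W : set 'rV[R]_2, nbhs p W -> \forall nu \near \oo, gamma nu `<=` W.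

(* T is the least period, so that gamma is an embedded circle R / T Z. *)
Definition periodic_orbit (R : realType) (U : set 'rV[R]_2)
    (X : 'rV[R]_2 -> 'rV[R]_2) (gamma : set 'rV[R]_2) : Prop :=
  exists (T : R) (c : R -> 'rV[R]_2),
    [/\ 0 < T, integral_curve U X setT c,
        forall s t : R, c s = c t <-> exists m : int, s = t + m%:~R * T
      & gamma = range c].

Definition isolated_singularity (R : realType)
    (X : 'rV[R]_2 -> 'rV[R]_2) (p : 'rV[R]_2) : Prop :=
  X p = 0 /\ \forall q \near p, q != p -> X q != 0.

Definition center_at (R : realType) (U : set 'rV[R]_2)
    (X : 'rV[R]_2 -> 'rV[R]_2) (p : 'rV[R]_2) : Prop :=
  isolated_singularity X p /\
  exists N : set 'rV[R]_2,
    [/\ nbhs p N, N `<=` U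
      & forall q, N q -> q != p ->
          exists gamma, [/\ periodic_orbit U X gamma, gamma q & gamma `<=` N]].

(* Non-constancy is required of the germ of f at p: V need not be connected. *)
Definition analytic_first_integral (R : realType)
    (X : 'rV[R]_2 -> 'rV[R]_2) (p : 'rV[R]_2) (V : set 'rV[R]_2)
    (f : 'rV[R]_2 -> R) : Prop :=
  [/\ forall q, V q -> analytic_at f q,
      forall q, V q -> 'D_(X q) f q = 0
    & ~ exists a : R, \forall q \near p, f q = a].

(* Main.v *)
Require Import Defs.
From HB Require Import structures.
From mathcomp Require Import all_boot all_order all_algebra.
From mathcomp Require Import all_classical all_reals all_analysis.
From mathcomp Require Import complex ring lra.

Set Implicit Arguments.
Unset Strict Implicit.
Unset Printing Implicit Defensive.
Import Order.TTheory GRing.Theory Num.Theory.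
Import numFieldNormedType.Exports.
Local Open Scope classical_set_scope.
Local Open Scope ring_scope.

(* In a complex coordinate the field reads [z' = i w (z + F z)] with [F] quadratic.
   Instead of Poincare's formal normal form, one solves, by a convergent
   iteration, [d/dt phi (x e^(i t)) = i (1 + mu) (phi + F phi)] with [phi] tangent
   to the identity and [mu] a function of [|x| ^ 2] alone: all resonant terms go
   into the factor [1 + mu], which is complex, and no small divisors appear.
   Thus [phi] carries the circle of radius [|x|] to a closed curve along which the
   field makes with the tangent an angle governed by [Im mu].  If [Im mu] vanishes
   identically near 0, these curves are periodic orbits and [|phi^-1| ^ 2] is an
   analytic first integral.  Otherwise, by analyticity, [Im mu] keeps a strict sign
   on a punctured neighborhood of 0; there [|phi^-1| ^ 2] is strictly monotone
   along the orbits, with a speed bounded below away from 0, so that no orbit can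
   stay in that neighborhood, contrary to the convergence of the given orbits. *)

(** * Submultiplicative norms on polynomials *)

(** A convergent power series in [z] and its conjugate is represented by polynomials in two
    independent variables whose successive differences are bounded by a constant times [2^-1 ^+ n]
    in a weighted l1 norm on a polydisc. Identities are exact at each finite stage and pass to the
    limit only after evaluation. The field is known through truncations, so the fixed point schemes
    change their map at every stage; contracting by 1/4, they still keep the rate 1/2 of the
    truncations.

    Two obstacles shape the estimates. The operator [angular] is unbounded in these norms, so the
    convergence of [angular phi] is read off from the conjugacy equation itself. And as [mu] is
    complex, the field splits into a part tangent to the image of a circle and [Im mu] times a
    direction [Ang]; this direction is close to the radius vector, which is why [|phi^-1| ^ 2]
    increases along it. Three nested radii result: for [phi], for its inverse, for this growth.

    An orbit is followed without continuation to infinite time: near the supremum of [|phi^-1| ^ 2]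
    over the orbit, an existence time uniform near the origin is enough to exceed that supremum. *)

Record ring_norm (R : realFieldType) (B : comNzRingType) (nu : B -> R) : Prop :=
  RingNorm {
    rn_ge0 : forall x, 0 <= nu x;
    rn_0 : nu 0 = 0;
    rn_1 : nu 1 <= 1;
    rn_N : forall x, nu (- x) = nu x;
    rn_D : forall x y, nu (x + y) <= nu x + nu y;
    rn_M : forall x y, nu (x * y) <= nu x * nu y }.

Lemma rn_B (R : realFieldType) (B : comNzRingType) (nu : B -> R) :
  ring_norm nu -> forall x y, nu (x - y) <= nu x + nu y.
Proof. by move=> h x y; rewrite -(rn_N h y); exact: rn_D. Qed.

Lemma rn_distC (R : realFieldType) (B : comNzRingType) (nu : B -> R) :
  ring_norm nu -> forall x y, nu (x - y) = nu (y - x).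
Proof. by move=> h x y; rewrite -(rn_N h) opprB. Qed.

Lemma rn_sum (R : realFieldType) (B : comNzRingType) (nu : B -> R) :
  ring_norm nu -> forall (I : Type) (s : seq I) (P : pred I) (F : I -> B),
  nu (\sum_(i <- s | P i) F i) <= \sum_(i <- s | P i) nu (F i).
Proof.
move=> h I s P F; elim/big_rec2: _ => [|i y x _ H]; first by rewrite (rn_0 h).
by apply: le_trans (rn_D h _ _) _; rewrite lerD2l.
Qed.

Lemma rn_X (R : realFieldType) (B : comNzRingType) (nu : B -> R) :
  ring_norm nu -> forall x n, nu (x ^+ n) <= nu x ^+ n.
Proof.
move=> h x; elim=> [|n IH]; first by rewrite !expr0; exact: rn_1.
rewrite !exprS; apply: le_trans (rn_M h _ _) _.
by apply: ler_wpM2l => //; exact: rn_ge0.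
Qed.

Lemma ring_norm_abs (R : realFieldType) : ring_norm (fun x : R => `|x|).
Proof.
split=> //=; [exact: normr0 | by rewrite normr1 | exact: normrN | exact: ler_normD |].
by move=> x y; rewrite normrM.
Qed.

Section PolyNorm.
Variables (R : realFieldType) (B : comNzRingType) (nu : B -> R).
Hypothesis hnu : ring_norm nu.
Implicit Types p q : {poly B}.

(** Weighted l1 norm, a majorant of [p] on the disc of radius [r]. It is again a [ring_norm]
    ([ring_norm_pnorm]), so the construction iterates to polynomials in two variables. *)
Definition pnorm (r : R) (p : {poly B}) : R := \sum_(i < size p) nu p`_i * r ^+ i.

Lemma pnorm_widen r p n : (size p <= n)%N ->
  pnorm r p = \sum_(i < n) nu p`_i * r ^+ i.
Proof.
move=> le; rewrite /pnorm (big_ord_widen n (fun i => nu p`_i * r ^+ i) le) big_mkcond /=.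
apply: eq_bigr => i _; case: ltnP => // h.
by rewrite nth_default // (rn_0 hnu) mul0r.
Qed.

Lemma pnorm0 r : pnorm r 0 = 0.
Proof. by rewrite /pnorm size_poly0 big_ord0. Qed.

Lemma pnormN r p : pnorm r (- p) = pnorm r p.
Proof.
rewrite /pnorm size_polyN; apply: eq_bigr => i _.
by rewrite coefN (rn_N hnu).
Qed.

Lemma pnormC r c : pnorm r c%:P = nu c.
Proof.
rewrite (@pnorm_widen r _ 1) ?size_polyC_leq1 // big_ord1 coefC /=.
by rewrite expr0 mulr1.
Qed.

Section NonNeg.
Variable r : R.
Hypothesis r0 : 0 <= r.

Lemma pnorm_ge0 p : 0 <= pnorm r p.
Proof. by apply: sumr_ge0 => i _; rewrite mulr_ge0 ?exprn_ge0 ?(rn_ge0 hnu). Qed.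

Lemma pnormD p q : pnorm r (p + q) <= pnorm r p + pnorm r q.
Proof.
set n := maxn (size p) (size q).
rewrite (@pnorm_widen r p n) ?leq_maxl // (@pnorm_widen r q n) ?leq_maxr //.
rewrite (@pnorm_widen r (p + q) n) ?size_polyD // -big_split /=.
apply: ler_sum => i _; rewrite coefD -mulrDl ler_wpM2r ?exprn_ge0 //.
exact: rn_D.
Qed.

Lemma pnorm_mulXaddC p c : pnorm r (p * 'X + c%:P) = pnorm r p * r + nu c.
Proof.
rewrite (@pnorm_widen r (p * 'X + c%:P) (size p).+1); last first.
  by rewrite size_MXaddC; case: ifP.
rewrite big_ord_recl /= coefD coefMX coefC /= add0r expr0 mulr1 addrC.
congr (_ + _); rewrite /pnorm big_distrl /=; apply: eq_bigr => i _.
by rewrite coefD coefMX coefC /= addr0 exprSr mulrA.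
Qed.

Lemma pnormMX p : pnorm r (p * 'X) = pnorm r p * r.
Proof. by rewrite -[p * 'X]addr0 -[0]/(0%:P) pnorm_mulXaddC (rn_0 hnu) addr0. Qed.

Lemma pnormCM c p : pnorm r (c%:P * p) <= nu c * pnorm r p.
Proof.
rewrite mul_polyC (@pnorm_widen r _ (size p)) ?size_scale_leq // /pnorm big_distrr /=.
apply: ler_sum => i _; rewrite coefZ mulrA ler_wpM2r ?exprn_ge0 //; exact: rn_M.
Qed.

(** Induction on the Horner form of [p] replaces the Cauchy product: only multiplication by ['X] and
    by a constant has to be bounded. *)
Lemma pnormM p q : pnorm r (p * q) <= pnorm r p * pnorm r q.
Proof.
elim/poly_ind: p => [|p c IH]; first by rewrite mul0r pnorm0 mul0r.
rewrite pnorm_mulXaddC mulrDl; apply: le_trans (pnormD _ _) _; rewrite mulrDl lerD ?pnormCM //.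
by rewrite -mulrA -(commr_polyX q) mulrA pnormMX mulrAC ler_wpM2r.
Qed.

Lemma pnormX : pnorm r 'X <= r.
Proof.
rewrite -['X]mul1r pnormMX -[1]/(1%:P) pnormC -[leRHS]mul1r ler_wpM2r //; exact: rn_1.
Qed.

Lemma ring_norm_pnorm : ring_norm (pnorm r).
Proof.
split; [exact: pnorm_ge0|exact: pnorm0| |exact: pnormN|exact: pnormD|exact: pnormM].
by rewrite -[1]/(1%:P) pnormC; exact: rn_1.
Qed.

Lemma pnorm_coef p i : nu p`_i * r ^+ i <= pnorm r p.
Proof.
have [h|h] := ltnP i (size p); last first.
  by rewrite nth_default // (rn_0 hnu) mul0r; exact: pnorm_ge0.
rewrite /pnorm (bigD1 (Ordinal h)) //= lerDl; apply: sumr_ge0 => j _.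
by rewrite mulr_ge0 ?exprn_ge0 ?(rn_ge0 hnu).
Qed.

Lemma pnorm_le_coef p q (k : R) : 0 <= k ->
  (forall i, nu p`_i <= k * nu q`_i) -> pnorm r p <= k * pnorm r q.
Proof.
move=> k0 H; set n := maxn (size p) (size q).
rewrite (@pnorm_widen r p n) ?leq_maxl // (@pnorm_widen r q n) ?leq_maxr //.
rewrite big_distrr; apply: ler_sum => i _.
by rewrite /= mulrA ler_wpM2r ?exprn_ge0.
Qed.
End NonNeg.

Lemma pnorm_le_radius r s p : 0 <= r -> r <= s -> pnorm r p <= pnorm s p.
Proof.
move=> r0 rs; apply: ler_sum => i _; rewrite ler_wpM2l ?(rn_ge0 hnu) //.
by apply: lerXn2r; rewrite ?nnegrE // (le_trans r0).
Qed.

End PolyNorm.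

(** * Substitution into polynomials and its Lipschitz estimates *)

Section EvalNorm.
Variables (R : realFieldType) (K B : comNzRingType).
Variables (nuB : B -> R) (nuK : K -> R).
Hypotheses (hB : ring_norm nuB) (hK : ring_norm nuK).
Implicit Types p : {poly K}.

Definition psubst (f : {rmorphism K -> B}) (b : B) : {poly K} -> B :=
  horner_morph (fun x : K => mulrC b (f x)).

HB.instance Definition _ f b := GRing.RMorphism.on (psubst f b).

Lemma psubstC f b c : psubst f b c%:P = f c.
Proof. exact: horner_morphC. Qed.
Lemma psubstX f b : psubst f b 'X = b.
Proof. exact: horner_morphX. Qed.
Lemma psubst_mulXaddC f b p c :
  psubst f b (p * 'X + c%:P) = psubst f b p * b + f c.
Proof. by rewrite rmorphD rmorphM /= psubstX psubstC. Qed.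

Lemma psubst_norm (f : {rmorphism K -> B}) b s p : nuB b <= s ->
  (forall x, nuB (f x) <= nuK x) -> nuB (psubst f b p) <= pnorm nuK s p.
Proof.
move=> bs hf; have s0 : 0 <= s by exact: le_trans (rn_ge0 hB b) bs.
elim/poly_ind: p => [|p c IH]; first by rewrite rmorph0 (rn_0 hB) pnorm0.
rewrite psubst_mulXaddC pnorm_mulXaddC //; apply: le_trans (rn_D hB _ _) _.
apply: lerD; last exact: hf.
apply: le_trans (rn_M hB _ _) _; apply: ler_pM => //; exact: rn_ge0.
Qed.

(** A Cauchy estimate: doubling the radius pays for the factor [i] in the derivative of the [i]-th
    power, as [i <= 2 ^ i]. In the induction, [(u - v) * b] and [v * (b - b')] each cost [N * d],
    which is what the factor [2 * s] supplies. The morphisms may differ because in two variables the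
    coefficients are themselves substituted at different points; [nuK2] then carries the doubled
    inner radius. *)
Lemma psubst_lip (nuK2 : K -> R) (hK2 : ring_norm nuK2)
    (f f' : {rmorphism K -> B}) b b' s d p : 0 < s ->
  nuB b <= s -> nuB b' <= s -> nuB (b - b') <= d ->
  (forall x, nuB (f x) <= nuK x) -> (forall x, nuB (f' x) <= nuK x) ->
  (forall x, nuK x <= nuK2 x) ->
  (forall x, nuB (f x - f' x) <= d / s * nuK2 x) ->
  nuB (psubst f b p - psubst f' b' p) <= d / s * pnorm nuK2 (2 * s) p.
Proof.
move=> s0 bs b's bb hf hf' hKK hff.
have d0 : 0 <= d := le_trans (rn_ge0 hB _) bb.
have ss : 0 <= 2 * s by rewrite mulr_ge0 // ltW.
elim/poly_ind: p => [|p c IH].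
  by rewrite !rmorph0 subr0 (rn_0 hB) pnorm0 mulr0.
rewrite !psubst_mulXaddC pnorm_mulXaddC //.
set u := psubst f b p in IH *; set v := psubst f' b' p in IH *.
have -> : u * b + f c - (v * b' + f' c) = (u - v) * b + (v * (b - b') + (f c - f' c)).
  by ring.
apply: le_trans (rn_D hB _ _) _; rewrite [leRHS]mulrDr.
set N := pnorm nuK2 (2 * s) p in IH *.
have hv : nuB v <= N.
  apply: le_trans (psubst_norm p b's hf') _.
  apply: (@le_trans _ _ (pnorm nuK2 s p)).
    apply: ler_sum => i _; rewrite ler_wpM2r //; by rewrite exprn_ge0 ?ltW.
  by apply: pnorm_le_radius; rewrite ?ltW // ltr_pMl // ltr1n.
have h1 : nuB ((u - v) * b) <= d / s * N * s.
  apply: le_trans (rn_M hB _ _) _; apply: ler_pM => //; exact: rn_ge0.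
have h2 : nuB (v * (b - b')) <= N * d.
  apply: le_trans (rn_M hB _ _) _; apply: ler_pM => //; exact: rn_ge0.
have h3 := rn_D hB (v * (b - b')) (f c - f' c).
have h4 := hff c.
have e : d / s * N * s = N * d by field; rewrite gt_eqF.
have e2 : d / s * (N * (2 * s)) = N * d + N * d by field; rewrite gt_eqF.
rewrite e in h1; rewrite e2; lra.
Qed.
End EvalNorm.

Section Eval2.
Variables (R : realFieldType) (K B : comNzRingType).
Variables (nuB : B -> R) (nuK : K -> R) (f : {rmorphism K -> B}).
Hypotheses (hB : ring_norm nuB) (hK : ring_norm nuK).
Implicit Types p : {poly {poly K}}.
Hypothesis hf : forall x, nuB (f x) <= nuK x.

Definition psubst2 (a b : B) : {poly {poly K}} -> B := psubst (psubst f b) a.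
HB.instance Definition _ a b := GRing.RMorphism.on (psubst2 a b).

Definition pnorm2 (r : R) : {poly {poly K}} -> R := pnorm (pnorm nuK r) r.

Lemma ring_norm_pnorm2 r : 0 <= r -> ring_norm (pnorm2 r).
Proof. by move=> r0; apply: ring_norm_pnorm => //; exact: ring_norm_pnorm. Qed.

Lemma psubst2_norm a b s p : nuB a <= s -> nuB b <= s ->
  nuB (psubst2 a b p) <= pnorm2 s p.
Proof.
move=> as_ bs; have s0 : 0 <= s by exact: le_trans (rn_ge0 hB b) bs.
apply: psubst_norm => //; first exact: ring_norm_pnorm.
by move=> x; apply: psubst_norm.
Qed.

Lemma psubst2_lip a b a' b' s d p : 0 < s ->
  nuB a <= s -> nuB b <= s -> nuB a' <= s -> nuB b' <= s ->
  nuB (a - a') <= d -> nuB (b - b') <= d ->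
  nuB (psubst2 a b p - psubst2 a' b' p) <= d / s * pnorm2 (2 * s) p.
Proof.
move=> s0 as_ bs a's b's da db; have s0' := ltW s0.
have d0 : 0 <= d := le_trans (rn_ge0 hB _) da.
have ss : 0 <= 2 * s by rewrite mulr_ge0.
apply: (@psubst_lip _ _ _ _ (pnorm nuK s)) => //.
- exact: ring_norm_pnorm.
- exact: ring_norm_pnorm.
- by move=> x; apply: psubst_norm.
- by move=> x; apply: psubst_norm.
- by move=> x; apply: pnorm_le_radius => //; rewrite ler_pMl // ler1n.
- move=> x; apply: (@psubst_lip _ _ _ _ nuK) => //.
  move=> c; rewrite subrr (rn_0 hB) mulr_ge0 ?(rn_ge0 hK) //.
  by rewrite divr_ge0.
Qed.

Lemma psubst2XZ a b : psubst2 a b 'X = a.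
Proof. exact: psubstX. Qed.
Lemma psubst2XW a b : psubst2 a b 'X%:P = b.
Proof. by rewrite /psubst2 psubstC /= psubstX. Qed.
Lemma psubst2C a b c : psubst2 a b c%:P%:P = f c.
Proof. by rewrite /psubst2 psubstC /= psubstC. Qed.

Lemma psubst2E a b (p : {poly {poly K}}) n : (size p <= n)%N ->
  (forall i, (size (p`_i)%R <= n)%N) ->
  psubst2 a b p = \sum_(i < n) \sum_(j < n) f p`_i`_j * a ^+ i * b ^+ j.
Proof.
move=> h1 h2; rewrite /psubst2 /psubst /horner_morph.
rewrite (@horner_coef_wide _ n); last by apply: leq_trans h1; exact: size_poly.
apply: eq_bigr => i _; rewrite coef_map /= /psubst /horner_morph.
rewrite (@horner_coef_wide _ n); last by apply: leq_trans (h2 i); exact: size_poly.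
rewrite big_distrl /=; apply: eq_bigr => j _; rewrite coef_map /=; ring.
Qed.
End Eval2.

Lemma pnorm2_coef (R : realFieldType) (K : comNzRingType) (nuK : K -> R) :
  ring_norm nuK -> forall (r : R) (p : {poly {poly K}}) i j, 0 <= r ->
  nuK p`_i`_j * r ^+ (i + j) <= pnorm2 nuK r p.
Proof.
move=> hK r p i j r0; apply: le_trans (pnorm_coef _ r0 p i); last exact: ring_norm_pnorm.
rewrite exprD mulrCA mulrC ler_wpM2r ?exprn_ge0 //.
exact: (pnorm_coef hK r0 p`_i j).
Qed.

Lemma psubst_rmorph (K B B' : comNzRingType) (f : {rmorphism K -> B})
  (f' : {rmorphism K -> B'}) (g : {rmorphism B -> B'}) b p :
  (forall c, g (f c) = f' c) -> g (psubst f b p) = psubst f' (g b) p.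
Proof.
move=> h; elim/poly_ind: p => [|p c IH]; first by rewrite !rmorph0.
by rewrite !psubst_mulXaddC rmorphD rmorphM /= IH h.
Qed.

Lemma psubst2_rmorph (K B B' : comNzRingType) (f : {rmorphism K -> B})
  (f' : {rmorphism K -> B'}) (g : {rmorphism B -> B'}) a b p :
  (forall c, g (f c) = f' c) -> g (psubst2 f a b p) = psubst2 f' (g a) (g b) p.
Proof. by move=> h; apply: psubst_rmorph => q; apply: psubst_rmorph. Qed.

(** * Polynomials in a complex variable and its conjugate *)

Section ComplexNorm.
Variable R : rcfType.
Local Notation C := R[i].

(** The l1 norm takes values in [R], is submultiplicative and is accessible to linear arithmetic. It
    is not invariant under rotations, which costs a factor 2 on each circle below. *)
Definition cnorm (x : C) : R := `|complex.Re x| + `|complex.Im x|.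

Lemma ring_norm_cnorm : ring_norm cnorm.
Proof.
split; rewrite /cnorm.
- by move=> x; rewrite addr_ge0.
- by rewrite /= normr0 addr0.
- by rewrite /= normr1 normr0 addr0.
- by case=> a b /=; rewrite !normrN.
- move=> [a b] [c d] /=; have := ler_normD a c; have := ler_normD b d; lra.
- move=> [a b] [c d] /=.
  have := ler_normB (a * c) (b * d); have := ler_normD (a * d) (b * c).
  rewrite !normrM; nra.
Qed.

Lemma cnorm_conj x : cnorm (conjc x) = cnorm x.
Proof. by case: x => a b; rewrite /cnorm /= normrN. Qed.

Lemma cnorm_real (a : R) : cnorm (real_complex R a) = `|a|.
Proof. by rewrite /cnorm /= normr0 addr0. Qed.

Lemma cnorm_eq0 x : cnorm x = 0 -> x = 0.
Proof.
case: x => a b; rewrite /cnorm /= => h.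
have := normr_ge0 a; have := normr_ge0 b => hb ha.
have a0 : `|a| = 0 by lra.
have b0 : `|b| = 0 by lra.
by move: a0 b0 => /eqP; rewrite normr_eq0 => /eqP -> /eqP; rewrite normr_eq0 => /eqP ->.
Qed.

Lemma Re_le_cnorm x : `|complex.Re x| <= cnorm x.
Proof. by rewrite /cnorm lerDl. Qed.
Lemma Im_le_cnorm x : `|complex.Im x| <= cnorm x.
Proof. by rewrite /cnorm lerDr. Qed.

Local Notation P := {poly {poly C}}.
Implicit Types (p q : P) (x y c : C).

Definition wnorm (r : R) : P -> R := pnorm2 cnorm r.

Lemma ring_norm_wnorm r : 0 <= r -> ring_norm (wnorm r).
Proof. by move=> r0; exact: ring_norm_pnorm2 ring_norm_cnorm _ r0. Qed.

Lemma wnormE r (p : P) n : 0 <= r -> (size p <= n)%N ->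
  (forall i, (size (p`_i)%R <= n)%N) ->
  wnorm r p = \sum_(i < n) \sum_(j < n) cnorm p`_i`_j * r ^+ i * r ^+ j.
Proof.
move=> r0 h1 h2; rewrite /wnorm /pnorm2 (@pnorm_widen _ _ _ _ r p n) //; last first.
  by apply: ring_norm_pnorm => //; exact: ring_norm_cnorm.
apply: eq_bigr => i _; rewrite (@pnorm_widen _ _ _ _ r p`_i n) //; last exact: ring_norm_cnorm.
by rewrite big_distrl; apply: eq_bigr => j _; rewrite /= mulrAC.
Qed.

Lemma wnorm_coef r (p : P) i j : 0 <= r -> cnorm p`_i`_j * r ^+ (i + j) <= wnorm r p.
Proof. by move=> r0; apply: pnorm2_coef => //; exact: ring_norm_cnorm. Qed.

Lemma wnorm_le_radius r s p : 0 <= r -> r <= s -> wnorm r p <= wnorm s p.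
Proof.
move=> r0 rs; apply: (@le_trans _ _ (pnorm (pnorm cnorm r) s p)).
  apply: pnorm_le_radius => //; apply: ring_norm_pnorm => //; exact: ring_norm_cnorm.
apply: ler_sum => i _; rewrite ler_wpM2r ?exprn_ge0 ?(le_trans r0) //.
by apply: pnorm_le_radius => //; exact: ring_norm_cnorm.
Qed.

Lemma wnorm_le_coef r (p q : P) (k : R) : 0 <= r -> 0 <= k ->
  (forall i j, cnorm p`_i`_j <= k * cnorm q`_i`_j) -> wnorm r p <= k * wnorm r q.
Proof.
move=> r0 k0 H; apply: pnorm_le_coef => //.
  by apply: ring_norm_pnorm => //; exact: ring_norm_cnorm.
by move=> i; apply: pnorm_le_coef => //; exact: ring_norm_cnorm.
Qed.

(** The real structure: where the second variable is the conjugate of the first, [star p] takes the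
    conjugate value ([ev_star]). *)
Definition star (p : P) : P := swapXY (map_poly (map_poly conjc) p).
HB.instance Definition _ := GRing.RMorphism.copy star
  (swapXY \o map_poly (map_poly (@conjc R))).

Lemma coef_star p i j : (star p)`_i`_j = conjc p`_j`_i.
Proof. by rewrite /star coef_swapXY !coef_map. Qed.

Lemma poly2_bound (p : P) : exists n, (size p <= n)%N /\ forall i, (size (p`_i)%R <= n)%N.
Proof.
exists (maxn (size p) (\max_(i < size p) size (p`_i)%R)); split; first exact: leq_maxl.
move=> i; have [h|h] := ltnP i (size p); last by rewrite nth_default ?size_poly0.
apply: leq_trans (leq_maxr _ _); exact: (@leq_bigmax _ (fun i : 'I__ => size (p`_i)%R) (Ordinal h)).
Qed.

Lemma wnorm_star r p : 0 <= r -> wnorm r (star p) = wnorm r p.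
Proof.
move=> r0; have [n1 [h1 h1']] := poly2_bound p.
have [n2 [h2 h2']] := poly2_bound (star p).
set n := maxn n1 n2.
rewrite (@wnormE r p n) //; [|by apply: leq_trans h1 _; exact: leq_maxl
  |by move=> i; apply: leq_trans (h1' i) _; exact: leq_maxl].
rewrite (@wnormE r (star p) n) //; [|by apply: leq_trans h2 _; exact: leq_maxr
  |by move=> i; apply: leq_trans (h2' i) _; exact: leq_maxr].
rewrite exchange_big /=; apply: eq_bigr => i _; apply: eq_bigr => j _.
by rewrite coef_star cnorm_conj mulrAC.
Qed.

Lemma starX : star 'X = 'X%:P.
Proof. by rewrite /star map_polyX swapXY_X. Qed.

Definition cscale (c : nat -> nat -> R) (p : P) : P :=
  \poly_(i < size p) \poly_(j < size (p`_i)%R) (real_complex R (c i j) * p`_i`_j).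

Lemma coef_cscale (c : nat -> nat -> R) p i j : (cscale c p)`_i`_j = real_complex R (c i j) * p`_i`_j.
Proof.
rewrite coef_poly; case: ltnP => h; last by rewrite coef0 (nth_default 0 h) coef0 mulr0.
by rewrite coef_poly; case: ltnP => h'; rewrite // (nth_default _ h') mulr0.
Qed.

Lemma poly2P (p q : P) : (forall i j, p`_i`_j = q`_i`_j) -> p = q.
Proof. by move=> h; apply/polyP => i; apply/polyP => j. Qed.

Lemma cscale_is_additive (c : nat -> nat -> R) : additive (cscale c).
Proof.
by move=> p q; apply: poly2P => i j; rewrite coef_cscale !coefB !coef_cscale mulrBr.
Qed.
HB.instance Definition _ (c : nat -> nat -> R) := GRing.isAdditive.Build P P (cscale c) (cscale_is_additive c).

Lemma wnorm_cscale r (c : nat -> nat -> R) k p : 0 <= r -> 0 <= k -> (forall i j, `|c i j| <= k) ->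
  wnorm r (cscale c p) <= k * wnorm r p.
Proof.
move=> r0 k0 h; apply: wnorm_le_coef => // i j; rewrite coef_cscale.
apply: le_trans (rn_M ring_norm_cnorm _ _) _.
by rewrite cnorm_real ler_wpM2r // (rn_ge0 ring_norm_cnorm).
Qed.

(* In polar coordinates [z = r e^(i t)] and [w = r e^(-i t)], so that the
   derivation [d/dt] multiplies the coefficient of [z^i w^j] by [i - j]
   (times the imaginary unit); the coefficients with [i = j + 1] are resonant. *)
Definition freq i j : R := i%:R - j%:R.
Definition angular : P -> P := cscale freq.
Definition resonant : P -> P := cscale (fun i j => (i == j.+1)%:R).
Definition homological_inv : P -> P :=
  cscale (fun i j => if i == j.+1 then 0 else (freq i j - 1)^-1).
HB.instance Definition _ := GRing.Additive.copy angular (cscale freq).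
HB.instance Definition _ := GRing.Additive.copy resonant (cscale (fun i j => (i == j.+1)%:R)).
HB.instance Definition _ := GRing.Additive.copy homological_inv
  (cscale (fun i j => if i == j.+1 then 0 else (freq i j - 1)^-1)).

(** The number is a nonzero integer; this is the absence of small divisors. *)
Lemma freq_abs i j : i != j.+1 -> 1 <= `|freq i j - 1|.
Proof.
move=> ij; rewrite /freq.
have -> : i%:R - j%:R - 1 = (i%:Z - j.+1%:Z)%:~R :> R.
  by rewrite rmorphB /= -!pmulrn -natr1; ring.
rewrite -intr_norm -[1]/(1%:~R) ler_int.
have : (i%:Z - j.+1%:Z) != 0 by rewrite subr_eq0 eqz_nat.
by rewrite -normr_gt0 -gtz0_ge1.
Qed.

(** [angular - 1] is the left-hand side of the linearised conjugacy equation at ['X], as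
    [angular 'X = 'X]. It is diagonal on monomials, and its kernel is spanned by the resonant ones,
    on which [homological_inv] is set to 0. *)
Lemma homological_invK p :
  angular (homological_inv p) - homological_inv p = p - resonant p.
Proof.
apply: poly2P => i j; rewrite !coefB !coef_cscale.
case: eqP => [->|/eqP ij].
  by rewrite rmorph0 rmorph1 !mul0r mulr0 mul1r !subrr.
rewrite rmorph0 mul0r subr0 mulrA -mulrBl -rmorphM -rmorphB /=.
have -> : freq i j * (freq i j - 1)^-1 - (freq i j - 1)^-1 = 1.
  rewrite -{2}[(_ - 1)^-1]mul1r -mulrBl mulfV //.
  by rewrite -normr_gt0; apply: lt_le_trans (freq_abs ij).
by rewrite rmorph1 mul1r.
Qed.

Lemma wnorm_homological_inv r p : 0 <= r -> wnorm r (homological_inv p) <= wnorm r p.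
Proof.
move=> r0; rewrite -[leRHS]mul1r; apply: wnorm_cscale => // i j.
case: eqP => [_|/eqP ij]; first by rewrite normr0.
rewrite normfV invf_le1 ?freq_abs //.
by apply: lt_le_trans (freq_abs ij).
Qed.

Lemma wnorm_resonant r p : 0 <= r -> wnorm r (resonant p) <= wnorm r p.
Proof.
move=> r0; rewrite -[leRHS]mul1r; apply: wnorm_cscale => // i j.
by case: eqP; rewrite ?normr1 ?normr0.
Qed.

(** Division by [z], meant for resonant polynomials: each [z ^ (j + 1) w ^ j] is [z] times a power
    of [z w], that is, of the squared modulus. *)
Definition zdiv (p : P) : P := drop_poly 1 p.

Lemma zdivK p : p`_0 = 0 -> zdiv p * 'X = p.
Proof.
move=> h; rewrite -[RHS](poly_take_drop 1) expr1 /zdiv.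
suff -> : take_poly 1 p = 0 by rewrite add0r.
apply/polyP => i; rewrite coef_take_poly coef0; case: i => [|i] //=.
Qed.

Lemma zdiv_is_additive : additive zdiv.
Proof. by move=> p q; rewrite /zdiv linearB. Qed.
HB.instance Definition _ := GRing.isAdditive.Build P P zdiv zdiv_is_additive.

Lemma coef_zdiv p i : (zdiv p)`_i = p`_i.+1.
Proof. by rewrite /zdiv coef_drop_poly addn1. Qed.

Lemma resonant0 p : (resonant p)`_0 = 0.
Proof. by apply/polyP => j; rewrite coef_cscale /= rmorph0 mul0r coef0. Qed.

Lemma wnorm_mulX r p : 0 <= r -> wnorm r (p * 'X) = wnorm r p * r.
Proof.
move=> r0; apply: pnormMX => //.
by apply: ring_norm_pnorm => //; exact: ring_norm_cnorm.
Qed.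

(** Dividing by [z] costs [1 / r]; the weight [s] in [nf_dist] compensates for it. *)
Lemma wnorm_zdiv_resonant r p : 0 < r -> wnorm r (zdiv (resonant p)) <= wnorm r p / r.
Proof.
move=> r0; rewrite ler_pdivlMr // -(wnorm_mulX _ (ltW r0)) (zdivK (resonant0 p)).
exact: wnorm_resonant (ltW r0).
Qed.

Lemma wnormX r : 0 <= r -> wnorm r 'X <= r.
Proof.
move=> r0; apply: pnormX => //.
by apply: ring_norm_pnorm => //; exact: ring_norm_cnorm.
Qed.

Lemma angularD p q : angular (p + q) = angular p + angular q.
Proof. exact: raddfD. Qed.
Lemma angularX : angular 'X = 'X.
Proof.
apply: poly2P => i j; rewrite coef_cscale /freq coefX.
case: eqP => [->|_]; last by rewrite coef0 mulr0.
by rewrite coef1; case: eqP => [->|_]; rewrite ?mulr0 // subr0 rmorph1 mul1r.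
Qed.
Lemma homological_invB p q : homological_inv (p - q) = homological_inv p - homological_inv q.
Proof. exact: raddfB. Qed.
Lemma zdiv_resonantB p q : zdiv (resonant (p - q)) = zdiv (resonant p) - zdiv (resonant q).
Proof. by rewrite (raddfB (cscale (fun i j => (i == j.+1)%:R))) (raddfB zdiv). Qed.

Definition PC : C -> P := polyC \o polyC.
HB.instance Definition _ := GRing.RMorphism.copy PC (polyC \o polyC).

Lemma wnormC r c : 0 <= r -> wnorm r (PC c) = cnorm c.
Proof.
move=> r0; have hn := ring_norm_pnorm ring_norm_cnorm r0.
by rewrite /wnorm /pnorm2 (pnormC hn) (pnormC ring_norm_cnorm).
Qed.

(* A polynomial map of the plane is given by its first component [p] in the
   coordinates [(z, w)], the second one being [star p]. *)
Definition scomp (q p : P) : P := psubst2 PC q (star q) p.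
HB.instance Definition _ q := GRing.RMorphism.copy (scomp q) (psubst2 PC q (star q)).

Lemma scompB q p p' : scomp q (p - p') = scomp q p - scomp q p'.
Proof. exact: rmorphB. Qed.

(** Restriction to the real plane, where the second variable is the conjugate of the first. *)
Definition ev (x : C) (p : P) : C := psubst2 idfun x (conjc x) p.
HB.instance Definition _ x := GRing.RMorphism.copy (ev x) (psubst2 idfun x (conjc x)).

Lemma evB x p q : ev x (p - q) = ev x p - ev x q. Proof. exact: rmorphB. Qed.
Lemma evD x p q : ev x (p + q) = ev x p + ev x q. Proof. exact: rmorphD. Qed.
Lemma evN x p : ev x (- p) = - ev x p. Proof. exact: rmorphN. Qed.
Lemma evM x p q : ev x (p * q) = ev x p * ev x q. Proof. exact: rmorphM. Qed.
Lemma ev1 x : ev x 1 = 1. Proof. exact: rmorph1. Qed.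
Lemma ev0 x : ev x 0 = 0. Proof. exact: rmorph0. Qed.

Lemma wnorm_scomp r s q p : 0 <= r -> wnorm r q <= s -> wnorm r (scomp q p) <= wnorm s p.
Proof.
move=> r0 h; apply: psubst2_norm => //.
- exact: ring_norm_wnorm.
- exact: ring_norm_cnorm.
- by move=> x; rewrite wnormC.
- by rewrite wnorm_star.
Qed.

Lemma scomp_lip r s d q q' p : 0 <= r -> 0 < s -> wnorm r q <= s -> wnorm r q' <= s ->
  wnorm r (q - q') <= d ->
  wnorm r (scomp q p - scomp q' p) <= d / s * wnorm (2 * s) p.
Proof.
move=> r0 s0 h h' hd; apply: psubst2_lip => //.
- exact: ring_norm_wnorm.
- exact: ring_norm_cnorm.
- by move=> x; rewrite wnormC.
- by rewrite wnorm_star.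
- by rewrite wnorm_star.
- by rewrite -rmorphB wnorm_star.
Qed.

Lemma ev_norm x s p : cnorm x <= s -> cnorm (ev x p) <= wnorm s p.
Proof.
move=> h; apply: psubst2_norm => //.
- exact: ring_norm_cnorm.
- exact: ring_norm_cnorm.
- by rewrite cnorm_conj.
Qed.

Lemma ev_lip x y s p : 0 < s -> cnorm x <= s -> cnorm y <= s ->
  cnorm (ev x p - ev y p) <= cnorm (x - y) / s * wnorm (2 * s) p.
Proof.
move=> s0 h h'; apply: psubst2_lip => //.
- exact: ring_norm_cnorm.
- exact: ring_norm_cnorm.
- by rewrite cnorm_conj.
- by rewrite cnorm_conj.
- by rewrite -rmorphB cnorm_conj.
Qed.

Lemma evX x : ev x 'X = x.
Proof. exact: psubst2XZ. Qed.
Lemma evC x c : ev x (PC c) = c.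
Proof. exact: psubst2C. Qed.

Lemma evE x (p : P) n : (size p <= n)%N -> (forall i, (size (p`_i)%R <= n)%N) ->
  ev x p = \sum_(i < n) \sum_(j < n) p`_i`_j * x ^+ i * conjc x ^+ j.
Proof. by move=> h1 h2; rewrite /ev (@psubst2E _ _ _ _ _ _ n). Qed.

Lemma ev_star x p : ev x (star p) = conjc (ev x p).
Proof.
have [n1 [h1 h1']] := poly2_bound p.
have [n2 [h2 h2']] := poly2_bound (star p).
set n := maxn n1 n2.
rewrite (@evE x p n) //; [|by apply: leq_trans h1 _; exact: leq_maxl
  |by move=> i; apply: leq_trans (h1' i) _; exact: leq_maxl].
rewrite (@evE x (star p) n) //; [|by apply: leq_trans h2 _; exact: leq_maxr
  |by move=> i; apply: leq_trans (h2' i) _; exact: leq_maxr].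
rewrite exchange_big rmorph_sum /=; apply: eq_bigr => i _.
rewrite rmorph_sum; apply: eq_bigr => j _ /=.
by rewrite coef_star !rmorphM !rmorphXn /= conjcK; ring.
Qed.

Lemma ev_scomp x q p : ev x (scomp q p) = ev (ev x q) p.
Proof.
rewrite /scomp (@psubst2_rmorph _ _ _ PC idfun (ev x)); last exact: evC.
by rewrite /= ev_star.
Qed.

End ComplexNorm.

(** * The normal form iteration *)

Lemma half_ge0 (R : realFieldType) n : 0 <= 2^-1 ^+ n :> R.
Proof. by rewrite exprn_ge0 // invr_ge0. Qed.

(** Any [c] with [c / 4 + A <= c / 2] propagates the bound [c * 2^-1 ^+ n], and [D + 4 * A] is such
    a value above [d 0]. The ratio 1/4, smaller than that of the source term, is what preserves the
    rate 1/2. *)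
Lemma perturbed_contraction (R : realFieldType) (d : nat -> R) (D A : R) :
  0 <= D -> 0 <= A -> d 0%N <= D ->
  (forall n, d n.+1 <= d n / 4 + A * 2^-1 ^+ n) ->
  forall n, d n <= (D + 4 * A) * 2^-1 ^+ n.
Proof.
move=> D0 A0 d0 H; elim=> [|n IH]; first by rewrite expr0; lra.
apply: le_trans (H n) _; rewrite exprS.
have h := half_ge0 R n.
set e := 2^-1 ^+ n in IH h *.
have De : 0 <= D * e by rewrite mulr_ge0.
have -> : (D + 4 * A) * (2^-1 * e) = (D * e) / 2 + 2 * (A * e) by field.
have IH' : d n <= D * e + 4 * (A * e) by apply: le_trans IH _; rewrite mulrDl mulrA.
lra.
Qed.

Section NormalForm.
Variable R : rcfType.
Local Notation C := R[i].
Local Notation P := {poly {poly C}}.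
Implicit Types (p q : P) (r s : R).

(** Asking the bound at all radii [s <= r] encodes vanishing to second order, with a constant that a
    whole sequence of polynomials can share. *)
Definition quadratic (K r : R) (p : P) : Prop :=
  forall s, 0 < s -> s <= r -> wnorm s p <= K * s ^+ 2.

Definition geometric (r A : R) (u : nat -> P) : Prop :=
  forall n, wnorm r (u n.+1 - u n) <= A * 2^-1 ^+ n.

(** From radius [2 * s], [scomp_lip] evaluates [p] at [4 * s], whence the side condition; the
    constant is [K * (4 * s) ^+ 2 / (2 * s)]. *)
Lemma quadratic_lip K r p s q q' : quadratic K r p -> 0 < s -> 4 * s <= r ->
  wnorm s q <= 2 * s -> wnorm s q' <= 2 * s ->
  wnorm s (scomp q p - scomp q' p) <= 8 * K * s * wnorm s (q - q').
Proof.
move=> hp s0 sr hq hq'.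
apply: le_trans (scomp_lip p (ltW s0) _ hq hq' (lexx _)) _; first lra.
have h : wnorm (2 * (2 * s)) p <= K * (2 * (2 * s)) ^+ 2 by apply: hp; lra.
have d0 : 0 <= wnorm s (q - q') by apply: rn_ge0; apply: ring_norm_wnorm; lra.
have -> : 8 * K * s * wnorm s (q - q') =
   wnorm s (q - q') / (2 * s) * (K * (2 * (2 * s)) ^+ 2).
  by field; rewrite gt_eqF.
by rewrite ler_wpM2l // divr_ge0 //; lra.
Qed.

Lemma geometric_le_radius r s A u : 0 <= s -> s <= r -> geometric r A u -> geometric s A u.
Proof. by move=> s0 sr h n; apply: le_trans (wnorm_le_radius _ s0 sr) _. Qed.

(* With [phi = 'X + x.1] and [mu = x.2], a fixed point of [nf_step] solves the
   conjugacy equation [angular phi = (1 + mu) * (phi + F o phi)]. The resonant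
   terms are absorbed in the time change [mu], which involves only the products
   [z ^ j w ^ j]; as the other divisors have modulus at least 1, the iteration
   is a contraction on a fixed polydisc. *)
Definition nf_rhs (F : P) (x : P * P) : P :=
  (1 + x.2) * scomp ('X + x.1) F + x.2 * x.1.

Definition nf_step (F : P) (x : P * P) : P * P :=
  (homological_inv (nf_rhs F x), - zdiv (resonant (nf_rhs F x))).

Fixpoint nf_seq (F : nat -> P) n : P * P :=
  if n is n'.+1 then nf_step (F n') (nf_seq F n') else (0, 0).

Variables (K r1 A : R) (F : nat -> P).
Hypotheses (K0 : 0 < K) (A0 : 0 <= A).
Hypothesis F_quad : forall n, quadratic K r1 (F n).
Hypothesis F_geo : geometric r1 A F.

(** The displacement has order 2 and the time factor order 1, being a resonant part divided by [z].
    One step produces at most [5.25 * K * s ^+ 2], so 16 leaves room. *)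
Definition nf_ball s (x : P * P) : Prop :=
  wnorm s x.1 <= 16 * K * s ^+ 2 /\ wnorm s x.2 <= 16 * K * s.

Section Radius.
Variable s : R.
Hypotheses (s0 : 0 < s) (s1 : 4 * s <= r1) (s2 : 256 * (K * s) <= 1).

Ltac radius_facts := have := s0; have := s1; have := s2; have := K0; have := A0; move=> ? ? ? ? ?.

Let hW : ring_norm (@wnorm R s) := ring_norm_wnorm (ltW s0).

Lemma nf_ball_small (x : P * P) : nf_ball s x ->
  [/\ wnorm s x.1 <= s / 16, wnorm s x.2 <= 16^-1 & wnorm s ('X + x.1) <= 2 * s].
Proof.
radius_facts; case=> h1 h2; have hX := wnormX (ltW s0).
have h1' : wnorm s x.1 <= s / 16.
  apply: le_trans h1 _; have -> : 16 * K * s ^+ 2 = s * (16 * (K * s)) by ring.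
  have e : 16 * (K * s) <= 16^-1 by lra.
  by apply: ler_wpM2l => //; exact: ltW.
split => //; first by apply: le_trans h2 _; lra.
by apply: le_trans (rn_D hW _ _) _; lra.
Qed.

Lemma nf_rhs_norm n x : nf_ball s x -> wnorm s (nf_rhs (F n) x) <= 16 * K * s ^+ 2.
Proof.
radius_facts; move=> hx; have [h1 h2 h3] := nf_ball_small hx; case: hx => h1' h2'.
have hH : wnorm s (scomp ('X + x.1) (F n)) <= K * (2 * s) ^+ 2.
  apply: le_trans (wnorm_scomp (F n) (ltW s0) h3) _; apply: F_quad; lra.
have hm : wnorm s (1 + x.2) <= 1 + 16^-1.
  by apply: le_trans (rn_D hW _ _) _; rewrite lerD // (rn_1 hW).
have e1 : wnorm s ((1 + x.2) * scomp ('X + x.1) (F n)) <= (1 + 16^-1) * (K * (2 * s) ^+ 2).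
  by apply: le_trans (rn_M hW _ _) _; apply: ler_pM => //; exact: (rn_ge0 hW).
have e2 : wnorm s (x.2 * x.1) <= 16^-1 * (16 * K * s ^+ 2).
  by apply: le_trans (rn_M hW _ _) _; apply: ler_pM => //; exact: (rn_ge0 hW).
apply: le_trans (rn_D hW _ _) _.
have : 0 <= K * s ^+ 2 by rewrite mulr_ge0 ?exprn_ge0 // ltW.
by move: e1 e2; rewrite exprMn; set ks := s ^+ 2; nra.
Qed.

Lemma nf_step_ball n x : nf_ball s x -> nf_ball s (nf_step (F n) x).
Proof.
radius_facts; move=> hx; have h := nf_rhs_norm n hx; split=> /=.
  by apply: le_trans (wnorm_homological_inv _ (ltW s0)) _.
rewrite (rn_N hW); apply: le_trans (wnorm_zdiv_resonant _ s0) _.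
by rewrite ler_pdivrMr // (_ : 16 * K * s * s = 16 * K * s ^+ 2) //; ring.
Qed.

Lemma nf_seq_ball n : nf_ball s (nf_seq F n).
Proof.
radius_facts; elim: n => [|n IH] /=; last exact: nf_step_ball.
by split; rewrite /= (rn_0 hW) ?mulr_ge0 ?exprn_ge0 ?ltW.
Qed.

Definition nf_dist (x y : P * P) : R := wnorm s (x.1 - y.1) + s * wnorm s (x.2 - y.2).

(** The difference of products is split so that a small factor appears in each term: [H + x.1] is of
    order [K * s ^+ 2], the Lipschitz constant of [scomp] is [8 * K * s], and [y.2] is at most
    [16 * K * s]. With [256 * (K * s) <= 1], both parts of [nf_dist] receive a coefficient of at
    most 1/8. *)
Lemma nf_rhs_lip n x y : nf_ball s x -> nf_ball s y ->
  wnorm s (nf_rhs (F n) x - nf_rhs (F n) y) <= nf_dist x y / 8.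
Proof.
have fin (b c : R) : 0 <= c -> c * (20 / 256) + b * (1 / 8) <= (b + c) / 8 by lra.
radius_facts; have K20 : 20 * (K * s) <= 20 / 256 by lra.
have K32 : 32 * (K * s) <= 1 / 8 by lra.
move=> hx hy; have [hx1 hx2 hx3] := nf_ball_small hx; have [hy1 hy2 hy3] := nf_ball_small hy.
have hlip := quadratic_lip (F_quad n) s0 s1 hx3 hy3.
have hH : wnorm s (scomp ('X + x.1) (F n)) <= K * (2 * s) ^+ 2.
  apply: le_trans (wnorm_scomp (F n) (ltW s0) hx3) _; apply: F_quad; lra.
have e : 'X + x.1 - ('X + y.1) = x.1 - y.1 by ring.
rewrite e in hlip.
rewrite /nf_rhs /nf_dist.
set H := scomp _ _ in hH hlip *; set H' := scomp _ _ in hlip *.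
have -> : (1 + x.2) * H + x.2 * x.1 - ((1 + y.2) * H' + y.2 * y.1)
  = (x.2 - y.2) * (H + x.1) + ((1 + y.2) * (H - H') + y.2 * (x.1 - y.1)) by ring.
have a0 := rn_ge0 hW (x.1 - y.1); have b0 := rn_ge0 hW (x.2 - y.2).
set a := wnorm s (x.1 - y.1) in a0 hlip *; set b := wnorm s (x.2 - y.2) in b0 *.
have Ks : 0 < K * s by rewrite mulr_gt0.
have f1 : wnorm s ((x.2 - y.2) * (H + x.1)) <= b * (20 * (K * s ^+ 2)).
  apply: le_trans (rn_M hW _ _) _; rewrite ler_wpM2l //.
  apply: le_trans (rn_D hW _ _) _; have := hx.1; move: hH; rewrite exprMn; lra.
have f2 : wnorm s ((1 + y.2) * (H - H')) <= 2 * (8 * K * s * a).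
  apply: le_trans (rn_M hW _ _) _; apply: ler_pM => //; try exact: (rn_ge0 hW).
  by apply: le_trans (rn_D hW _ _) _; have := rn_1 hW; lra.
have f3 : wnorm s (y.2 * (x.1 - y.1)) <= 16 * K * s * a.
  by apply: le_trans (rn_M hW _ _) _; apply: ler_wpM2r => //; exact: hy.2.
have g1 := rn_D hW ((x.2 - y.2) * (H + x.1)) ((1 + y.2) * (H - H') + y.2 * (x.1 - y.1)).
have g2 := rn_D hW ((1 + y.2) * (H - H')) (y.2 * (x.1 - y.1)).
have sb : 0 <= s * b by rewrite mulr_ge0 // ltW.
have k1 : b * (20 * (K * s ^+ 2)) <= (s * b) * (20 / 256).
  rewrite (_ : b * _ = (s * b) * (20 * (K * s))); last by ring.
  exact: ler_wpM2l.
have k2 : a * (32 * (K * s)) <= a * (1 / 8) by exact: ler_wpM2l.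
have f1' := le_trans f1 k1.
have f23 : 2 * (8 * K * s * a) + 16 * K * s * a <= a * (1 / 8).
  by rewrite (_ : _ + _ = a * (32 * (K * s))) //; ring.
apply: le_trans g1 (le_trans (lerD f1' (le_trans g2 (le_trans (lerD f2 f3) f23))) _).
exact: fin.
Qed.

Lemma nf_rhs_geo n x : nf_ball s x ->
  wnorm s (nf_rhs (F n.+1) x - nf_rhs (F n) x) <= 2 * A * 2^-1 ^+ n.
Proof.
radius_facts; move=> hx; have [h1 h2 h3] := nf_ball_small hx.
have -> : nf_rhs (F n.+1) x - nf_rhs (F n) x = (1 + x.2) * scomp ('X + x.1) (F n.+1 - F n).
  rewrite scompB /nf_rhs; set a := scomp _ _; set b := scomp _ _.
  by ring.
apply: le_trans (rn_M hW _ _) _; rewrite -mulrA; apply: ler_pM; try exact: (rn_ge0 hW).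
  by apply: le_trans (rn_D hW _ _) _; have := rn_1 hW; lra.
apply: le_trans (wnorm_scomp _ (ltW s0) h3) _.
by apply: (geometric_le_radius _ _ F_geo); lra.
Qed.

(** The nonresonant and the resonant part each cost one copy of the norm, the weight [s] cancelling
    the [1 / s] of the division by [z]. The factor 2 turns the 1/8 of [nf_rhs_lip] into the 1/4 of
    [perturbed_contraction]. *)
Lemma nf_step_dist p q :
  nf_dist (homological_inv p, - zdiv (resonant p)) (homological_inv q, - zdiv (resonant q))
  <= 2 * wnorm s (p - q).
Proof.
radius_facts; rewrite /nf_dist [_.1]/= [_.1]/= [_.2]/= [_.2]/=.
rewrite -opprD (rn_N hW) -homological_invB -zdiv_resonantB.
have h1 := wnorm_homological_inv (p - q) (ltW s0).
have h2 := wnorm_zdiv_resonant (p - q) s0.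
rewrite ler_pdivlMr // in h2; rewrite mulrC in h2; lra.
Qed.

Lemma nf_seq_dist n : nf_dist (nf_seq F n.+1) (nf_seq F n) <= (s + 16 * A) * 2^-1 ^+ n.
Proof.
have fin (x y z d e : R) : x <= d / 8 -> y <= 2 * A * e -> z <= x + y -> 2 * z <= d / 4 + 4 * A * e.
  by lra.
radius_facts; have -> : s + 16 * A = s + 4 * (4 * A) by ring.
apply: (@perturbed_contraction R (fun n => nf_dist (nf_seq F n.+1) (nf_seq F n))).
- exact: ltW.
- by rewrite mulr_ge0.
- have [h1 h2 _] := nf_ball_small (nf_seq_ball 1%N).
  by rewrite /nf_dist [nf_seq F 0%N]/= !subr0; nra.
move=> k; set x := nf_seq F k.
have hx : nf_ball s x := nf_seq_ball k; have hx' := nf_seq_ball k.+1.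
rewrite -[nf_seq F k.+2]/(nf_step (F k.+1) (nf_seq F k.+1)).
rewrite -[X in nf_dist _ X]/(nf_step (F k) x).
apply: le_trans (nf_step_dist _ _) _.
have h1 := nf_rhs_lip k.+1 hx' hx; have h2 := nf_rhs_geo k hx.
have h3 := rn_D hW (nf_rhs (F k.+1) (nf_seq F k.+1) - nf_rhs (F k.+1) x)
  (nf_rhs (F k.+1) x - nf_rhs (F k) x).
rewrite subrKA in h3; move: h1 h2 h3.
by move=> h1 h2 h3; exact: fin h1 h2 h3.
Qed.

Lemma nf_seq_geo1 : geometric s (s + 16 * A) (fun n => (nf_seq F n).1).
Proof.
radius_facts; move=> n; apply: le_trans (nf_seq_dist n); rewrite /nf_dist lerDl mulr_ge0 ?(rn_ge0 hW) //.
exact: ltW.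
Qed.

Lemma nf_seq_geo2 : geometric s ((s + 16 * A) / s) (fun n => (nf_seq F n).2).
Proof.
radius_facts; move=> n; rewrite mulrAC ler_pdivlMr // mulrC.
apply: le_trans (nf_seq_dist n); rewrite /nf_dist lerDr; exact: (rn_ge0 hW).
Qed.

(** The conjugacy equation holds exactly at each stage, up to a shift of index: the resonant
    remainder left by [homological_invK] is, up to sign, the new time factor multiplied back by
    ['X]. *)
Lemma angular_nf_seq n : angular (nf_seq F n.+1).1 - (nf_seq F n.+1).1 =
  nf_rhs (F n) (nf_seq F n) + (nf_seq F n.+1).2 * 'X.
Proof. by rewrite /= homological_invK mulNr zdivK ?resonant0. Qed.

(** [angular] multiplies coefficients by unbounded integers, so [nf_seq_geo1] does not give this.
    The stage equation expresses [angular] through terms whose convergence is known, without any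
    loss of radius. *)
Lemma nf_seq_geo_angular :
  geometric s (5 * (s + 16 * A)) (fun n => angular (nf_seq F n.+1).1).
Proof.
have fin (b b1 b2 c d p q e E : R) : b <= c + b1 -> b1 <= p + b2 -> b2 <= q + d ->
    p <= e / 8 -> e <= E -> c + d <= E / 2 -> q <= E -> 0 <= E -> b <= 5 * E by lra.
radius_facts; move=> n; set D := s + 16 * A.
have D0 : 0 <= D by rewrite /D; lra.
have AD : 2 * A <= D by rewrite /D; lra.
have hd1 := nf_seq_dist n; have hd2 := nf_seq_dist n.+1.
have e0 := half_ge0 R n.
have eE : 2^-1 ^+ n.+1 = 2^-1 ^+ n / 2 :> R by rewrite exprS mulrC.
have E k : angular (nf_seq F k.+1).1 = (nf_seq F k.+1).1 +
   (nf_rhs (F k) (nf_seq F k) + (nf_seq F k.+1).2 * 'X).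
  by rewrite -angular_nf_seq; ring.
rewrite !E {E}.
set x := nf_seq F n in hd1 *; set y := nf_seq F n.+1 in hd1 hd2 *; set z := nf_seq F n.+2 in hd2 *.
have hx : nf_ball s x := nf_seq_ball n; have hy : nf_ball s y := nf_seq_ball n.+1.
have -> : z.1 + (nf_rhs (F n.+1) y + z.2 * 'X) - (y.1 + (nf_rhs (F n) x + y.2 * 'X))
  = (z.1 - y.1) + ((nf_rhs (F n.+1) y - nf_rhs (F n.+1) x) +
    ((nf_rhs (F n.+1) x - nf_rhs (F n) x) + (z.2 - y.2) * 'X)) by ring.
have t1 := rn_D hW (z.1 - y.1) ((nf_rhs (F n.+1) y - nf_rhs (F n.+1) x) +
    ((nf_rhs (F n.+1) x - nf_rhs (F n) x) + (z.2 - y.2) * 'X)).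
have t2 := rn_D hW (nf_rhs (F n.+1) y - nf_rhs (F n.+1) x)
    ((nf_rhs (F n.+1) x - nf_rhs (F n) x) + (z.2 - y.2) * 'X).
have t3 := rn_D hW (nf_rhs (F n.+1) x - nf_rhs (F n) x) ((z.2 - y.2) * 'X).
have h1 := nf_rhs_lip n.+1 hy hx; have h2 := nf_rhs_geo n hx.
have h3 := wnorm_mulX (z.2 - y.2) (ltW s0).
rewrite h3 [_ * s]mulrC in t3; rewrite eE [X in _ <= X]mulrA in hd2.
have k1 := le_trans h2 (ler_wpM2r e0 AD).
rewrite -mulrA; exact: (fin _ _ _ _ _ _ _ _ _ t1 t2 t3 h1 hd1 hd2 k1 (mulr_ge0 D0 e0)).
Qed.

End Radius.
End NormalForm.

(** * Inverse of a map tangent to the identity *)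

Section InverseSeries.
Variable R : rcfType.
Local Notation C := R[i].
Local Notation P := {poly {poly C}}.
Implicit Types (p q : P) (r s : R).

(** Iterates for [h = - G ('X + h)], whose solution makes ['X + h] a right inverse of ['X + G]; each
    stage uses the current approximation of [G]. *)
Fixpoint inv_seq (G : nat -> P) n : P :=
  if n is n'.+1 then - scomp ('X + inv_seq G n') (G n') else 0.

Variables (K r1 A : R) (G : nat -> P).
Hypotheses (K0 : 0 < K) (A0 : 0 <= A).
Hypothesis G_quad : forall n, quadratic K r1 (G n).
Hypothesis G_geo : geometric r1 A G.
Variable s : R.
Hypotheses (s0 : 0 < s) (s1 : 4 * s <= r1) (s2 : 64 * (K * s) <= 1).
Ltac inv_facts := have := s0; have := s1; have := s2; have := K0; have := A0; move=> ? ? ? ? ?.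
Let hW : ring_norm (@wnorm R s) := ring_norm_wnorm (ltW s0).

Lemma inv_seq_norm n : wnorm s (inv_seq G n) <= 4 * K * s ^+ 2 /\
  wnorm s ('X + inv_seq G n) <= 2 * s.
Proof.
inv_facts; have hX := wnormX (ltW s0).
have small p : wnorm s p <= 4 * K * s ^+ 2 -> wnorm s ('X + p) <= 2 * s.
  move=> h; apply: le_trans (rn_D hW _ _) _.
  have : wnorm s p <= s by apply: le_trans h _; nra.
  lra.
elim: n => [|n [_ IH]].
  have h : wnorm s (inv_seq G 0%N) <= 4 * K * s ^+ 2.
    by rewrite /= (rn_0 hW) ?mulr_ge0 ?exprn_ge0 // ltW.
  by split => //; exact: small.
have h : wnorm s (inv_seq G n.+1) <= 4 * K * s ^+ 2.
  rewrite /= (rn_N hW); apply: le_trans (wnorm_scomp (G n) (ltW s0) IH) _.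
  have -> : 4 * K * s ^+ 2 = K * (2 * s) ^+ 2 by ring.
  by apply: G_quad; lra.
by split => //; exact: small.
Qed.

Lemma inv_seq_geo : geometric s (s + 4 * A) (inv_seq G).
Proof.
inv_facts; move=> n; apply: (@perturbed_contraction R (fun n => wnorm s (inv_seq G n.+1 - inv_seq G n))) => //.
- exact: ltW.
- rewrite [inv_seq G 0%N]/= subr0; apply: le_trans (inv_seq_norm 1%N).1 _; nra.
move=> k; rewrite -[inv_seq G k.+2]/(- scomp ('X + inv_seq G k.+1) (G k.+1)).
set y := inv_seq G k.+1; set x := inv_seq G k.
rewrite -[X in _ - X]/(- scomp ('X + x) (G k)).
have [_ hx] := inv_seq_norm k; have [_ hy] := inv_seq_norm k.+1.
have h1 := quadratic_lip (G_quad k.+1) s0 s1 hy hx.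
have e : 'X + y - ('X + x) = y - x by ring.
rewrite e in h1.
have h2 := wnorm_scomp (G k.+1 - G k) (ltW s0) hx.
have h3 : wnorm (2 * s) (G k.+1 - G k) <= A * 2^-1 ^+ k.
  by apply: (geometric_le_radius _ _ G_geo); lra.
have -> : - scomp ('X + y) (G k.+1) - - scomp ('X + x) (G k) =
  - ((scomp ('X + y) (G k.+1) - scomp ('X + x) (G k.+1)) + scomp ('X + x) (G k.+1 - G k)).
  rewrite scompB; set a := scomp _ _; set b := scomp _ _.
  by set c := scomp _ _; ring.
rewrite (rn_N hW); apply: le_trans (rn_D hW _ _) _.
have a0 := rn_ge0 hW (y - x).
have : 8 * K * s * wnorm s (y - x) <= wnorm s (y - x) / 4 by nra.
lra.
Qed.
End InverseSeries.

(** * Limits with geometric rate *)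

Section GeometricLimits.
Variable R : realType.
Local Notation C := R[i].
Let hC := @ring_norm_cnorm R.

Lemma half_small (e : R) : 0 < e -> exists n, 2^-1 ^+ n < e.
Proof.
move=> e0; have h : `|2^-1 : R| < 1 by rewrite ger0_norm ?invr_ge0 // invf_lt1 // ltr1n.
have := cvg_expr h => /cvgrPdist_lt /(_ e e0) [N _ H].
exists N; have := H N (leqnn N); rewrite /= sub0r normrN ger0_norm //; exact: half_ge0.
Qed.

Lemma le_half_small (a b c : R) : (forall n, a <= b + c * 2^-1 ^+ n) -> a <= b.
Proof.
move=> H; rewrite leNgt; apply/negP => ba.
have c0 : 0 < c.
  by rewrite ltNge; apply/negP => c0; have := H 0%N; rewrite expr0; lra.
have d0 : 0 < (a - b) / c by rewrite divr_gt0 // subr_gt0.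
have [n hn] := half_small d0; have := H n.
by rewrite ltr_pdivlMr // in hn; lra.
Qed.

Lemma geometric_dist (B : comNzRingType) (nu : B -> R) (hn : ring_norm nu)
  (u : nat -> B) (A : R) : (forall n, nu (u n.+1 - u n) <= A * 2^-1 ^+ n) ->
  forall n m, (n <= m)%N -> nu (u m - u n) <= 2 * A * (2^-1 ^+ n - 2^-1 ^+ m).
Proof.
move=> H n m; elim: m => [|m IH]; first by rewrite leqn0 => /eqP ->; rewrite !subrr (rn_0 hn) mulr0.
rewrite leq_eqVlt => /orP[/eqP <-|]; first by rewrite !subrr (rn_0 hn) mulr0.
rewrite ltnS => /IH h.
have := rn_D hn (u m.+1 - u m) (u m - u n); rewrite subrKA => h2.
apply: le_trans h2 _; have := H m; rewrite exprS; set e := _ ^+ m in h *.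
set e' := _ ^+ n in h *; move=> h3; lra.
Qed.

(** The limit is the supremum of the lower bounds [u n - 2 * A * 2^-1 ^+ n]; every
    [u m + 2 * A * 2^-1 ^+ m] is an upper bound of them. *)
Lemma real_geometric_limit (u : nat -> R) (A : R) :
  (forall n, `|u n.+1 - u n| <= A * 2^-1 ^+ n) ->
  exists l, forall n, `|u n - l| <= 2 * A * 2^-1 ^+ n.
Proof.
move=> H.
have A0 : 0 <= A by have := H 0%N; rewrite expr0 mulr1; apply: le_trans.
have Hd := geometric_dist (@ring_norm_abs R) H.
have Hd' n m : `|u m - u n| <= 2 * A * (2^-1 ^+ n + 2^-1 ^+ m).
  have := half_ge0 R n; have := half_ge0 R m => a b.
  case: (leqP n m) => [/Hd|/ltnW /Hd]; [|rewrite distrC] => h; apply: le_trans h _;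
    apply: ler_wpM2l; lra.
pose S := range (fun n => u n - 2 * A * 2^-1 ^+ n).
have ub m : ubound S (u m + 2 * A * 2^-1 ^+ m).
  move=> _ [n _ <-]; have := Hd' m n; rewrite ler_norml => /andP[_]; lra.
have hS : has_sup S by split; [exists (u 0%N - 2 * A * 2^-1 ^+ 0), 0%N | exists (u 0%N + 2 * A * 2^-1 ^+ 0)].
exists (sup S) => n; rewrite ler_norml; apply/andP; split.
  have : sup S <= u n + 2 * A * 2^-1 ^+ n by apply: ge_sup; [exact: hS.1|exact: ub].
  lra.
have : u n - 2 * A * 2^-1 ^+ n <= sup S by apply: ub_le_sup; [exact: hS.2|exists n].
lra.
Qed.

Lemma complex_geometric_limit (u : nat -> C) (A : R) :
  (forall n, cnorm (u n.+1 - u n) <= A * 2^-1 ^+ n) ->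
  exists l, forall n, cnorm (u n - l) <= 4 * A * 2^-1 ^+ n.
Proof.
move=> H.
have [a ha] : exists l, forall n, `|complex.Re (u n) - l| <= 2 * A * 2^-1 ^+ n.
  apply: real_geometric_limit => n; apply: le_trans (H n).
  by rewrite -raddfB; exact: Re_le_cnorm.
have [b hb] : exists l, forall n, `|complex.Im (u n) - l| <= 2 * A * 2^-1 ^+ n.
  apply: real_geometric_limit => n; apply: le_trans (H n).
  by rewrite -raddfB; exact: Im_le_cnorm.
exists (Complex a b) => n; have := ha n; have := hb n; rewrite /cnorm.
case: (u n) => x y /=; lra.
Qed.

(** With an explicit rate built in, [R[i]] enters only through [cnorm], and limits of inequalities
    reduce to [le_half_small]. *)
Definition gcvg (u : nat -> C) (l : C) : Prop :=
  exists A, forall n, cnorm (u n - l) <= A * 2^-1 ^+ n.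

Lemma gcvg_unique u l l' : gcvg u l -> gcvg u l' -> l = l'.
Proof.
move=> [A ha] [B hb]; apply/eqP; rewrite -subr_eq0; apply/eqP; apply: cnorm_eq0.
apply/eqP; rewrite eq_le (rn_ge0 hC) andbT.
apply: (@le_half_small _ _ (A + B)) => n.
have := rn_B hC (u n - l') (u n - l).
have -> : u n - l' - (u n - l) = l - l' by ring.
by have := ha n; have := hb n; lra.
Qed.

Lemma gcvg_cst c : gcvg (fun=> c) c.
Proof. by exists 0 => n; rewrite subrr (rn_0 hC) mul0r. Qed.

Lemma gcvg_shift u l : gcvg u l -> gcvg (fun n => u n.+1) l.
Proof.
move=> [A h]; exists (A / 2) => n; apply: le_trans (h n.+1) _.
by rewrite exprS mulrA.
Qed.

Lemma gcvgD u v l m : gcvg u l -> gcvg v m -> gcvg (fun n => u n + v n) (l + m).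
Proof.
move=> [A ha] [B hb]; exists (A + B) => n.
have -> : u n + v n - (l + m) = (u n - l) + (v n - m) by ring.
by apply: le_trans (rn_D hC _ _) _; rewrite mulrDl lerD.
Qed.

Lemma gcvgN u l : gcvg u l -> gcvg (fun n => - u n) (- l).
Proof. by move=> [A ha]; exists A => n; rewrite -opprD (rn_N hC). Qed.

Lemma gcvgM u v l m : gcvg u l -> gcvg v m -> gcvg (fun n => u n * v n) (l * m).
Proof.
move=> [A ha] [B hb].
have A0 : 0 <= A by have := ha 0%N; rewrite expr0 mulr1; apply: le_trans; exact: (rn_ge0 hC).
have B0 : 0 <= B by have := hb 0%N; rewrite expr0 mulr1; apply: le_trans; exact: (rn_ge0 hC).
exists (A * (cnorm m + B) + cnorm l * B) => n.
have -> : u n * v n - l * m = (u n - l) * (m + (v n - m)) + l * (v n - m) by ring.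
have e1 := half_ge0 R n.
have e2 : 2^-1 ^+ n <= 1 :> R by rewrite exprn_ile1 ?invr_ge0 // invf_le1 // ler1n.
apply: le_trans (rn_D hC _ _) _; rewrite [leRHS]mulrDl; apply: lerD.
  apply: le_trans (rn_M hC _ _) _; rewrite mulrAC; apply: ler_pM => //; try exact: (rn_ge0 hC).
  apply: le_trans (rn_D hC _ _) _; rewrite lerD2l; apply: le_trans (hb n) _.
  by rewrite -[leRHS]mulr1 ler_wpM2l.
by apply: le_trans (rn_M hC _ _) _; rewrite -mulrA ler_wpM2l // (rn_ge0 hC).
Qed.

Lemma gcvg_conj u l : gcvg u l -> gcvg (fun n => conjc (u n)) (conjc l).
Proof. by move=> [A ha]; exists A => n; rewrite -rmorphB cnorm_conj. Qed.

Lemma gcvg_cnorm_le u l b : gcvg u l -> (forall n, cnorm (u n) <= b) -> cnorm l <= b.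
Proof.
move=> [A ha] hb; apply: (@le_half_small _ _ A) => n.
have := rn_B hC (u n) (u n - l); rewrite (_ : u n - (u n - l) = l); last by ring.
by have := ha n; have := hb n; lra.
Qed.

(** The default 0 makes [Phi], [Mu] and [Psi] total functions; they are meaningful on the discs
    where [gcvg] is established. *)
Definition clim (u : nat -> C) : C := xget 0 [set l | gcvg u l].

Lemma climP u l : gcvg u l -> clim u = l.
Proof.
move=> h; apply: (@gcvg_unique u) => //.
by rewrite /clim; case: xgetP => [y -> //|/(_ l)].
Qed.

Lemma clim_geometric u A : (forall n, cnorm (u n.+1 - u n) <= A * 2^-1 ^+ n) ->
  forall n, cnorm (u n - clim u) <= 4 * A * 2^-1 ^+ n.
Proof.
move=> /complex_geometric_limit[l hl] n.
by rewrite (@climP _ l) //; exists (4 * A).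
Qed.

Lemma ev_geometric x s (p : nat -> {poly {poly C}}) A : cnorm x <= s -> geometric s A p ->
  forall n, cnorm (ev x (p n) - clim (fun n => ev x (p n))) <= 4 * A * 2^-1 ^+ n.
Proof.
move=> xs hp; apply: clim_geometric => n; rewrite -evB.
by apply: le_trans (ev_norm _ xs) _.
Qed.

Lemma ev_gcvg x s (p : nat -> {poly {poly C}}) A : cnorm x <= s -> geometric s A p ->
  gcvg (fun n => ev x (p n)) (clim (fun n => ev x (p n))).
Proof. by move=> xs hp; exists (4 * A); exact: ev_geometric hp. Qed.

(** Polynomial and point vary together: a Lipschitz bound uniform in [n] moves the point to its
    limit, after which only the polynomials converge. *)
Lemma gcvg_comp s B A (p : nat -> {poly {poly C}}) (u : nat -> C) l m :
  0 < s -> (forall n, wnorm (2 * s) (p n) <= B) -> (forall n, cnorm (u n) <= s) ->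
  cnorm l <= s -> gcvg u l -> (forall n, cnorm (ev l (p n) - m) <= A * 2^-1 ^+ n) ->
  gcvg (fun n => ev (u n) (p n)) m.
Proof.
move=> s0 hB hu hl [A' h'] hm; exists (A' / s * B + A) => n.
rewrite -(subrKA (ev l (p n))); apply: le_trans (rn_D hC _ _) _.
rewrite mulrDl lerD //; apply: le_trans (ev_lip (p n) s0 (hu n) hl) _.
rewrite [leRHS]mulrAC; apply: ler_pM => //; last 1 first.
- by rewrite mulrAC ler_wpM2r ?invr_ge0 // ltW.
- by rewrite divr_ge0 ?(rn_ge0 hC) // ltW.
- by apply: rn_ge0; apply: ring_norm_wnorm; rewrite mulr_ge0 // ltW.
Qed.

End GeometricLimits.

(** * Derivatives of complex-valued functions *)

(** Difference quotients are traded for an error bound that makes sense at [h = 0] too, the form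
    suited to limits and to gluing curves. *)
Lemma is_derive_epsP (R : realType) (V : normedModType R) (f : R -> V) (t : R) (l : V) :
  is_derive t 1 f l <->
  forall e, 0 < e -> exists2 d, 0 < d &
    forall h, `|h| < d -> `|f (t + h) - f t - h *: l| <= e * `|h|.
Proof.
split=> [[df vl] e e0|H].
  have hc : (fun h : R => h^-1 *: (f (t + h) - f t)) @ 0^' --> l.
    rewrite -vl; move: df; rewrite /derivable /derive => df.
    apply: cvg_trans df; apply: near_eq_cvg; near=> h.
    have -> : (f \o shift t) (h *: 1) = f (t + h) by rewrite /= [h *: 1]mulr1 addrC.
    by [].
  move: hc => /cvgrPdist_le /(_ e e0) [d /= d0 Hd]; exists d => // h hd.
  have [->|h0] := eqVneq h 0; first by rewrite addr0 subrr scale0r subr0 !normr0 mulr0.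
  have := Hd h; rewrite /ball_ /= sub0r normrN => /(_ hd h0) H2.
  have -> : f (t + h) - f t - h *: l = - (h *: (l - h^-1 *: (f (t + h) - f t))).
    by rewrite scalerBr scalerA divff // scale1r opprB.
  by rewrite normrN normrZ mulrC ler_wpM2r.
have hc : (fun h : R => h^-1 *: ((f \o shift t) (h *: 1) - f t)) @ 0^' --> l.
  apply/cvgrPdist_le => e e0; have [d d0 Hd] := H e e0.
  exists d => //= h; rewrite /ball_ /= sub0r normrN => hd h0.
  have -> : h *: (1 : R) + t = t + h by rewrite [h *: 1]mulr1 addrC.
  rewrite distrC.
  have -> : h^-1 *: (f (t + h) - f t) - l = h^-1 *: (f (t + h) - f t - h *: l).
    by rewrite [in RHS]scalerBr scalerA mulVf // scale1r.
  rewrite normrZ normfV mulrC ler_pdivrMr ?normr_gt0 //; exact: Hd.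
by split; [apply/cvg_ex; exists l|exact/cvg_lim].
Unshelve. all: by end_near. Qed.

Lemma is_derive_shift (R : realType) (V : normedModType R) (f : R -> V) (t s : R) (l : V) :
  is_derive (t + s) 1 f l -> is_derive t 1 (fun u => f (u + s)) l.
Proof.
move=> /is_derive_epsP H; apply/is_derive_epsP => e /H[d d0 hd].
by exists d => // h /hd; rewrite (addrAC t s).
Qed.

Section ComplexDerivative.
Variable R : realType.
Local Notation C := R[i].
Let hC := @ring_norm_cnorm R.
Implicit Types (u v : R -> C) (t h : R) (l : C).

Definition hderiv u t l : Prop :=
  forall e, 0 < e -> exists2 d, 0 < d &
    forall h, `|h| < d -> cnorm (u (t + h) - u t - real_complex R h * l) <= e * `|h|.

Lemma hderiv_reim u t l :
  hderiv u t l <-> is_derive t 1 (fun s => complex.Re (u s)) (complex.Re l) /\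
                   is_derive t 1 (fun s => complex.Im (u s)) (complex.Im l).
Proof.
have re h : complex.Re (u (t + h) - u t - real_complex R h * l) =
   complex.Re (u (t + h)) - complex.Re (u t) - h *: complex.Re l.
  by move: (u (t + h)) (u t) (l) => [a b] [c d] [x y] /=; rewrite mul0r subr0.
have im h : complex.Im (u (t + h) - u t - real_complex R h * l) =
   complex.Im (u (t + h)) - complex.Im (u t) - h *: complex.Im l.
  by move: (u (t + h)) (u t) (l) => [a b] [c d] [x y] /=; rewrite mul0r addr0.
split=> [H|[/is_derive_epsP H1 /is_derive_epsP H2] e e0].
  split; apply/is_derive_epsP => e /H [d d0 Hd]; exists d => // h /Hd; apply: le_trans.
    by rewrite -re; exact: Re_le_cnorm.
  by rewrite -im; exact: Im_le_cnorm.
have e2 : 0 < e / 2 by lra.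
have [d1 d10 h1] := H1 _ e2; have [d2 d20 h2] := H2 _ e2.
exists (Num.min d1 d2); first by rewrite lt_min d10.
move=> h; rewrite lt_min => /andP[/h1 k1 /h2 k2]; rewrite /cnorm re im; lra.
Qed.

Lemma hderiv_ext u v t l : (forall s, u s = v s) -> hderiv u t l -> hderiv v t l.
Proof. by move=> h; rewrite (_ : v = u) //; apply/funext => s. Qed.

Lemma hderiv_cst c t : hderiv (fun=> c) t 0.
Proof. by move=> e e0; exists 1 => // h _; rewrite subrr mulr0 subr0 (rn_0 hC) mulr_ge0 // ltW. Qed.

Lemma hderivD u v t l m : hderiv u t l -> hderiv v t m ->
  hderiv (fun s => u s + v s) t (l + m).
Proof.
move=> /hderiv_reim[ur ui] /hderiv_reim[vr vi]; apply/hderiv_reim; rewrite !raddfD.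
by split; [under eq_fun do rewrite raddfD|under eq_fun do rewrite raddfD]; exact: is_deriveD.
Qed.

Lemma hderivM u v t l m : hderiv u t l -> hderiv v t m ->
  hderiv (fun s => u s * v s) t (l * v t + u t * m).
Proof.
move=> /hderiv_reim[ur ui] /hderiv_reim[vr vi]; apply/hderiv_reim.
have reE : (fun s => complex.Re (u s * v s)) =
    (fun s => complex.Re (u s) * complex.Re (v s) - complex.Im (u s) * complex.Im (v s)).
  by apply/funext => s; case: (u s) (v s) => a b [c d].
have imE : (fun s => complex.Im (u s * v s)) =
    (fun s => complex.Re (u s) * complex.Im (v s) + complex.Im (u s) * complex.Re (v s)).
  by apply/funext => s; case: (u s) (v s) => a b [c d].
rewrite reE imE; split.
  apply: is_derive_eq (is_deriveB (is_deriveM ur vr) (is_deriveM ui vi)) _.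
  by rewrite /GRing.scale /=; move: (u t) (v t) (l) (m) => [a b] [c d] [e f] [g h] /=; ring.
apply: is_derive_eq (is_deriveD (is_deriveM ur vi) (is_deriveM ui vr)) _.
by rewrite /GRing.scale /=; move: (u t) (v t) (l) (m) => [a b] [c d] [e f] [g h] /=; ring.
Qed.

Lemma hderivMl c u t l : hderiv u t l -> hderiv (fun s => c * u s) t (c * l).
Proof.
by move=> h; have := hderivM (hderiv_cst c t) h; rewrite mul0r add0r.
Qed.

Lemma hderivN u t l : hderiv u t l -> hderiv (fun s => - u s) t (- l).
Proof.
by move=> /(hderivMl (-1)); rewrite mulN1r; apply: hderiv_ext => s; rewrite mulN1r.
Qed.

Lemma hderiv_conj u t l : hderiv u t l -> hderiv (fun s => conjc (u s)) t (conjc l).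
Proof.
move=> H e /H [d d0 Hd]; exists d => // h /Hd.
by rewrite -(cnorm_conj (_ - _)) !rmorphB rmorphM /= oppr0.
Qed.

Lemma hderiv_sum n (u : 'I_n -> R -> C) t (l : 'I_n -> C) :
  (forall i, hderiv (u i) t (l i)) -> hderiv (fun s => \sum_(i < n) u i s) t (\sum_(i < n) l i).
Proof.
elim: n u l => [|n IH] u l H.
  by rewrite big_ord0; apply: hderiv_ext (hderiv_cst 0 t) => s; rewrite big_ord0.
rewrite big_ord_recr /=.
have := hderivD (IH _ _ (fun i => H (widen_ord (leqnSn n) i))) (H ord_max).
by apply: hderiv_ext => s; rewrite big_ord_recr.
Qed.

(** Phrased with a logarithmic derivative [l], so that powers keep the form of the hypothesis; a
    rotating point and its conjugate are of this type. *)
Lemma hderivX u t l n : hderiv u t (l * u t) ->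
  hderiv (fun s => u s ^+ n) t (n%:R * l * u t ^+ n).
Proof.
move=> h; elim: n => [|n IH].
  by rewrite mul0r mul0r; apply: hderiv_ext (hderiv_cst 1 t) => s; rewrite expr0.
have := hderivM h IH; rewrite (_ : _ + _ = n.+1%:R * l * u t ^+ n.+1); last first.
  by rewrite -natr1 exprS; ring.
by apply: hderiv_ext => s; rewrite exprS.
Qed.

Lemma hderiv_affine u t l (a b : R) : hderiv u (a * t + b) l ->
  hderiv (fun s => u (a * s + b)) t (real_complex R a * l).
Proof.
move=> H e e0; pose e' := e / (`|a| + 1).
have a0 : 0 < `|a| + 1 by have := normr_ge0 a; lra.
have e'0 : 0 < e' by rewrite divr_gt0.
have [d d0 Hd] := H _ e'0; exists (d / (`|a| + 1)); first by rewrite divr_gt0.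
move=> h hd; have hh : `|a * h| <= (`|a| + 1) * `|h|.
  by rewrite normrM; apply: ler_wpM2r => //; lra.
have hd2 : `|a * h| < d.
  by apply: le_lt_trans hh _; rewrite mulrC -ltr_pdivlMr.
rewrite (_ : a * (t + h) + b = a * t + b + a * h); last by ring.
rewrite mulrA -rmorphM /= [h * a]mulrC; apply: le_trans (Hd _ hd2) _.
apply: (@le_trans _ _ (e' * ((`|a| + 1) * `|h|))); first by apply: ler_wpM2l => //; exact: ltW.
by rewrite mulrA divfK // gt_eqF.
Qed.

(** The mean value theorem is applied to the real and imaginary parts separately, whence the factor
    2. *)
Lemma mean_value_le (u : R -> C) (v : R -> C) (a b B : R) : a <= b ->
  (forall s, a <= s <= b -> hderiv u s (v s)) ->
  (forall s, a <= s <= b -> cnorm (v s) <= B) ->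
  cnorm (u b - u a) <= 2 * B * (b - a).
Proof.
move=> ab hu hv.
have key (pr : C -> R) : (forall s, a <= s <= b -> is_derive s (1 : R) (fun s => pr (u s)) (pr (v s))) ->
    (forall z, `|pr z| <= cnorm z) -> `|pr (u b) - pr (u a)| <= B * (b - a).
  move=> hd hp.
  have hd' x : x \in `]a, b[%R -> is_derive x (1 : R) (fun s => pr (u s)) (pr (v x)).
    by rewrite in_itv /= => /andP[h1 h2]; apply: hd; rewrite !ltW.
  have hcont : {within `[a, b], continuous (fun s => pr (u s))}.
    by apply: derivable_within_continuous => x; rewrite in_itv /= => /hd[].
  have [c cab ->] := MVT_segment ab hd' hcont.
  rewrite normrM (ger0_norm (_ : 0 <= b - a)) ?subr_ge0 //; apply: ler_wpM2r; first by rewrite subr_ge0.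
  by apply: le_trans (hp _) _; apply: hv; move: cab; rewrite in_itv.
have h1 := key (@complex.Re R) (fun s hs => ((hderiv_reim _ _ _).1 (hu s hs)).1) (@Re_le_cnorm R).
have h2 := key (@complex.Im R) (fun s hs => ((hderiv_reim _ _ _).1 (hu s hs)).2) (@Im_le_cnorm R).
rewrite /cnorm !raddfB /=; lra.
Qed.

(** The mean value estimate for [un n - un m] bounds its increments by [4 * (A * 2^-1 ^+ n)] times
    the step, uniformly in [m >= n]. Letting [m] grow gives the same for [un n - u], so the
    differential of a single [un n] with [n] large serves for [u]. *)
Lemma hderiv_limit (un vn : nat -> R -> C) (u v : R -> C) (a b A : R) (t : R) :
  a < t < b ->
  (forall n s, a < s < b -> hderiv (un n) s (vn n s)) ->
  (forall n s, a < s < b -> cnorm (un n s - u s) <= A * 2^-1 ^+ n) ->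
  (forall n s, a < s < b -> cnorm (vn n s - v s) <= A * 2^-1 ^+ n) ->
  hderiv u t (v t).
Proof.
move=> tab hd hu hv e e0.
have A0 : 0 <= A.
  by have := hu 0%N t tab; rewrite expr0 mulr1; apply: le_trans; exact: (rn_ge0 hC).
have incr n m x y : (n <= m)%N -> a < x -> x <= y -> y < b ->
    cnorm ((un n y - un m y) - (un n x - un m x)) <= 4 * (A * 2^-1 ^+ n) * (y - x).
  move=> nm ax xy yb.
  rewrite (_ : 4 * (A * _) = 2 * (2 * (A * 2^-1 ^+ n))); last by ring.
  apply: (@mean_value_le (fun s => un n s - un m s) (fun s => vn n s - vn m s)) => // s /andP[xs sy].
    have sab : a < s < b by apply/andP; split; lra.
    exact: (hderivD (hd n s sab) (hderivN (hd m s sab))).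
  have sab : a < s < b by apply/andP; split; lra.
  have := rn_B hC (vn n s - v s) (vn m s - v s).
  rewrite (_ : vn n s - v s - _ = vn n s - vn m s); last by ring.
  have : A * 2^-1 ^+ m <= A * 2^-1 ^+ n.
    by apply: ler_wpM2l => //; apply: ler_wiXn2l => //; rewrite ?invr_ge0 // invf_le1 // ler1n.
  have := hv n s sab; have := hv m s sab; lra.
have incr' n x y : a < x -> x <= y -> y < b ->
    cnorm ((un n y - u y) - (un n x - u x)) <= 4 * (A * 2^-1 ^+ n) * (y - x).
  move=> ax xy yb; apply: (@le_half_small _ _ _ (2 * A)) => m.
  have [xab yab] : a < x < b /\ a < y < b by split; apply/andP; split; lra.
  pose N := maxn n m.
  have k1 := incr n N x y (leq_maxl _ _) ax xy yb.
  have k2 := hu N x xab; have k3 := hu N y yab.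
  have k4 : A * 2^-1 ^+ N <= A * 2^-1 ^+ m.
    apply: ler_wpM2l => //; apply: ler_wiXn2l; rewrite ?invr_ge0 // ?invf_le1 ?ler1n //.
    exact: leq_maxr.
  have k5 := rn_D hC ((un n y - un N y) - (un n x - un N x)) ((un N y - u y) - (un N x - u x)).
  have k6 := rn_B hC (un N y - u y) (un N x - u x).
  rewrite (_ : un n y - u y - (un n x - u x) = (un n y - un N y) - (un n x - un N x) +
    ((un N y - u y) - (un N x - u x))); last by ring.
  lra.
(* [n] is chosen so that the errors below add up to at most [(1/4 + 1/8 + 1/2) * e] times [|h|]. *)
have e8 : 0 < e / (8 * (A + 1)) by rewrite divr_gt0 // mulr_gt0 //; lra.
have [n hn] := half_small e8.
have An : A * 2^-1 ^+ n <= e / 8.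
  apply: (@le_trans _ _ ((A + 1) * (e / (8 * (A + 1))))).
    by apply: ler_pM => //; first [exact: ltW|exact: half_ge0|lra].
  by rewrite [leLHS](_ : _ = e / 8) //; field; rewrite gt_eqF //; lra.
have e4 : 0 < e / 4 by lra.
have [d1 d10 h1] := hd n t tab _ e4.
case/andP: (tab) => at_ tb.
exists (Num.min d1 (Num.min (t - a) (b - t))); first by rewrite !lt_min d10 !subr_gt0 at_.
move=> h; rewrite !lt_min => /and3P[/h1 k1 ha hb].
have thab : a < t + h < b.
  by move: ha hb; rewrite !ltr_norml => /andP[? ?] /andP[? ?]; apply/andP; split; lra.
have k2 : cnorm ((un n (t + h) - u (t + h)) - (un n t - u t)) <= 4 * (A * 2^-1 ^+ n) * `|h|.
  case/andP: thab => x1 x2; case: (leP 0 h) => h0.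
    have := incr' n t (t + h) at_ _ x2; rewrite [t + h - t]addrC addKr (ger0_norm h0).
    by apply; lra.
  have := incr' n (t + h) t x1 _ tb.
  rewrite (rn_distC hC) (_ : t - (t + h) = - h) ?(ltr0_norm h0); last by ring.
  by apply; lra.
have k3 := hv n t tab.
have k3' : cnorm (real_complex R h * (vn n t - v t)) <= `|h| * (e / 8).
  apply: le_trans (rn_M hC _ _) _; rewrite cnorm_real; apply: ler_wpM2l => //; lra.
have k2' : 4 * (A * 2^-1 ^+ n) * `|h| <= e / 2 * `|h| by apply: ler_wpM2r => //; lra.
rewrite (_ : _ - _ = (un n (t + h) - un n t - real_complex R h * vn n t) +
  (real_complex R h * (vn n t - v t) - ((un n (t + h) - u (t + h)) - (un n t - u t)))); last by ring.
have := rn_D hC (un n (t + h) - un n t - real_complex R h * vn n t) (real_complex R h * (vn n t - v t) - ((un n (t + h) - u (t + h)) - (un n t - u t))).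
have := rn_B hC (real_complex R h * (vn n t - v t)) ((un n (t + h) - u (t + h)) - (un n t - u t)).
have hh := normr_ge0 h.
have : 0 <= e * `|h| by rewrite mulr_ge0 // ltW.
lra.
Qed.

Definition cis (t : R) : C := Complex (cos t) (sin t).

Lemma hderiv_cis t : hderiv cis t (Complex 0 1 * cis t).
Proof.
apply/hderiv_reim; split=> /=.
  by apply: is_derive_eq; rewrite mul0r mul1r sub0r.
by apply: is_derive_eq; rewrite mul0r mul1r add0r.
Qed.

(** The logarithmic derivatives of [x * cis s] and of its conjugate are the imaginary unit and its
    opposite, so each monomial picks up its own [freq]. *)
Lemma hderiv_circle (p : {poly {poly C}}) x t :
  hderiv (fun s => ev (x * cis s) p) t (Complex 0 1 * ev (x * cis t) (angular p)).
Proof.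
have [n [h1 h2]] := poly2_bound p.
have e1 : (size (angular p) <= n)%N by apply: leq_trans h1; exact: size_poly.
have e2 i : (size ((angular p)`_i)%R <= n)%N.
  apply: leq_trans (h2 i); rewrite /angular /cscale coef_poly.
  by case: ifP => _; [exact: size_poly|rewrite size_poly0].
rewrite (evE _ e1 e2).
apply: (@hderiv_ext (fun s => \sum_(i < n) \sum_(j < n) p`_i`_j * (x * cis s) ^+ i * conjc (x * cis s) ^+ j)).
  by move=> s; rewrite (evE _ h1 h2).
have hz : hderiv (fun s => x * cis s) t (Complex 0 1 * (x * cis t)).
  by rewrite mulrCA; exact: hderivMl (hderiv_cis t).
have hw : hderiv (fun s => conjc (x * cis s)) t (- Complex 0 1 * conjc (x * cis t)).
  have -> : - Complex 0 1 * conjc (x * cis t) = conjc (Complex 0 1 * (x * cis t)).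
    by rewrite [RHS]rmorphM; congr (_ * _); rewrite /= /GRing.opp /= oppr0.
  exact: hderiv_conj hz.
rewrite big_distrr; apply: hderiv_sum => i /=.
rewrite big_distrr; apply: hderiv_sum => j /=.
have := hderivM (hderivMl p`_i`_j (hderivX i hz)) (hderivX j hw).
rewrite coef_cscale /freq rmorphB !rmorph_nat.
set a := _ ^+ i; set b := _ ^+ j; rewrite (_ : _ + _ = Complex 0 1 *
  ((i%:R - j%:R) * p`_i`_j * a * b)) //; ring.
Qed.

End ComplexDerivative.

Section SquaredModulus.
Variable R : realType.
Local Notation C := R[i].
Implicit Types x y : C.

(** Unlike [cnorm], exactly invariant under multiplication by [cis], so its level sets are the
    circles; it is comparable to [cnorm x ^+ 2] within a factor 2. *)
Definition msq (x : C) : R := complex.Re x ^+ 2 + complex.Im x ^+ 2.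

Lemma mul_conj x : x * conjc x = real_complex R (msq x).
Proof. by case: x => a b; rewrite /msq; apply/eqP; rewrite eq_complex /=; apply/andP; split; apply/eqP; ring. Qed.

Lemma msqM x y : msq (x * y) = msq x * msq y.
Proof. by case: x => a b; case: y => c d; rewrite /msq /=; ring. Qed.

Lemma msq_cis t : msq (cis t : C) = 1.
Proof. by rewrite /msq /= cos2Dsin2. Qed.

Lemma cnorm_cis t : cnorm (cis t : C) <= 2.
Proof. by rewrite /cnorm /= -[2]/(1 + 1); apply: lerD; [exact: cos_max|exact: sin_max]. Qed.

Lemma msq_ge0 x : 0 <= msq x.
Proof. by rewrite /msq addr_ge0 // sqr_ge0. Qed.

Lemma msq_le_cnorm x : msq x <= cnorm x ^+ 2.
Proof.
case: x => a b; rewrite /msq /cnorm /= -(real_normK (num_real a)) -(real_normK (num_real b)).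
have := mulr_ge0 (normr_ge0 a) (normr_ge0 b); rewrite sqrrD mulr2n; lra.
Qed.

Lemma cnorm_le_msq x : cnorm x ^+ 2 <= 2 * msq x.
Proof.
case: x => a b; rewrite /msq /cnorm /= -(real_normK (num_real a)) -(real_normK (num_real b)).
have := sqr_ge0 (`|a| - `|b|); rewrite sqrrB sqrrD !mulr2n; lra.
Qed.

Lemma msq_eq0 x : msq x = 0 -> x = 0.
Proof.
move=> h; have := cnorm_le_msq x; rewrite h mulr0 => h2.
apply: cnorm_eq0; apply/eqP; rewrite -sqrf_eq0; apply/eqP/le_anti.
by rewrite h2 sqr_ge0.
Qed.

Lemma real_complexB (a b : R) : real_complex R (a - b) = real_complex R a - real_complex R b.
Proof. exact: rmorphB. Qed.

Lemma starB (p q : {poly {poly C}}) : star (p - q) = star p - star q.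
Proof.
by apply: poly2P => i j; rewrite coef_star !coefB !coef_star (rmorphB (@conjc R)).
Qed.

Lemma cnorm_mul_i x : cnorm (Complex 0 1 * x) = cnorm x.
Proof. by case: x => a b; rewrite /cnorm /= !mul0r !mul1r sub0r add0r normrN addrC. Qed.
End SquaredModulus.

(** * Real analytic germs in the plane *)

Lemma square_sum_recr (V : zmodType) (G : nat -> nat -> V) n :
  \sum_(i < n.+1) \sum_(j < n.+1) G i j =
  \sum_(i < n) \sum_(j < n) G i j + (\sum_(i < n) G i n + \sum_(j < n.+1) G n j).
Proof.
rewrite big_ord_recr /= addrA; congr (_ + _).
by rewrite -big_split /=; apply: eq_bigr => i _; rewrite big_ord_recr.
Qed.

Section SquareSums.
Variables (R : realType) (B : comNzRingType) (nu : B -> R) (f : {rmorphism R -> B}).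
Hypotheses (hB : ring_norm nu) (hf : forall x, nu (f x) <= `|x|).
Implicit Types (a : nat -> nat -> R) (u v : B) (r s M : R).

(** The target ring is left free: the same coefficients are summed at real points, at complex points
    and at polynomials, and [psum_rmorph] relates these sums. *)
Definition psum a n u v : B := \sum_(i < n) \sum_(j < n) f (a i j) * u ^+ i * v ^+ j.

Definition abs_sum a n r : R := \sum_(i < n) \sum_(j < n) `|a i j| * r ^+ (i + j).

Lemma abs_sum_ge0 a n r : 0 <= r -> 0 <= abs_sum a n r.
Proof. by move=> r0; apply: sumr_ge0 => i _; apply: sumr_ge0 => j _; rewrite mulr_ge0 ?exprn_ge0. Qed.

Lemma psum_term a i j u v s : nu u <= s -> nu v <= s ->
  nu (f (a i j) * u ^+ i * v ^+ j) <= `|a i j| * s ^+ (i + j).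
Proof.
move=> us vs; have s0 : 0 <= s := le_trans (rn_ge0 hB _) us.
have hX w k : nu w <= s -> nu (w ^+ k) <= s ^+ k.
  by move=> ws; apply: le_trans (rn_X hB _ _) _; apply: lerXn2r; rewrite ?nnegrE ?(rn_ge0 hB).
rewrite exprD mulrA; apply: le_trans (rn_M hB _ _) _.
apply: ler_pM; rewrite ?(rn_ge0 hB) ?hX //.
apply: le_trans (rn_M hB _ _) _; apply: ler_pM; rewrite ?(rn_ge0 hB) ?hX //.
Qed.

Lemma psum_norm a n u v s : nu u <= s -> nu v <= s -> nu (psum a n u v) <= abs_sum a n s.
Proof.
move=> us vs; apply: le_trans (rn_sum hB _ _ _) _; apply: ler_sum => i _.
by apply: le_trans (rn_sum hB _ _ _) _; apply: ler_sum => j _; exact: psum_term.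
Qed.

(** The terms added between two consecutive squares have [i + j >= n], so halving the radius gains
    [2^-1 ^+ n]: absolute convergence becomes convergence at a geometric rate. *)
Lemma abs_sum_half a r M n : 0 < r -> (forall n, abs_sum a n r <= M) ->
  abs_sum a n.+1 (r / 2) - abs_sum a n (r / 2) <= M * 2^-1 ^+ n.
Proof.
move=> r0 hM; rewrite /abs_sum.
rewrite (square_sum_recr (fun i j => `|a i j| * (r / 2) ^+ (i + j))) [X in X - _]addrC addrK.
have h := hM n.+1; rewrite /abs_sum (square_sum_recr (fun i j => `|a i j| * r ^+ (i + j))) in h.
have h0 : 0 <= \sum_(i < n) \sum_(j < n) `|a i j| * r ^+ (i + j) by apply: (abs_sum_ge0 a n); exact: ltW.
set S1 := \sum_(i < n) _ in h h0;
have h' : \sum_(i < n) `|a i n| * r ^+ (i + n) + \sum_(j < n.+1) `|a n j| * r ^+ (n + j) <= M.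
  by move: h; lra.
apply: le_trans (_ : (\sum_(i < n) `|a i n| * r ^+ (i + n) +
   \sum_(j < n.+1) `|a n j| * r ^+ (n + j)) * 2^-1 ^+ n <= _); last first.
  by apply: ler_wpM2r => //; exact: half_ge0.
have half1 (k m : nat) : 2^-1 ^+ (k + m) <= 2^-1 ^+ m :> R.
  by apply: ler_wiXn2l; rewrite ?leq_addl // ?invr_ge0 // invf_le1 // ler1n.
rewrite mulrDl; apply: lerD; rewrite big_distrl /=; apply: ler_sum => i _.
  rewrite exprMn mulrA; apply: ler_wpM2l => //; first by rewrite mulr_ge0 // exprn_ge0 // ltW.
rewrite exprMn mulrA; apply: ler_wpM2l; first by rewrite mulr_ge0 // exprn_ge0 // ltW.
by rewrite addnC.
Qed.

Lemma psum_diff a r M n u v : 0 < r -> (forall n, abs_sum a n r <= M) ->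
  nu u <= r / 2 -> nu v <= r / 2 -> nu (psum a n.+1 u v - psum a n u v) <= M * 2^-1 ^+ n.
Proof.
move=> r0 hM us vs; apply: le_trans (abs_sum_half n r0 hM).
rewrite /psum /abs_sum.
rewrite (square_sum_recr (fun i j => `|a i j| * (r / 2) ^+ (i + j))) [X in _ <= X - _]addrC addrK.
rewrite (square_sum_recr (fun i j => f (a i j) * u ^+ i * v ^+ j)) [X in nu (X - _)]addrC addrK.
apply: le_trans (rn_D hB _ _) _; apply: lerD; apply: le_trans (rn_sum hB _ _ _) _;
  by apply: ler_sum => i _; exact: psum_term.
Qed.

Definition tail2 a i j : R := if (i + j < 2)%N then 0 else a i j.

Lemma abs_sum_tail2 a r M n s : 0 < r -> (forall n, abs_sum a n r <= M) ->
  0 <= s -> s <= r -> abs_sum (tail2 a) n s <= M / r ^+ 2 * s ^+ 2.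
Proof.
move=> r0 hM s0 sr; apply: le_trans (_ : abs_sum a n r * (s / r) ^+ 2 <= _); last first.
  rewrite exprMn exprVn mulrA mulrAC; apply: ler_wpM2r; first exact: exprn_ge0.
  by apply: ler_wpM2r; [rewrite invr_ge0 exprn_ge0 // ltW|exact: hM].
rewrite big_distrl; apply: ler_sum => i _ /=; rewrite big_distrl; apply: ler_sum => j _ /=.
rewrite /tail2; case: ltnP => h.
  have rr := ltW r0.
  rewrite normr0 mul0r; apply: mulr_ge0; first by rewrite mulr_ge0 ?exprn_ge0.
  by rewrite exprn_ge0 // divr_ge0.
rewrite -mulrA; apply: ler_wpM2l => //.
have -> : s ^+ (i + j) = r ^+ (i + j) * (s / r) ^+ (i + j).
  by rewrite -exprMn mulrCA divff ?mulr1 // gt_eqF.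
apply: ler_wpM2l; first by rewrite exprn_ge0 // ltW.
by apply: ler_wiXn2l => //; [rewrite divr_ge0 // ltW|rewrite ler_pdivrMr // mul1r].
Qed.

Lemma abs_sum_tail2_le a r n : 0 <= r -> abs_sum (tail2 a) n r <= abs_sum a n r.
Proof.
move=> r0; apply: ler_sum => i _; apply: ler_sum => j _; rewrite /tail2.
by case: ifP => // _; rewrite normr0 mul0r mulr_ge0 // exprn_ge0.
Qed.

(** A square of side [n.+2] contains all three indices of order at most 1. *)
Lemma psum_tail2 a n u v : psum a n.+2 u v =
  f (a 0 0)%N + f (a 1 0)%N * u + f (a 0 1)%N * v + psum (tail2 a) n.+2 u v.
Proof.
have e : psum a n.+2 u v - psum (tail2 a) n.+2 u v =
    \sum_(i < n.+2) \sum_(j < n.+2) (if (i + j < 2)%N then f (a i j) * u ^+ i * v ^+ j else 0).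
  rewrite /psum -sumrB; apply: eq_bigr => i _; rewrite -sumrB; apply: eq_bigr => j _.
  rewrite /tail2; case: ifP => _; last by rewrite subrr.
  by rewrite rmorph0 !mul0r subr0.
rewrite -[LHS](subrK (psum (tail2 a) n.+2 u v)) e; congr (_ + _).
rewrite big_ord_recl [X in _ + X]big_ord_recl /= [X in _ + (_ + X)]big1 ?addr0; last first.
  by move=> i _; apply: big1 => j _.
rewrite !big_ord_recl /= !big1 ?addr0 //.
rewrite /bump /= !expr0 !expr1 !mulr1; ring.
Qed.

End SquareSums.

Lemma psum_rmorph (R : realType) (B B' : comNzRingType) (f : {rmorphism R -> B})
  (f' : {rmorphism R -> B'}) (g : {rmorphism B -> B'}) a n u v :
  (forall x, g (f x) = f' x) -> g (psum f a n u v) = psum f' a n (g u) (g v).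
Proof.
move=> h; rewrite /psum rmorph_sum; apply: eq_bigr => i _; rewrite rmorph_sum.
by apply: eq_bigr => j _; rewrite !rmorphM !rmorphXn /= h.
Qed.

Section PolynomialOfSquareSum.
Variables (R : realType).
Local Notation Q := {poly {poly R}}.
Implicit Types (a : nat -> nat -> R) (r s M : R).

Definition absn2 (r : R) : Q -> R := pnorm2 (fun x : R => `|x|) r.
Definition QC : R -> Q := polyC \o polyC.
HB.instance Definition _ := GRing.RMorphism.copy QC (polyC \o polyC).

(** The generic square sum as a polynomial, through which [psum] inherits the Lipschitz estimate of
    [psubst2]. *)
Definition square_poly a n : Q := psum QC a n 'X 'X%:P.

Lemma ring_norm_absn2 r : 0 <= r -> ring_norm (absn2 r).
Proof. by move=> r0; exact: (ring_norm_pnorm2 (ring_norm_abs R) r0). Qed.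

Lemma absn2C r c : 0 <= r -> absn2 r (QC c) <= `|c|.
Proof.
move=> r0; have hn := ring_norm_pnorm (ring_norm_abs R) r0.
by rewrite /absn2 /pnorm2 (pnormC hn) (pnormC (ring_norm_abs R)).
Qed.

Lemma absn2X r : 0 <= r -> absn2 r 'X <= r.
Proof. by move=> r0; apply: pnormX => //; exact: (ring_norm_pnorm (ring_norm_abs R) r0). Qed.

Lemma absn2W r : 0 <= r -> absn2 r 'X%:P <= r.
Proof.
move=> r0; have hn := ring_norm_pnorm (ring_norm_abs R) r0.
by rewrite /absn2 /pnorm2 (pnormC hn); apply: pnormX => //; exact: ring_norm_abs.
Qed.

Lemma square_poly_norm a n r : 0 <= r -> absn2 r (square_poly a n) <= abs_sum a n r.
Proof.
move=> r0; apply: psum_norm; [exact: ring_norm_absn2|move=> x; exact: absn2C|exact: absn2X|exact: absn2W].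
Qed.

Lemma psubst2_square (B : comNzRingType) (f : {rmorphism R -> B}) a n u v :
  psubst2 f u v (square_poly a n) = psum f a n u v.
Proof.
rewrite /square_poly (@psum_rmorph _ _ _ QC f (psubst2 f u v)).
  by congr psum; [exact: psubst2XZ|exact: psubst2XW].
by move=> x; exact: psubst2C.
Qed.

Lemma psum_lip (B : comNzRingType) (nu : B -> R) (f : {rmorphism R -> B}) a n u v u' v' s d :
  ring_norm nu -> (forall x, nu (f x) <= `|x|) -> 0 < s ->
  nu u <= s -> nu v <= s -> nu u' <= s -> nu v' <= s -> nu (u - u') <= d -> nu (v - v') <= d ->
  nu (psum f a n u v - psum f a n u' v') <= d / s * abs_sum a n (2 * s).
Proof.
move=> hB hf s0 h1 h2 h3 h4 h5 h6; rewrite -!psubst2_square.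
apply: le_trans (psubst2_lip hB (ring_norm_abs R) hf (square_poly a n) s0 h1 h2 h3 h4 h5 h6) _.
apply: ler_wpM2l; last by apply: square_poly_norm; rewrite mulr_ge0 // ltW.
by rewrite divr_ge0 // ?(ltW s0) // (le_trans (rn_ge0 hB _) h5).
Qed.
End PolynomialOfSquareSum.

Lemma ord2E (i : 'I_2) : i = 0 \/ i = 1.
Proof.
case: (unliftP ord0 i) => [k ->|->]; [right|by left].
by rewrite ord1; exact/val_inj.
Qed.

Section AnalyticPlane.
Variable R : realType.
Local Notation V := 'rV[R]_2.
Local Notation C := R[i].
Local Notation P := {poly {poly C}}.
Implicit Types (p q h v : V) (a : nat -> nat -> R).

Definition row2 (x y : R) : V := \row_(j < 2) (if j == 0 then x else y).
Lemma row20 x y : row2 x y 0 0 = x. Proof. by rewrite mxE. Qed.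
Lemma row21 x y : row2 x y 0 1 = y. Proof. by rewrite mxE. Qed.

Lemma rV2P (u v : V) : u 0 0 = v 0 0 -> u 0 1 = v 0 1 -> u = v.
Proof.
by move=> h0 h1; apply/rowP => j; case: (ord2E j) => ->.
Qed.

Lemma norm_rV2_le (v : V) (s : R) : 0 <= s ->
  `|v| <= s <-> `|v 0 0| <= s /\ `|v 0 1| <= s.
Proof.
move=> s0; have -> : `|v| = mx_norm v by [].
rewrite mx_normrE; split=> [h|[h0 h1]].
  by split; apply: le_trans h; [apply: (le_bigmax _ _ (ord0, ord0))|apply: (le_bigmax _ _ (ord0, 1))].
by apply: bigmax_le => // -[i j] _ /=; rewrite (ord1 i); case: (ord2E j) => ->.
Qed.

Lemma norm_coord (v : V) j : `|v 0 j| <= `|v|.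
Proof.
have [h0 h1] := (norm_rV2_le v (normr_ge0 v)).1 (lexx _).
by case: (ord2E j) => ->.
Qed.

Lemma half_cvg (u : nat -> R) (l A : R) : (forall n, `|u n - l| <= A * 2^-1 ^+ n) ->
  u @ \oo --> l.
Proof.
move=> H; have A0 : 0 <= A by have := H 0%N; rewrite expr0 mulr1; apply: le_trans.
apply/cvgrPdist_le => e e0; have e1 : 0 < e / (A + 1) by rewrite divr_gt0 //; lra.
have [N hN] := half_small e1; exists N => // n /= Nn; rewrite distrC.
apply: le_trans (H n) _; apply: (@le_trans _ _ ((A + 1) * (e / (A + 1)))); last first.
  by rewrite mulrC divfK // gt_eqF //; lra.
have hn : 2^-1 ^+ n <= e / (A + 1).
  by apply: le_trans (ltW hN); apply: ler_wiXn2l => //; rewrite ?invr_ge0 // invf_le1 // ler1n.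
by apply: ler_pM => //; first [exact: half_ge0 | lra].
Qed.

Lemma analytic_atE (f : V -> R) p : analytic_at f p ->
  exists a r M, [/\ 0 < r, 0 <= M, forall n, abs_sum a n r <= M &
    forall h, `|h| <= r / 2 -> forall n,
      `|psum idfun a n (h 0 0) (h 0 1) - f (p + h)| <= 2 * M * 2^-1 ^+ n].
Proof.
move=> [a [r [r0 [M hM] hf]]].
have M0 : 0 <= M by have := hM 0%N; rewrite big_ord0.
exists a, r, M; split => // h hr n.
have [h0 h1] := (norm_rV2_le h (le_trans (normr_ge0 h) hr)).1 hr.
have hd k : `|psum idfun a k.+1 (h 0 0) (h 0 1) - psum idfun a k (h 0 0) (h 0 1)| <= M * 2^-1 ^+ k.
  by apply: (psum_diff (ring_norm_abs R)) r0 hM _ _.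
have [l hl] := real_geometric_limit hd.
suff -> : f (p + h) = l by exact: hl.
have c1 : (fun n => psum idfun a n (h 0 0) (h 0 1)) @ \oo --> f (p + h).
  by apply: hf; apply: le_lt_trans hr _; lra.
have c2 : (fun n => psum idfun a n (h 0 0) (h 0 1)) @ \oo --> l := half_cvg hl.
by rewrite -(cvg_lim (@norm_hausdorff _ _) c1) (cvg_lim (@norm_hausdorff _ _) c2).
Qed.

(** The quadratic remainder is uniform in the direction, so directional derivatives, the chain rule
    and the Jacobian can all be drawn from it. *)
Definition first_order (f : V -> R) p (l0 l1 K r : R) : Prop :=
  forall h, `|h| <= r -> `|f (p + h) - f p - (l0 * h 0 0 + l1 * h 0 1)| <= K * `|h| ^+ 2.

Lemma analytic_first_order_coef f p a r M : 0 < r -> 0 <= M ->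
  (forall n, abs_sum a n r <= M) ->
  (forall h, `|h| <= r / 2 -> forall n,
      `|psum idfun a n (h 0 0) (h 0 1) - f (p + h)| <= 2 * M * 2^-1 ^+ n) ->
  a 0%N 0%N = f p /\ first_order f p (a 1%N 0%N) (a 0%N 1%N) (M / r ^+ 2) (r / 2).
Proof.
move=> r0 M0 hM hf.
have key h : `|h| <= r / 2 ->
    `|f (p + h) - a 0%N 0%N - (a 1%N 0%N * h 0 0 + a 0%N 1%N * h 0 1)| <= M / r ^+ 2 * `|h| ^+ 2.
  move=> hr; apply: (@le_half_small _ _ _ (2 * M)) => n.
  have := hf h hr n.+2; rewrite psum_tail2 /=.
  have [h0 h1] := (norm_rV2_le h (normr_ge0 h)).1 (lexx _).
  have hr2 : `|h| <= r by lra.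
  have k1 := psum_norm (ring_norm_abs R) (f := idfun) (fun x => lexx _) (tail2 a) n.+2 h0 h1.
  have k2 := abs_sum_tail2 n.+2 r0 hM (normr_ge0 h) hr2.
  set T := psum _ _ _ _ _ in k1 *; move=> k3.
  have k4 : 2 * M * 2^-1 ^+ n.+2 <= 2 * M * 2^-1 ^+ n.
    apply: ler_wpM2l; first by rewrite mulr_ge0.
    by apply: ler_wiXn2l; rewrite ?invr_ge0 // ?invf_le1 ?ler1n // leqW.
  rewrite (_ : f (p + h) - _ - _ = T - (a 0%N 0%N + a 1%N 0%N * h 0 0 + a 0%N 1%N * h 0 1 + T - f (p + h))); last by ring.
  apply: le_trans (ler_normB _ _) _; lra.
have a00 : a 0%N 0%N = f p.
  have h0 : `|(0 : V)| <= r / 2 by rewrite normr0; lra.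
  have := key 0 h0; rewrite addr0 !mxE !mulr0 addr0 subr0 normr0 expr0n /= mulr0 normr_le0.
  by rewrite subr_eq0 => /eqP.
by split => // h /key; rewrite a00.
Qed.

Lemma first_order_derive f p l0 l1 K r v : 0 < r -> 0 <= K -> first_order f p l0 l1 K r ->
  'D_v f p = l0 * v 0 0 + l1 * v 0 1.
Proof.
move=> r0 K0 H; apply: cvg_lim; first exact: norm_hausdorff.
apply/cvgrPdist_le => e e0.
pose B := (K + 1) * (`|v| + 1) ^+ 2.
have v1 : 1 <= `|v| + 1 by have := normr_ge0 v; lra.
have v2 : 1 <= (`|v| + 1) ^+ 2 by rewrite exprn_ege1.
have B0 : 0 < B by rewrite mulr_gt0 //; lra.
pose d := Num.min (e / B) (r / (`|v| + 1)).
have d0 : 0 < d by rewrite lt_min !divr_gt0 //; lra.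
exists d => //= t; rewrite /ball_ /= sub0r normrN lt_min => /andP[t1 t2] t0.
have tv : `|t *: v| <= r.
  rewrite normrZ; rewrite ltr_pdivlMr in t2; last by lra.
  apply: le_trans (ltW t2); apply: ler_wpM2l => //; lra.
have := H _ tv; rewrite !mxE => h.
rewrite [t *: v + p]addrC distrC.
have -> : t^-1 *: (f (p + t *: v) - f p) - (l0 * v 0 0 + l1 * v 0 1) =
   t^-1 * (f (p + t *: v) - f p - (l0 * (t * v 0 0) + l1 * (t * v 0 1))).
  by rewrite /GRing.scale /=; field.
rewrite normrM normfV mulrC ler_pdivrMr ?normr_gt0 //.
apply: le_trans h _; rewrite normrZ exprMn.
rewrite ltr_pdivlMr // in t1.
have -> : K * (`|t| ^+ 2 * `|v| ^+ 2) = (`|t| * (K * `|v| ^+ 2)) * `|t| by ring.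
apply: ler_wpM2r => //; apply: le_trans (ltW t1); apply: ler_wpM2l => //.
apply: ler_pM; rewrite ?exprn_ge0 //; first lra.
by apply: lerXn2r; rewrite ?nnegrE //; lra.
Qed.

Lemma first_order_chain f (c : R -> V) t v l0 l1 K r : 0 < r -> 0 <= K ->
  first_order f (c t) l0 l1 K r -> is_derive t (1 : R) c v ->
  is_derive t (1 : R) (fun s => f (c s)) (l0 * v 0 0 + l1 * v 0 1).
Proof.
move=> r0 K0 H /is_derive_epsP hc; apply/is_derive_epsP => e e0.
pose L := `|l0| + `|l1| + 1; have L0 : 0 < L by rewrite /L; have := normr_ge0 l0; have := normr_ge0 l1; lra.
pose B := `|v| + 1; have B1 : 1 <= B by rewrite /B; have := normr_ge0 v; lra.
pose e1 := Num.min 1 (e / (2 * L)).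
have e10 : 0 < e1 by rewrite lt_min ltr01 divr_gt0 // mulr_gt0.
have [d d0 hd] := hc _ e10.
pose d1 := Num.min d (Num.min (r / B) (e / (2 * (K + 1) * B ^+ 2))).
have KB : 0 < 2 * (K + 1) * B ^+ 2 by rewrite !mulr_gt0 ?exprn_gt0 //; lra.
exists d1; first by rewrite !lt_min d0 !divr_gt0 //; lra.
move=> h; rewrite !lt_min => /and3P[h1 h2 h3].
have := hd _ h1; set D := c (t + h) - c t => kD.
have e1a : e1 <= 1 by rewrite ge_min lexx.
have e1b : e1 * L <= e / 2.
  have : e1 <= e / (2 * L) by rewrite ge_min lexx orbT.
  rewrite -(ler_pM2r L0) => /le_trans; apply; rewrite [leLHS](_ : _ = e / 2) //.
  by field; rewrite gt_eqF.
have nD : `|D| <= B * `|h|.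
  have := ler_normD (D - h *: v) (h *: v); rewrite subrK normrZ => k.
  have : e1 * `|h| <= 1 * `|h| by apply: ler_wpM2r.
  rewrite /B; lra.
have nDr : `|D| <= r.
  apply: le_trans nD _; rewrite ltr_pdivlMr in h2; last by lra.
  by rewrite mulrC ltW.
have k1 := H _ nDr; rewrite (_ : c t + D = c (t + h)) in k1; last by rewrite /D addrC subrK.
rewrite /GRing.scale /=.
rewrite (_ : f (c (t + h)) - f (c t) - _ = (f (c (t + h)) - f (c t) - (l0 * D 0 0 + l1 * D 0 1))
  + (l0 * (D - h *: v) 0 0 + l1 * (D - h *: v) 0 1)); last by rewrite !mxE; ring.
apply: le_trans (ler_normD _ _) _.
have k2 : `|l0 * (D - h *: v) 0 0 + l1 * (D - h *: v) 0 1| <= e / 2 * `|h|.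
  apply: le_trans (ler_normD _ _) _; rewrite !normrM.
  have m0 := norm_coord (D - h *: v) 0; have m1 := norm_coord (D - h *: v) 1.
  apply: (@le_trans _ _ (L * `|D - h *: v|)).
    have := normr_ge0 (D - h *: v).
    have := ler_wpM2l (normr_ge0 l0) m0; have := ler_wpM2l (normr_ge0 l1) m1; rewrite /L; lra.
  apply: (@le_trans _ _ (L * (e1 * `|h|))); first by apply: ler_wpM2l => //; exact: ltW.
  by rewrite mulrA [L * e1]mulrC; apply: ler_wpM2r.
have k3 : K * `|D| ^+ 2 <= e / 2 * `|h|.
  apply: (@le_trans _ _ ((K + 1) * (B * `|h|) ^+ 2)).
    apply: ler_pM; rewrite ?exprn_ge0 //; first lra.
    by apply: lerXn2r; rewrite ?nnegrE // mulr_ge0 //; lra.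
  rewrite ltr_pdivlMr // in h3.
  have -> : (K + 1) * (B * `|h|) ^+ 2 = (`|h| * (2 * (K + 1) * B ^+ 2)) / 2 * `|h| by field.
  by apply: ler_wpM2r => //; apply: ler_wpM2r; [rewrite invr_ge0|exact: ltW].
lra.
Qed.

Lemma jacobian_first_order (X : V -> V) (l0 l1 : 'I_2 -> R) K r : 0 < r -> 0 <= K ->
  (forall j, first_order (fun q => X q 0 j) 0 (l0 j) (l1 j) K r) ->
  forall j, DX X 0 j 0 = l0 j /\ DX X 0 j 1 = l1 j.
Proof.
move=> r0 K0 H.
pose A : 'M[R]_2 := \matrix_(i, j) (if i == 0 then l0 j else l1 j).
have mulA h j : (h *m A) 0 j = l0 j * h 0 0 + l1 j * h 0 1.
  by rewrite mxE !big_ord_recl big_ord0 addr0 !mxE /= mulrC [h _ _ * l1 _]mulrC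
    (_ : lift ord0 ord0 = 1) //; apply/val_inj.
(* [diff_unique] asks for the continuity of the candidate differential. *)
have hcont : forall h0 : V, (fun h : V => h *m A) @ h0 --> h0 *m A.
  pose B := `|l0 0| + `|l1 0| + `|l0 1| + `|l1 1| + 1.
  have := normr_ge0 (l0 0); have := normr_ge0 (l1 0); have := normr_ge0 (l0 1).
  have := normr_ge0 (l1 1) => p1 p2 p3 p4.
  have B0 : 0 < B by rewrite /B; lra.
  move=> h0; apply: (@cvgrPdist_le _ V _ (nbhs h0) _ (fun h : V => h *m A) (h0 *m A)).2 => e e0.
  have e1 : 0 < e / B by rewrite divr_gt0.
  apply/nbhs_ballP; exists (e / B) => // h; rewrite mx_norm_ball /ball_ /= => /ltW he.
  rewrite ler_pdivlMr // in he.
  rewrite -mulmxBl; apply/(norm_rV2_le _ (ltW e0)).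
  have n0 := norm_coord (h0 - h) 0; have n1 := norm_coord (h0 - h) 1.
  have n2 := normr_ge0 (h0 - h).
  suff bnd j : `|l0 j| + `|l1 j| <= B -> `|((h0 - h) *m A) 0 j| <= e.
    by split; apply: bnd; rewrite /B; lra.
  move=> jB; rewrite mulA; apply: le_trans (ler_normD _ _) _; rewrite !normrM.
  have m0 := ler_wpM2l (normr_ge0 (l0 j)) n0; have m1 := ler_wpM2l (normr_ge0 (l1 j)) n1.
  have := ler_wpM2l n2 jB; lra.
have hdiff : 'd X 0 = mulmxr A :> (V -> V).
  apply: diff_unique; first exact: hcont.
  apply/eqaddoP => e e0; have e1 : 0 < e / (K + 1) by rewrite divr_gt0 //; lra.
  near=> h.
  have hr : `|h| <= r.
    near: h; apply/nbhs_ballP; exists r => // h; rewrite mx_norm_ball /ball_ /=.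
    by rewrite sub0r normrN => /ltW.
  have he : `|h| <= e / (K + 1).
    near: h; apply/nbhs_ballP; exists (e / (K + 1)) => // h; rewrite mx_norm_ball /ball_ /=.
    by rewrite sub0r normrN => /ltW.
  have K1 : K * `|h| <= e.
    rewrite ler_pdivlMr in he; last lra.
    by have := normr_ge0 h; lra.
  have key j : `|((X \o shift 0) h - (X 0 + h *m A)) 0 j| <= e * `|h|.
    have := H j h hr; rewrite add0r => k; apply: le_trans (_ : K * `|h| ^+ 2 <= _); last first.
      by rewrite expr2 mulrA; apply: ler_wpM2r.
    apply: le_trans k; rewrite [X in `|X|](_ : _ = X h 0 j - X 0 0 j - (l0 j * h 0 0 + l1 j * h 0 1)) //.
    by rewrite -mulA /= addr0 !mxE /=; ring.
  have eh : 0 <= e * `|h| by rewrite mulr_ge0 // ltW.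
  by apply/(norm_rV2_le _ eh); split; exact: key.
move=> j; rewrite /DX /jacobian !mxE hdiff /= -!rowE !mxE; split => //.
Unshelve. all: by end_near. Qed.

(** Each coefficient converges, with an error divided by [r ^+ (i + j)], and the limits are
    absolutely summable because finite blocks of [g k - g n] are bounded by its norm. The two
    variables are real and independent here; since [f] is real, the real parts of the limit
    coefficients represent it. *)
Lemma analytic_of_geometric (g : nat -> P) (r A : R) (f : V -> R) p : 0 < r ->
  geometric r A g ->
  (forall h, `|h| < r -> gcvg (fun n => psubst2 idfun (real_complex R (h 0 0))
     (real_complex R (h 0 1)) (g n)) (real_complex R (f (p + h)))) ->
  analytic_at f p.
Proof.
move=> r0 hg hf; have r0' := ltW r0.
have hW := ring_norm_wnorm r0'; have hC := @ring_norm_cnorm R.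
have coef_geo i j : exists l, forall n,
    cnorm ((g n)`_i`_j - l) <= 4 * (A / r ^+ (i + j)) * 2^-1 ^+ n.
  apply: complex_geometric_limit => n.
  rewrite mulrAC ler_pdivlMr ?exprn_gt0 //; apply: le_trans (hg n).
  by rewrite -!coefB; exact: wnorm_coef.
have [c hc] := choice (fun ij => coef_geo ij.1 ij.2).
pose al i j := c (i, j).
have hal i j n : cnorm ((g n)`_i`_j - al i j) <= 4 * (A / r ^+ (i + j)) * 2^-1 ^+ n := hc (i, j) n.
have hd := geometric_dist hW hg.
have A0 : 0 <= A by have := hg 0%N; rewrite expr0 mulr1; apply: le_trans; exact: (rn_ge0 hW).
have sum_le N (q : P) : \sum_(i < N) \sum_(j < N) cnorm q`_i`_j * r ^+ (i + j) <= wnorm r q.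
  have [n1 [h1 h2]] := poly2_bound q; pose n := maxn n1 N.
  rewrite (@wnormE _ r q n) //; last 2 first.
  - by apply: leq_trans h1 _; exact: leq_maxl.
  - by move=> i; apply: leq_trans (h2 i) _; exact: leq_maxl.
  have Nn : (N <= n)%N by exact: leq_maxr.
  have t0 i j : 0 <= cnorm q`_i`_j * r ^+ i * r ^+ j.
    by rewrite !mulr_ge0 ?exprn_ge0 ?(rn_ge0 hC).
  rewrite (big_ord_widen _ (fun i => \sum_(j < N) cnorm q`_i`_j * r ^+ (i + j)) Nn) big_mkcond.
  apply: ler_sum => i _; case: ifP => _; last by apply: sumr_ge0.
  rewrite (big_ord_widen _ (fun j => cnorm q`_i`_j * r ^+ (i + j)) Nn) big_mkcond.
  by apply: ler_sum => j _; case: ifP => // _; rewrite exprD mulrA.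
(* The bound is uniform in the block size [N]: the coefficientwise errors, whose total depends on
   [N], disappear as [m] grows. *)
have key n N : \sum_(i < N) \sum_(j < N) cnorm (al i j - (g n)`_i`_j) * r ^+ (i + j) <= 2 * A * 2^-1 ^+ n.
  apply: (@le_half_small _ _ _ (\sum_(i < N) \sum_(j < N) 4 * A)) => m.
  pose k := maxn n m.
  have s1 := le_trans (sum_le N (g k - g n)) (hd n k (leq_maxl _ _)).
  have s2 : 2 * A * (2^-1 ^+ n - 2^-1 ^+ k) <= 2 * A * 2^-1 ^+ n.
    by apply: ler_wpM2l; [rewrite mulr_ge0|have := half_ge0 R k; lra].
  apply: le_trans (lerD (le_trans s1 s2) (lexx _)).
  rewrite mulr_suml -big_split; apply: ler_sum => i _ /=.
  rewrite mulr_suml -big_split; apply: ler_sum => j _ /=.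
  rewrite !coefB.
  have t1 := hal i j k; have rr : 0 < r ^+ (i + j) by rewrite exprn_gt0.
  have t2 : cnorm ((g k)`_i`_j - al i j) * r ^+ (i + j) <= 4 * A * 2^-1 ^+ m.
    rewrite -ler_pdivlMr //; apply: le_trans t1 _.
    have -> : 4 * A * 2^-1 ^+ m / r ^+ (i + j) = 4 * (A / r ^+ (i + j)) * 2^-1 ^+ m by ring.
    apply: ler_wpM2l; first by rewrite mulr_ge0 // divr_ge0 // ltW.
    by apply: ler_wiXn2l; rewrite ?invr_ge0 // ?invf_le1 ?ler1n // leq_maxr.
  have t3 := rn_B hC ((g k)`_i`_j - (g n)`_i`_j) ((g k)`_i`_j - al i j).
  rewrite (_ : _ - _ - _ = al i j - (g n)`_i`_j) in t3; last by ring.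
  by apply: le_trans (_ : (cnorm ((g k)`_i`_j - (g n)`_i`_j) + cnorm ((g k)`_i`_j - al i j)) * r ^+ (i + j) <= _);
    [apply: ler_wpM2r => //; exact: ltW | rewrite mulrDl lerD2l].
exists (fun i j => complex.Re (al i j)), r; split=> //.
  exists (2 * A + wnorm r (g 0%N)) => N.
  have k0 := key 0%N N; rewrite expr0 mulr1 in k0.
  apply: le_trans (lerD k0 (sum_le N (g 0%N))).
  rewrite -big_split; apply: ler_sum => i _ /=; rewrite -big_split; apply: ler_sum => j _ /=.
  rewrite -mulrDl; apply: ler_wpM2r; first by rewrite exprn_ge0.
  apply: le_trans (Re_le_cnorm _) _.
  by have := rn_D hC (al i j - (g 0%N)`_i`_j) (g 0%N)`_i`_j; rewrite subrK.
move=> h hr; have [h0 h1] := (norm_rV2_le h r0').1 (ltW hr).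
have [B hB] := hf h hr.
apply/cvgrPdist_le => e e0.
have B0 : 0 <= B by have := hB 0%N; rewrite expr0 mulr1; apply: le_trans; exact: (rn_ge0 hC).
have e1 : 0 < e / (2 * A + B + 1) by rewrite divr_gt0 //; lra.
have [n hn] := half_small e1.
have [n1 [s1 s2]] := poly2_bound (g n).
exists n1 => // N /= n1N; rewrite distrC.
set h' := real_complex R (h 0 0); set h'' := real_complex R (h 0 1).
have ev_g : psubst2 idfun h' h'' (g n) = \sum_(i < N) \sum_(j < N) (g n)`_i`_j * h' ^+ i * h'' ^+ j.
  by rewrite (@psubst2E _ _ _ _ _ _ N) //; [exact: leq_trans s1 n1N|move=> i; exact: leq_trans (s2 i) n1N].
have re_sum : complex.Re (\sum_(i < N) \sum_(j < N) al i j * h' ^+ i * h'' ^+ j) =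
   \sum_(i < N) \sum_(j < N) complex.Re (al i j) * h 0 0 ^+ i * h 0 1 ^+ j.
  rewrite raddf_sum; apply: eq_bigr => i _; rewrite raddf_sum; apply: eq_bigr => j _ /=.
  by rewrite /h' /h'' -!rmorphXn -mulrA -rmorphM /=; case: (al i j) => x y /=; rewrite mulr0 subr0 mulrA.
rewrite -re_sum -[f (p + h)]/(complex.Re (real_complex R (f (p + h)))) -raddfB.
apply: le_trans (Re_le_cnorm _) _.
set S := \sum_(i < N) _; rewrite -(subrKA (psubst2 idfun h' h'' (g n))).
apply: le_trans (rn_D hC _ _) _.
have k1 : cnorm (S - psubst2 idfun h' h'' (g n)) <= 2 * A * 2^-1 ^+ n.
  apply: le_trans (key n N); rewrite ev_g /S -sumrB.
  apply: le_trans (rn_sum hC _ _ _) _; apply: ler_sum => i _.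
  rewrite -sumrB; apply: le_trans (rn_sum hC _ _ _) _; apply: ler_sum => j _.
  rewrite -!mulrBl exprD mulrA.
  have hX (x : R) k : `|x| <= r -> cnorm (real_complex R x ^+ k) <= r ^+ k.
    move=> xr; apply: le_trans (rn_X hC _ _) _; rewrite cnorm_real.
    by apply: lerXn2r; rewrite ?nnegrE.
  apply: le_trans (rn_M hC _ _) _; apply: ler_pM; rewrite ?(rn_ge0 hC) ?hX //.
  by apply: le_trans (rn_M hC _ _) _; apply: ler_wpM2l; rewrite ?(rn_ge0 hC) ?hX.
have k2 := hB n; rewrite -/h' -/h'' in k2.
have k3 : (2 * A + B + 1) * 2^-1 ^+ n <= e.
  have k4 : 0 < 2 * A + B + 1 by lra.
  by rewrite mulrC -ler_pdivlMr // ltW.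
apply: le_trans (lerD k1 k2) _; apply: le_trans k3; rewrite -mulrDl.
by apply: ler_wpM2r; [exact: half_ge0|rewrite lerDl].
Qed.

End AnalyticPlane.

Section AnalyticGermProperties.
Variable R : realType.
Local Notation V := 'rV[R]_2.

Lemma analytic_gradient (f : V -> R) p : analytic_at f p -> exists l0 l1,
  (forall v : V, 'D_v f p = l0 * v 0 0 + l1 * v 0 1) /\
  forall (c : R -> V) t v, c t = p -> is_derive t (1 : R) c v ->
    is_derive t (1 : R) (fun s => f (c s)) (l0 * v 0 0 + l1 * v 0 1).
Proof.
move=> /analytic_atE[a [r [M [r0 M0 hM hf]]]].
have [_ fo] := analytic_first_order_coef r0 M0 hM hf.
have r2 : 0 < r / 2 by lra.
have M2 : 0 <= M / r ^+ 2 by rewrite divr_ge0 // exprn_ge0 // ltW.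
exists (a 1%N 0%N), (a 0%N 1%N); split=> [v|c t v ct dc].
  exact: first_order_derive r2 M2 fo.
by rewrite -ct in fo; exact: first_order_chain r2 M2 fo dc.
Qed.

Lemma psum_axis (a : nat -> nat -> R) n t :
  psum idfun a n.+1 t 0 = \sum_(i < n.+1) a i 0%N * t ^+ i.
Proof.
rewrite /psum; apply: eq_bigr => i _; rewrite big_ord_recl /= expr0 mulr1 big1 ?addr0 // => j _.
by rewrite /bump /= add1n expr0n /= mulr0.
Qed.

(** The first nonzero coefficient on the axis dominates the later ones near 0 and fixes the sign; if
    there is none, all partial sums vanish on the axis. *)
Lemma analytic_axis_dichotomy (f : V -> R) : analytic_at f 0 ->
  (exists2 d, 0 < d & forall t, 0 <= t <= d -> f (row2 t 0) = 0) \/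
  (exists (b : bool) (k : nat) (c d : R), [/\ 0 < c, 0 < d &
     forall t, 0 <= t <= d -> c * t ^+ k <= (-1) ^+ b * f (row2 t 0)]).
Proof.
move=> /analytic_atE[a [r [M [r0 M0 hM hf]]]].
have sumE n t : 0 <= t <= r / 2 ->
    `|\sum_(i < n.+1) a i 0%N * t ^+ i - f (row2 t 0)| <= 2 * M * 2^-1 ^+ n.
  move=> /andP[t0 tr]; have h : `|row2 t 0| <= r / 2.
    by apply/norm_rV2_le; [lra|rewrite row20 row21 normr0 ger0_norm //; split=> //; lra].
  have := hf _ h n.+1; rewrite add0r row20 row21 psum_axis => k.
  apply: le_trans k _; apply: ler_wpM2l; first by rewrite mulr_ge0.
  by apply: ler_wiXn2l; rewrite ?invr_ge0 // ?invf_le1 ?ler1n.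
have [[k0 hk0]|none] := pselect (exists k, a k 0%N != 0); last first.
  left; exists (r / 2) => [|t ht]; first by lra.
  apply/eqP; rewrite -normr_eq0 -normr_le0; apply: (@le_half_small _ _ _ (2 * M)) => n.
  have := sumE n t ht; rewrite add0r big1 ?sub0r ?normrN ?normr_id // => i _.
  have [->|h] := eqVneq (a i 0%N) 0; first by rewrite mul0r.
  by case: none; exists i.
right; have ex : exists k, a k 0%N != 0 by exists k0.
case: (ex_minnP ex) => k ak kmin.
pose b := a k 0%N < 0; pose c := `|a k 0%N| / 2.
have ak0 : 0 < `|a k 0%N| by rewrite normr_gt0.
have rk : 0 < r ^+ k.+1 by rewrite exprn_gt0.
have M1 : 0 < 2 * (M + 1) by lra.
(* For [t <= d] the tail [M * (t / r) ^+ k.+1] is at most half of the leading term. *)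
pose d := Num.min (r / 2) (`|a k 0%N| * r ^+ k.+1 / (2 * (M + 1))).
have d0 : 0 < d by rewrite lt_min !divr_gt0 // mulr_gt0.
exists b, k, c, d; split=> //; first by rewrite divr_gt0.
move=> t /andP[t0 td].
have tr : t <= r / 2 by apply: le_trans td _; rewrite ge_min lexx.
have tk : t * (2 * (M + 1)) <= `|a k 0%N| * r ^+ k.+1.
  by rewrite -ler_pdivlMr //; apply: le_trans td _; rewrite ge_min lexx orbT.
have tkk : M * (t / r) ^+ k.+1 <= c * t ^+ k.
  rewrite exprMn exprVn exprSr mulrA ler_pdivrMr //.
  have := ler_wpM2r (exprn_ge0 k t0) tk; rewrite /c.
  have := mulr_ge0 t0 (exprn_ge0 k t0).
  move: (t ^+ k) (r ^+ k.+1) (`|a k 0%N|) => x y z; lra.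
apply: (@le_half_small _ _ _ (2 * M)) => n.
pose m := (n + k)%N.
have bnd : `|\sum_(i < m.+1) a i 0%N * t ^+ i - f (row2 t 0)| <= 2 * M * 2^-1 ^+ n.
  apply: le_trans (sumE m t _) _; first by rewrite t0.
  apply: ler_wpM2l; first by rewrite mulr_ge0.
  by apply: ler_wiXn2l; rewrite ?invr_ge0 // ?invf_le1 ?ler1n // leq_addr.
have km : (k < m.+1)%N by rewrite ltnS leq_addl.
have split_k : \sum_(i < m.+1) a i 0%N * t ^+ i =
    a k 0%N * t ^+ k + \sum_(i < m.+1 | i != Ordinal km) a i 0%N * t ^+ i.
  by rewrite (bigD1 (Ordinal km)).
have tail : `|\sum_(i < m.+1 | i != Ordinal km) a i 0%N * t ^+ i| <= M * (t / r) ^+ k.+1.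
  apply: le_trans (ler_norm_sum _ _ _) _.
  apply: le_trans (_ : (\sum_(i < m.+1) `|a i 0%N| * r ^+ i) * (t / r) ^+ k.+1 <= _); last first.
    apply: ler_wpM2r; first by rewrite exprn_ge0 // divr_ge0 // ltW.
    apply: le_trans (hM m.+1); apply: ler_sum => i _.
    rewrite big_ord_recl /= addn0 lerDl; apply: sumr_ge0 => j _.
    by rewrite mulr_ge0 // exprn_ge0 // ltW.
  rewrite mulr_suml big_mkcond; apply: ler_sum => i _.
  have p0 : 0 <= `|a i 0%N| * r ^+ i * (t / r) ^+ k.+1.
    apply: mulr_ge0; first by rewrite mulr_ge0 // exprn_ge0 // ltW.
    by rewrite exprn_ge0 // divr_ge0 // ltW.
  case: ifP => // ik; have [->|hi] := eqVneq (a i 0%N) 0; first by rewrite mul0r normr0 !mul0r.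
  have ki : (k < i)%N.
    rewrite ltn_neqAle (kmin _ hi) andbT; apply/eqP => e.
    by case/negP: ik; apply/eqP; apply: val_inj; rewrite /= -e.
  rewrite normrM (ger0_norm (exprn_ge0 _ t0)) -mulrA; apply: ler_wpM2l => //.
  have -> : t ^+ i = r ^+ i * (t / r) ^+ i by rewrite -exprMn mulrC divfK // gt_eqF.
  apply: ler_wpM2l; first by rewrite exprn_ge0 // ltW.
  apply: ler_wiXn2l => //; first by rewrite divr_ge0 // ltW.
  by rewrite ler_pdivrMr //; lra.
have sg : (-1) ^+ b * a k 0%N = `|a k 0%N|.
  rewrite /b; case: ltP => h; first by rewrite expr1 mulN1r ltr0_norm.
  by rewrite expr0 mul1r ger0_norm.
have key : `|(-1) ^+ b * f (row2 t 0) - `|a k 0%N| * t ^+ k| <=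
    M * (t / r) ^+ k.+1 + 2 * M * 2^-1 ^+ n.
  rewrite -sg -(mulrA ((-1) ^+ b)) -mulrBr normrM normrX normrN1 expr1n mul1r.
  have -> : f (row2 t 0) - a k 0%N * t ^+ k =
    \sum_(i < m.+1 | i != Ordinal km) a i 0%N * t ^+ i -
    (\sum_(i < m.+1) a i 0%N * t ^+ i - f (row2 t 0)) by rewrite split_k; ring.
  by apply: le_trans (ler_normB _ _) _; exact: lerD.
move: key tkk; rewrite /c ler_norml => /andP[k1 _].
move: k1; move: ((-1) ^+ b * f (row2 t 0)) (M * (t / r) ^+ k.+1) (2 * M * 2^-1 ^+ n) => x y z.
move: (`|a k 0%N|) (t ^+ k) => u v; lra.
Qed.
End AnalyticGermProperties.

(** * Integral curves *)

Section PolynomialPrimitive.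
Variable R : realType.
Implicit Types p q : {poly R}.
Local Notation absn := (pnorm (fun x : R => `|x|)).

(** The antiderivative vanishing at 0. Each integration gains a factor [r] in norm
    ([primitive_norm]), which makes the Picard map contracting for short times. *)
Definition primitive p : {poly R} := \poly_(i < size p) (p`_i / i.+1%:R) * 'X.

Lemma primitive_deriv p : (primitive p)^`() = p.
Proof.
apply/polyP => i; rewrite coef_deriv /primitive coefMX /= coef_poly.
case: ltnP => h; last by rewrite mul0rn nth_default.
by rewrite -(mulr_natr (p`_i / i.+1%:R)) divfK // pnatr_eq0.
Qed.

Lemma primitive0 p : (primitive p).[0] = 0.
Proof. by rewrite /primitive hornerMX mulr0. Qed.

Lemma primitiveB p q : primitive (p - q) = primitive p - primitive q.
Proof.
rewrite /primitive -mulrBl; congr (_ * _); apply/polyP => i; rewrite coefB !coef_poly.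
have e (f : {poly R}) : (if (i < size f)%N then f`_i / i.+1%:R else 0) = f`_i / i.+1%:R.
  by case: ltnP => // h; rewrite nth_default // mul0r.
by rewrite !e coefB mulrBl.
Qed.

Lemma primitive_norm (r : R) p : 0 <= r -> absn r (primitive p) <= r * absn r p.
Proof.
move=> r0; have hn := ring_norm_abs R.
rewrite /primitive (pnormMX hn) mulrC; apply: ler_wpM2l => //.
rewrite -[leRHS]mul1r; apply: (pnorm_le_coef hn) => // i.
rewrite mul1r coef_poly; case: ifP => _; last by rewrite normr0.
rewrite normrM normfV [`|i.+1%:R|]ger0_norm // ler_pdivrMr ?ltr0n //.
by rewrite -[leLHS]mulr1; apply: ler_wpM2l => //; rewrite ler1n.
Qed.

Lemma horner_le_absn (r t : R) p : `|t| <= r -> `|p.[t]| <= absn r p.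
Proof.
move=> tr; have r0 := le_trans (normr_ge0 t) tr.
rewrite horner_coef; apply: le_trans (ler_norm_sum _ _ _) _; apply: ler_sum => i _.
by rewrite normrM normrX; apply: ler_wpM2l => //; apply: lerXn2r; rewrite ?nnegrE.
Qed.
End PolynomialPrimitive.

(** * Local existence by Picard iteration on polynomials in time *)

Section LocalExistence.
Variable R : realType.
Local Notation V := 'rV[R]_2.
Local Notation absn := (pnorm (fun x : R => `|x|)).
Implicit Types (p q h v : V) (a : nat -> nat -> R).

Lemma abs_sum_le_radius a n (s r : R) : 0 <= s -> s <= r -> abs_sum a n s <= abs_sum a n r.
Proof.
move=> s0 sr; apply: ler_sum => i _; apply: ler_sum => j _; apply: ler_wpM2l => //.
by apply: lerXn2r; rewrite ?nnegrE // (le_trans s0).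
Qed.

Lemma analytic_pairE (X : V -> V) (p : V) : (forall j, analytic_at (fun q => X q 0 j) p) ->
  exists (a : 'I_2 -> nat -> nat -> R) r M, [/\ 0 < r, 0 <= M,
    forall j n, abs_sum (a j) n r <= M &
    forall j (h : V), `|h| <= r / 2 -> forall n,
      `|psum idfun (a j) n (h 0 0) (h 0 1) - X (p + h) 0 j| <= 2 * M * 2^-1 ^+ n].
Proof.
move=> hX.
have [a0 [r0 [M0 [r00 M00 hM0 hf0]]]] := analytic_atE (hX 0).
have [a1 [r1 [M1 [r10 M10 hM1 hf1]]]] := analytic_atE (hX 1).
pose r := Num.min r0 r1; pose M := M0 + M1.
have rr0 : r <= r0 by rewrite ge_min lexx.
have rr1 : r <= r1 by rewrite ge_min lexx orbT.
have r_gt0 : 0 < r by rewrite lt_min r00.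
have MM0 : M0 <= M by rewrite lerDl.
have MM1 : M1 <= M by rewrite lerDr.
exists (fun j => if j == 0 then a0 else a1), r, M; split=> //.
- exact: addr_ge0.
- move=> j n; case: (ord2E j) => -> /=.
    exact: le_trans (abs_sum_le_radius _ _ (ltW r_gt0) rr0) (le_trans (hM0 n) MM0).
  exact: le_trans (abs_sum_le_radius _ _ (ltW r_gt0) rr1) (le_trans (hM1 n) MM1).
have bnd (m : R) n : m <= M -> 2 * m * 2^-1 ^+ n <= 2 * M * 2^-1 ^+ n.
  by move=> h; apply: ler_wpM2r; [exact: half_ge0|exact: ler_wpM2l].
move=> j h hr n; case: (ord2E j) => -> /=.
  by apply: le_trans (bnd _ n MM0); apply: hf0; apply: le_trans hr _; lra.
by apply: le_trans (bnd _ n MM1); apply: hf1; apply: le_trans hr _; lra.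
Qed.

Lemma is_derive_rV2 (c : R -> V) (t : R) v :
  (forall j, is_derive t (1 : R) (fun s => c s 0 j) (v 0 j)) -> is_derive t (1 : R) c v.
Proof.
move=> H; apply/is_derive_epsP => e e0.
have [d0 d00 h0] := (is_derive_epsP _ _ _).1 (H 0) e e0.
have [d1 d10 h1] := (is_derive_epsP _ _ _).1 (H 1) e e0.
exists (Num.min d0 d1); first by rewrite lt_min d00.
move=> h; rewrite lt_min => /andP[/h0 k0 /h1 k1].
have eh : 0 <= e * `|h| by rewrite mulr_ge0 // ltW.
by apply/(norm_rV2_le _ eh); rewrite !mxE.
Qed.

Lemma is_derive_hderiv (f : R -> R) t (l : R) :
  is_derive t (1 : R) f l <-> hderiv (fun s => real_complex R (f s)) t (real_complex R l).
Proof.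
split=> [h|/hderiv_reim[//]].
apply/hderiv_reim; split => //=; exact: is_derive_cst.
Qed.

Section Picard.
Variables (a0 a1 : nat -> nat -> R) (r M s tau d0 d1 : R).
Hypotheses (M0 : 0 <= M) (s0 : 0 < s) (sr : 4 * s <= r).
Hypotheses (hM0 : forall n, abs_sum a0 n r <= M) (hM1 : forall n, abs_sum a1 n r <= M).
Hypotheses (tau0 : 0 < tau) (tauM : 4 * (tau * (M + 1)) <= s).
Hypotheses (hd0 : `|d0| <= s) (hd1 : `|d1| <= s).

Let hn : ring_norm (absn tau).
Proof. exact: (ring_norm_pnorm (ring_norm_abs R) (ltW tau0)). Qed.

Definition picard_rhs a n (u : {poly R} * {poly R}) : {poly R} :=
  psum polyC a n u.1 u.2.

(** Iterates stay polynomials in the time, so integration is algebraic. Stage [n] uses the square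
    sum of side [n]; the starting point [(d0, d1)] ranges over a whole square with the same
    [tau]. *)
Definition picard_step n (u : {poly R} * {poly R}) : {poly R} * {poly R} :=
  (d0%:P + primitive (picard_rhs a0 n u), d1%:P + primitive (picard_rhs a1 n u)).

Fixpoint picard n : {poly R} * {poly R} :=
  if n is k.+1 then picard_step k (picard k) else (0, 0).

Definition picard_ball (u : {poly R} * {poly R}) :=
  absn tau u.1 <= 2 * s /\ absn tau u.2 <= 2 * s.

Lemma polyC_norm (x : R) : absn tau x%:P <= `|x|.
Proof. by rewrite (pnormC (ring_norm_abs R)). Qed.

Lemma picard_rhs_norm a n u : (forall n, abs_sum a n r <= M) -> picard_ball u ->
  absn tau (picard_rhs a n u) <= M.
Proof.
move=> hM [h1 h2]; have s0' := s0; have sr' := sr.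
apply: le_trans (psum_norm hn polyC_norm a n h1 h2) _.
by apply: le_trans (hM n); apply: abs_sum_le_radius; lra.
Qed.

Lemma tau_M : tau * M <= s / 4.
Proof. by have := tauM; have := ltW tau0; lra. Qed.

Lemma picard_ballP n : picard_ball (picard n).
Proof.
elim: n => [|n IH]; first by split; rewrite /= pnorm0 mulr_ge0 // ltW.
have s0' := s0; have k := tau_M.
have key a d : `|d| <= s -> (forall n, abs_sum a n r <= M) ->
    absn tau (d%:P + primitive (picard_rhs a n (picard n))) <= 2 * s.
  move=> hd hM; apply: le_trans (rn_D hn _ _) _.
  have k1 := primitive_norm (picard_rhs a n (picard n)) (ltW tau0).
  have k2 := ler_wpM2l (ltW tau0) (picard_rhs_norm n hM IH).
  have k3 := polyC_norm d; lra.
by split; exact: key.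
Qed.

Definition picard_dist (u v : {poly R} * {poly R}) :=
  absn tau (u.1 - v.1) + absn tau (u.2 - v.2).

Lemma picard_rhs_lip a n (u v : {poly R} * {poly R}) : (forall n, abs_sum a n r <= M) ->
  picard_ball u -> picard_ball v ->
  absn tau (picard_rhs a n u - picard_rhs a n v) <= picard_dist u v / (2 * s) * M.
Proof.
move=> hM [h1 h2] [h3 h4]; have s0' := s0; have sr' := sr.
have n1 := rn_ge0 hn (u.1 - v.1); have n2 := rn_ge0 hn (u.2 - v.2).
have s2 : 0 < 2 * s by lra.
have e1 : absn tau (u.1 - v.1) <= picard_dist u v by rewrite /picard_dist lerDl.
have e2 : absn tau (u.2 - v.2) <= picard_dist u v by rewrite /picard_dist lerDr.
apply: le_trans (psum_lip a n hn polyC_norm s2 h1 h2 h3 h4 e1 e2) _.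
apply: ler_wpM2l; first by apply: divr_ge0; [exact: addr_ge0|exact: ltW].
by apply: le_trans (hM n); apply: abs_sum_le_radius; lra.
Qed.

Lemma picard_rhs_geo a n u : (forall n, abs_sum a n r <= M) -> picard_ball u ->
  absn tau (picard_rhs a n.+1 u - picard_rhs a n u) <= M * 2^-1 ^+ n.
Proof.
move=> hM [h1 h2]; have s0' := s0; have sr' := sr.
have r0 : 0 < r by lra.
by apply: (psum_diff hn polyC_norm n r0 hM); lra.
Qed.

(** Per component the Lipschitz part contributes [tau * M / (2 * s) <= 1/8] and the truncation
    [tau * M <= s / 4]. Two components give the ratio 1/4 and the source [s / 2] of
    [perturbed_contraction]. *)
Lemma picard_dist_le n : picard_dist (picard n.+1) (picard n) <= 6 * s * 2^-1 ^+ n.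
Proof.
have s0' := s0; have k := tau_M.
have -> : 6 * s = 4 * s + 4 * (s / 2) by field.
have s4 : 0 <= 4 * s by rewrite mulr_ge0 // ltW.
have s2 : 0 <= s / 2 by rewrite divr_ge0 // ltW.
apply: (@perturbed_contraction R (fun n => picard_dist (picard n.+1) (picard n)) (4 * s) (s / 2) s4 s2).
  move: (picard 1%N) (picard_ballP 1%N) => w [h1 h2].
  rewrite /picard_dist /picard [(0, 0).1]/= [(0, 0).2]/= !subr0; apply: le_trans (lerD h1 h2) _.
  by rewrite -mulrDl -natrD.
move=> m; set u := picard m; set v := picard m.+1.
have hu : picard_ball u := picard_ballP m; have hv : picard_ball v := picard_ballP m.+1.
have key a d : (forall n, abs_sum a n r <= M) ->
    absn tau ((d%:P + primitive (picard_rhs a m.+1 v)) - (d%:P + primitive (picard_rhs a m u)))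
    <= picard_dist v u / 8 + s / 4 * 2^-1 ^+ m.
  move=> hM; have -> : d%:P + primitive (picard_rhs a m.+1 v) - (d%:P + primitive (picard_rhs a m u))
    = primitive (picard_rhs a m.+1 v) - primitive (picard_rhs a m u) by ring.
  rewrite -primitiveB; apply: le_trans (primitive_norm _ (ltW tau0)) _.
  have k1 := picard_rhs_lip m.+1 hM hv hu; have k2 := picard_rhs_geo m hM hu.
  have k3 := rn_D hn (picard_rhs a m.+1 v - picard_rhs a m.+1 u) (picard_rhs a m.+1 u - picard_rhs a m u).
  rewrite subrKA in k3.
  have k4 := ler_wpM2l (ltW tau0) (le_trans k3 (lerD k1 k2)).
  apply: le_trans k4 _; rewrite mulrDr.
  have D0 : 0 <= picard_dist v u by rewrite /picard_dist addr_ge0 // (rn_ge0 hn).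
  have e1 : tau * (picard_dist v u / (2 * s) * M) = picard_dist v u / (2 * s) * (tau * M) by ring.
  have e2 : tau * (M * 2^-1 ^+ m) = (tau * M) * 2^-1 ^+ m by ring.
  rewrite e1 e2; apply: lerD; last by apply: ler_wpM2r => //; exact: half_ge0.
  apply: le_trans (ler_wpM2l _ k) _; first by rewrite divr_ge0 // mulr_ge0 // ltW.
  have -> : picard_dist v u / (2 * s) * (s / 4) = picard_dist v u / 8 by field; rewrite gt_eqF.
  by [].
have k0 := key a0 d0 hM0; have k1 := key a1 d1 hM1.
rewrite -[picard m.+2]/(picard_step m.+1 v) -[X in picard_dist (picard_step _ _) X]/(picard_step m u).
rewrite {1}/picard_dist /picard_step [_.1]/= [_.1]/= [_.2]/= [_.2]/=.
apply: le_trans (lerD k0 k1) _; rewrite le_eqVlt; apply/orP; left; apply/eqP.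
by move: (picard_dist v u) => D; field.
Qed.

Variables (X0 X1 : R -> R -> R).
Hypothesis hX0 : forall x y n, `|x| <= 2 * s -> `|y| <= 2 * s ->
  `|psum idfun a0 n x y - X0 x y| <= 2 * M * 2^-1 ^+ n.
Hypothesis hX1 : forall x y n, `|x| <= 2 * s -> `|y| <= 2 * s ->
  `|psum idfun a1 n x y - X1 x y| <= 2 * M * 2^-1 ^+ n.

Lemma picard_solution : exists c0 c1 : R -> R,
  [/\ c0 0 = d0, c1 0 = d1 & forall t, `|t| < tau ->
   [/\ `|c0 t| <= 2 * s, `|c1 t| <= 2 * s,
      is_derive t (1 : R) c0 (X0 (c0 t) (c1 t)) &
      is_derive t (1 : R) c1 (X1 (c0 t) (c1 t))] ].
Proof.
have s0' := s0; have sr' := sr; have M0' := M0.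
have lim (pr : {poly R} * {poly R} -> {poly R}) :
    (forall u v : {poly R} * {poly R}, absn tau (pr u - pr v) <= picard_dist u v) ->
    forall t, exists l, `|t| < tau -> forall n, `|(pr (picard n)).[t] - l| <= 12 * s * 2^-1 ^+ n.
  move=> hpr t; case: (ltP `|t| tau) => [ht|]; last by exists 0.
  have [l hl] : exists l, forall n, `|(pr (picard n)).[t] - l| <= 2 * (6 * s) * 2^-1 ^+ n.
    apply: real_geometric_limit => n; rewrite -hornerN -hornerD.
    apply: le_trans (horner_le_absn _ (ltW ht)) _.
    by apply: le_trans (hpr _ _) _; exact: picard_dist_le.
  by exists l => _ n; have := hl n; rewrite mulrA -natrM.
have pr1 (u v : {poly R} * {poly R}) : absn tau (u.1 - v.1) <= picard_dist u v.
  by rewrite /picard_dist lerDl (rn_ge0 hn).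
have pr2 (u v : {poly R} * {poly R}) : absn tau (u.2 - v.2) <= picard_dist u v.
  by rewrite /picard_dist lerDr (rn_ge0 hn).
have [c0 hc0] := choice (lim _ pr1); have [c1 hc1] := choice (lim _ pr2).
exists c0, c1.
have bnd c (pr : {poly R} * {poly R} -> {poly R}) t :
    (forall n, absn tau (pr (picard n)) <= 2 * s) ->
    (forall n, `|(pr (picard n)).[t] - c| <= 12 * s * 2^-1 ^+ n) -> `|t| < tau -> `|c| <= 2 * s.
  move=> h1 h2 ht; apply: (@le_half_small _ _ _ (12 * s)) => n.
  have k1 := le_trans (horner_le_absn (pr (picard n)) (ltW ht)) (h1 n); have k2 := h2 n.
  have := ler_normB (pr (picard n)).[t] ((pr (picard n)).[t] - c).
  by rewrite subKr; lra.
have init c (pr : {poly R} * {poly R} -> {poly R}) (d : R) :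
    (forall n, `|(pr (picard n)).[0] - c| <= 12 * s * 2^-1 ^+ n) ->
    (forall n, (pr (picard n.+1)).[0] = d) -> c = d.
  move=> h1 h2; apply/eqP; rewrite -subr_eq0 -normr_le0.
  apply: (@le_half_small _ _ _ (12 * s)) => n; rewrite add0r distrC.
  have := h1 n.+1; rewrite h2 exprS; have := half_ge0 R n; have := mulr_ge0 (ltW s0) (half_ge0 R n).
  by move=> k1 k2; lra.
have z : `|0 : R| < tau by rewrite normr0.
split.
- by apply: (init _ _ _ (hc0 0 z)) => n; rewrite /= hornerD hornerC primitive0 addr0.
- by apply: (init _ _ _ (hc1 0 z)) => n; rewrite /= hornerD hornerC primitive0 addr0.
move=> t ht.
have b0 t' : `|t'| < tau -> `|c0 t'| <= 2 * s.
  by move=> h; apply: (bnd _ fst t') => //; [move=> n; exact: (picard_ballP n).1|exact: hc0].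
have b1 t' : `|t'| < tau -> `|c1 t'| <= 2 * s.
  by move=> h; apply: (bnd _ snd t') => //; [move=> n; exact: (picard_ballP n).2|exact: hc1].
have der (a : nat -> nat -> R) (X : R -> R -> R) (c : R -> R) (d : R)
    (pr : {poly R} * {poly R} -> {poly R}) :
    (forall n, abs_sum a n r <= M) ->
    (forall x y n, `|x| <= 2 * s -> `|y| <= 2 * s -> `|psum idfun a n x y - X x y| <= 2 * M * 2^-1 ^+ n) ->
    (forall t, `|t| < tau -> forall n, `|(pr (picard n)).[t] - c t| <= 12 * s * 2^-1 ^+ n) ->
    (forall n, pr (picard n.+1) = d%:P + primitive (picard_rhs a n (picard n))) ->
    is_derive t (1 : R) c (X (c0 t) (c1 t)).
  move=> hM hX hc hpr; apply/is_derive_hderiv.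
  have itv u : - tau < u < tau -> `|u| < tau by rewrite -ltr_norml.
  (* The derivative of [picard n.+1] is exactly the right-hand side at [picard n]; its convergence
     combines the Lipschitz bound with the truncation error. *)
  apply: (@hderiv_limit R
    (fun n u => real_complex R (pr (picard n.+1)).[u])
    (fun n u => real_complex R (picard_rhs a n (picard n)).[u])
    (fun u => real_complex R (c u)) (fun u => real_complex R (X (c0 u) (c1 u)))
    (- tau) tau (12 * s + 14 * M)).
  - by rewrite -ltr_norml.
  - move=> n u _; apply/is_derive_hderiv; rewrite hpr.
    rewrite -[X in is_derive _ _ _ X](_ : (d%:P + primitive (picard_rhs a n (picard n)))^`().[u] = _).
      exact: is_derive_poly.
    by rewrite derivD derivC add0r primitive_deriv.
  - move=> n u /itv hu; rewrite -(rmorphB (real_complex R)) cnorm_real; apply: le_trans (hc u hu n.+1) _.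
    rewrite exprS; have k1 := mulr_ge0 (ltW s0) (half_ge0 R n); have k2 := mulr_ge0 M0 (half_ge0 R n).
    by rewrite mulrDl; lra.
  move=> n u /itv hu; rewrite -(rmorphB (real_complex R)) cnorm_real.
  have -> : (picard_rhs a n (picard n)).[u] = psum idfun a n (picard n).1.[u] (picard n).2.[u].
    by apply: (@psum_rmorph _ _ _ polyC idfun (horner_eval u)) => x; exact: hornerC.
  have p1 : `|(picard n).1.[u]| <= 2 * s.
    by apply: le_trans (horner_le_absn _ (ltW hu)) _; exact: (picard_ballP n).1.
  have p2 : `|(picard n).2.[u]| <= 2 * s.
    by apply: le_trans (horner_le_absn _ (ltW hu)) _; exact: (picard_ballP n).2.
  have s2 : 0 < 2 * s by lra.
  have q3 := hc0 u hu n; have q4 := hc1 u hu n.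
  have q1 := psum_lip a n (ring_norm_abs R) (f := idfun) (fun x => lexx _) s2
    p1 p2 (b0 u hu) (b1 u hu) q3 q4.
  have q2 := hX _ _ n (b0 u hu) (b1 u hu).
  rewrite -(subrKA (psum idfun a n (c0 u) (c1 u))); apply: le_trans (ler_normD _ _) _.
  have q5 : 12 * s * 2^-1 ^+ n / (2 * s) * abs_sum a n (2 * (2 * s)) <= 6 * M * 2^-1 ^+ n.
    rewrite (_ : 12 * s * _ / _ = 6 * 2^-1 ^+ n); last by field; rewrite gt_eqF.
    rewrite [leRHS]mulrAC; apply: ler_wpM2l; first by rewrite mulr_ge0 // half_ge0.
    by apply: le_trans (hM n); apply: abs_sum_le_radius; lra.
  have k1 := mulr_ge0 (ltW s0) (half_ge0 R n); have k2 := mulr_ge0 M0 (half_ge0 R n).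
  rewrite mulrDl; apply: le_trans (lerD (le_trans q1 q5) q2) _.
  lra.
split; [exact: b0|exact: b1| |].
- exact: (der a0 X0 c0 d0 fst).
- exact: (der a1 X1 c1 d1 snd).
Qed.
End Picard.
End LocalExistence.

(** * Orbits: extension, time reversal and escape *)

Section Orbits.
Variable R : realType.
Local Notation V := 'rV[R]_2.
Implicit Types (U : set V) (X : V -> V) (p q h : V) (c : R -> V).

Lemma nbhs_rV2P (p : V) (U : set V) : nbhs p U <->
  exists2 d, 0 < d & forall h, `|h| <= d -> U (p + h).
Proof.
split=> [/nbhs_ballP[d /= d0 hd]|[d d0 hd]].
  exists (d / 2); first by rewrite divr_gt0.
  move=> h hh; apply: hd; rewrite mx_norm_ball /ball_ /= opprD addrA subrr sub0r normrN.
  by apply: le_lt_trans hh _; lra.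
apply/nbhs_ballP; exists d => // q; rewrite mx_norm_ball /ball_ /= => hq.
by rewrite -(subrK p q) addrC; apply: hd; rewrite distrC ltW.
Qed.

(** One time [tau] serves all starting points of a neighborhood; this uniformity is what [escape]
    consumes. *)
Lemma local_existence U X p : nbhs p U ->
  (forall j, analytic_at (fun q => X q 0 j) p) ->
  exists rho tau, [/\ 0 < rho, 0 < tau & forall q, `|q - p| <= rho ->
    exists c, c 0 = q /\ integral_curve U X `]- tau, tau[ c].
Proof.
move=> /nbhs_rV2P[de de0 hU] hX.
have [a [r [M [r0 M0 hM hf]]]] := analytic_pairE hX.
pose s := Num.min (r / 4) (de / 2).
have s0 : 0 < s by rewrite lt_min !divr_gt0.
have sr' : s <= r / 4 by rewrite ge_min lexx.
have sd' : s <= de / 2 by rewrite ge_min lexx orbT.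
clearbody s.
have sr : 4 * s <= r by lra.
pose tau := s / (4 * (M + 1)).
have M4 : 0 < 4 * (M + 1) by lra.
have tau0 : 0 < tau by rewrite divr_gt0.
have tauM : 4 * (tau * (M + 1)) <= s by rewrite /tau [leLHS](_ : _ = s) //; field; lra.
exists s, tau; split => // q hq.
have hd0 : `|(q - p) 0 0| <= s := le_trans (norm_coord _ _) hq.
have hd1 : `|(q - p) 0 1| <= s := le_trans (norm_coord _ _) hq.
have s2 : 0 <= 2 * s by lra.
have row_le x y : `|x| <= 2 * s -> `|y| <= 2 * s -> `|row2 x y| <= 2 * s.
  by move=> hx hy; apply/(norm_rV2_le _ s2); rewrite row20 row21.
have hX' j x y n : `|x| <= 2 * s -> `|y| <= 2 * s ->
    `|psum idfun (a j) n x y - X (p + row2 x y) 0 j| <= 2 * M * 2^-1 ^+ n.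
  move=> hx hy; have h := row_le _ _ hx hy; have h' : `|row2 x y| <= r / 2 by lra.
  by have := hf j _ h' n; rewrite row20 row21.
have [c0 [c1 [e0 e1 H]]] := picard_solution M0 s0 sr (hM 0) (hM 1) tau0 tauM hd0 hd1 (hX' 0) (hX' 1).
exists (fun t => p + row2 (c0 t) (c1 t)); split.
  by apply: rV2P; rewrite !mxE /= ?e0 ?e1 !mxE addrC subrK.
move=> t; rewrite /= in_itv /= -ltr_norml => /H[b0 b1 D0 D1]; split.
  by apply: hU; apply: le_trans (row_le _ _ b0 b1) _; lra.
have shift_deriv (u : R -> R) (l k : R) : is_derive t (1 : R) u l -> is_derive t (1 : R) (fun s => k + u s) l.
  by move=> h; have := is_deriveD (is_derive_cst k t (1 : R)) h; rewrite add0r.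
apply: is_derive_rV2 => j; case: (ord2E j) => ->; last first.
  rewrite (_ : (fun s => _) = (fun s => p 0 1 + c1 s)); last by apply/funext => u; rewrite !mxE.
  exact: shift_deriv.
rewrite (_ : (fun s => _) = (fun s => p 0 0 + c0 s)); last by apply/funext => u; rewrite !mxE.
exact: shift_deriv.
Qed.

Lemma orbit_base U X p c tau : 0 < tau -> c 0 = p -> integral_curve U X `]- tau, tau[ c ->
  orbit_in U X p p.
Proof.
move=> tau0 c0 hc; exists (- tau), tau, c; split=> //; first by rewrite oppr_lt0 tau0.
by exists 0 => //; rewrite in_itv /= oppr_lt0 tau0.
Qed.

(** The curve [c], cut at [t0], is continued by a translate of [c']. At the junction both pieces
    have velocity [X (c t0)], so their error bounds combine into a derivative. *)
Lemma orbit_extend U X p c c' (a b t0 tau s : R) :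
  a < 0 < b -> integral_curve U X `]a, b[ c -> c 0 = p -> 0 <= t0 < b ->
  c' 0 = c t0 -> integral_curve U X `]- tau, tau[ c' -> 0 <= s < tau ->
  orbit_in U X p (c' s).
Proof.
move=> /andP[a0 b0] hc cp /andP[t00 t0b] c'0 hc' /andP[s0 st].
pose g t := if t <= t0 then c t else c' (t - t0).
exists a, (t0 + tau), g; split.
- by apply/andP; split => //; lra.
- move=> t; rewrite /= in_itv /= => /andP[at_ tt].
  have dc' : t0 - tau < t -> U (c' (t - t0)) /\
      is_derive t (1 : R) (fun u => c' (u - t0)) (X (c' (t - t0))).
    move=> h; have [|h1 h2] := hc' (t - t0); first by rewrite /= in_itv /=; apply/andP; split; lra.
    by split=> //; exact: is_derive_shift h2.
  have dc : t <= t0 -> U (c t) /\ is_derive t (1 : R) c (X (c t)).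
    by move=> h; apply: hc; rewrite /= in_itv /=; apply/andP; split; lra.
  rewrite {1 3}/g; case: (ltgtP t t0) => tt0.
  + have [h1 /is_derive_epsP h2] := dc (ltW tt0); split=> //; apply/is_derive_epsP => e e0.
    have [d d0 hd] := h2 e e0; exists (Num.min d (t0 - t)); first by rewrite lt_min d0 subr_gt0.
    move=> h; rewrite lt_min => /andP[/hd k1 k2].
    have k3 := ler_norm h; have k4 : t + h <= t0 by lra.
    by rewrite /g (ltW tt0) k4.
  + have [|h1 /is_derive_epsP h2] := dc'; first by lra.
    split=> //; apply/is_derive_epsP => e e0.
    have [d d0 hd] := h2 e e0; exists (Num.min d (t - t0)); first by rewrite lt_min d0 subr_gt0.
    move=> h; rewrite lt_min => /andP[/hd k1 k2].
    have k3 := ler_norm (- h); rewrite normrN in k3.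
    have k4 : t0 < t + h by lra.
    by rewrite /g (leNgt t) tt0 /= (leNgt (t + h)) k4.
  + have [|h1 /is_derive_epsP h2] := dc'; first by lra.
    have tt1 : t <= t0 by rewrite tt0.
    have [h3 /is_derive_epsP h4] := dc tt1.
    split=> //; apply/is_derive_epsP => e e0.
    have [d d0 hd] := h2 e e0; have [d1 d10 hd1] := h4 e e0.
    exists (Num.min d d1); first by rewrite lt_min d0.
    move=> h; rewrite lt_min => /andP[/hd k1 /hd1 k2].
    rewrite {2}/g tt0 lexx /g; case: ifP => _; first by rewrite -tt0.
    move: k1; rewrite tt0 subrr c'0; exact.
- by rewrite /g t00.
exists (t0 + s); first by rewrite in_itv /=; apply/andP; split; lra.
rewrite /g; case: leP => h; last by rewrite addrAC subrr add0r.
have -> : s = 0 by lra.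
by rewrite addr0 c'0.
Qed.

Lemma integral_curve_opp U X c (a b : R) : integral_curve U X `]a, b[ c ->
  integral_curve U (fun q => - X q) `]- b, - a[ (fun t => c (- t)).
Proof.
move=> hc t; rewrite /= in_itv /= => /andP[h1 h2].
have [|k1 /is_derive_epsP k2] := hc (- t).
  by rewrite /= in_itv /=; apply/andP; split; lra.
split=> //; apply/is_derive_epsP => e e0; have [d d0 hd] := k2 e e0.
exists d => // h hh; have := hd (- h); rewrite normrN => /(_ hh).
by rewrite -opprD scaleNr scalerN.
Qed.

Lemma orbit_opp U X p : orbit_in U X p `<=` orbit_in U (fun q => - X q) p.
Proof.
move=> q [a [b [c [/andP[a0 b0] hc cp [t tab <-]]]]].
exists (- b), (- a), (fun t => c (- t)); split.
- by rewrite oppr_lt0 oppr_gt0 a0 b0.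
- exact: integral_curve_opp.
- by rewrite oppr0.
exists (- t); last by rewrite opprK.
by move: tab; rewrite !in_itv /= !ltrN2 andbC.
Qed.

(** From a point where [F] is within [e * tau / 4] of its supremum over the orbit, the orbit can be
    continued for a time [tau / 2], during which [F] grows by at least [e * tau / 2]. *)
Lemma escape U X p (F G : V -> R) (tau B e : R) :
  orbit_in U X p p -> 0 < tau -> 0 < e ->
  (forall q, orbit_in U X p q -> exists c, c 0 = q /\ integral_curve U X `]- tau, tau[ c) ->
  (forall q, orbit_in U X p q -> F q <= B) ->
  (forall c t, orbit_in U X p (c t) -> is_derive t (1 : R) c (X (c t)) ->
     is_derive t (1 : R) (fun s => F (c s)) (G (c t))) ->
  (forall q, orbit_in U X p q -> 0 < G q) ->
  (forall q, orbit_in U X p q -> F p <= F q -> e <= G q) -> False.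
Proof.
move=> hp tau0 e0 hloc hB hF hG hGe.
have mono c (a b m : R) : a <= b ->
    (forall t, a <= t <= b -> orbit_in U X p (c t) /\ is_derive t (1 : R) c (X (c t))) ->
    (forall t, a <= t <= b -> m <= G (c t)) -> F (c a) + m * (b - a) <= F (c b).
  move=> ab hc hm.
  have hd t : a <= t <= b -> is_derive t (1 : R) (fun s => F (c s)) (G (c t)).
    by move=> /hc[h1 h2]; exact: hF.
  have hd' x : x \in `]a, b[%R -> is_derive x (1 : R) (fun s => F (c s)) (G (c x)).
    by rewrite in_itv /= => /andP[h1 h2]; apply: hd; rewrite !ltW.
  have hcont : {within `[a, b], continuous (fun s => F (c s))}.
    by apply: derivable_within_continuous => x; rewrite in_itv /= => /hd[].
  have [x xab E] := MVT_segment ab hd' hcont.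
  have : m * (b - a) <= G (c x) * (b - a).
    by apply: ler_wpM2r; [rewrite subr_ge0|apply: hm; move: xab; rewrite in_itv].
  lra.
pose S := [set F q | q in orbit_in U X p].
have hS : has_sup S by split; [exists (F p), p|exists B => _ [q hq <-]; exact: hB].
have et : 0 < e * tau / 4 by rewrite divr_gt0 // mulr_gt0.
have [_ [_ [a [b [c [hab hc cp [t tab <-]]]]] <-] hlt] := sup_adherent et hS.
have inorb u : a < u < b -> orbit_in U X p (c u) /\ is_derive u (1 : R) c (X (c u)).
  move=> uab; split; last by have [] := hc u; rewrite /= ?in_itv.
  by exists a, b, c; split=> //; exists u; rewrite ?in_itv.
move: tab; rewrite in_itv /= => tab; case/andP: (hab) (tab) => a0 b0 /andP[at_ tb].
have Gp q : orbit_in U X p q -> 0 <= G q by move=> h; exact: ltW (hG q h).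
have [T [T0 Tb FT1 FT2]] : exists T, [/\ 0 <= T, T < b, F p <= F (c T) & sup S - e * tau / 4 < F (c T)].
  case: (leP 0 t) => t0.
    exists t; split=> //; rewrite -cp.
    have := @mono c 0 t 0 t0; rewrite mul0r addr0; apply=> u /andP[u0 ut].
      by apply: inorb; apply/andP; split; lra.
    by apply: Gp; apply: (inorb u _).1; apply/andP; split; lra.
  exists 0; rewrite cp; split=> //; apply: lt_le_trans hlt _; rewrite -cp.
  have := @mono c t 0 0 (ltW t0); rewrite mul0r addr0; apply=> u /andP[u0 ut].
    by apply: inorb; apply/andP; split; lra.
  by apply: Gp; apply: (inorb u _).1; apply/andP; split; lra.
have TI : a < T < b by apply/andP; split=> //; lra.
have [c' [c'0 hc']] := hloc _ (inorb T TI).1.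
have inorb' u : 0 <= u < tau -> orbit_in U X p (c' u) /\ is_derive u (1 : R) c' (X (c' u)).
  move=> uab; split; last first.
    have [] // := hc' u; rewrite /= in_itv /=; case/andP: uab => u1 u2.
    by apply/andP; split; lra.
  by apply: (orbit_extend hab hc cp _ c'0 hc' uab); rewrite T0.
have t2 : 0 <= tau / 2 by lra.
have low u : 0 <= u <= tau / 2 -> F p <= F (c' u).
  move=> /andP[u0 ut]; apply: le_trans FT1 _; rewrite -c'0.
  have := @mono c' 0 u 0 u0; rewrite mul0r addr0; apply=> v /andP[v0 vu].
    by apply: inorb'; apply/andP; split; lra.
  by apply: Gp; apply: (inorb' v _).1; apply/andP; split; lra.
have inb u : 0 <= u <= tau / 2 -> 0 <= u < tau by move=> /andP[u0 ut]; apply/andP; split; lra.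
have := @mono c' 0 (tau / 2) e t2 (fun u hu => inorb' u (inb u hu))
  (fun u hu => hGe _ (inorb' u (inb u hu)).1 (low u hu)).
rewrite subr0 c'0.
have : F (c' (tau / 2)) <= sup S.
  apply: ub_le_sup; first exact: hS.2.
  by exists (c' (tau / 2)) => //; apply: (inorb' _ _).1; apply/andP; split; lra.
have := mulr_gt0 e0 tau0; lra.
Qed.
End Orbits.

(** * Generators of rotations *)

Lemma sum_ord2 (V : zmodType) (F : 'I_2 -> V) : \sum_(k < 2) F k = F 0 + F 1.
Proof. by rewrite big_ord_recl big_ord1; congr (_ + F _); exact/val_inj. Qed.

Section MatrixExponential.
Variable R : realType.
Variable A : 'M[R]_2.

Definition expmx_coef i j n : R := (A ^+ n) i j / n`!%:R.

Definition expmx_bound : R := `|A 0 0| + `|A 0 1| + `|A 1 0| + `|A 1 1|.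

Lemma expmx_coef_bound i j n : `|(A ^+ n) i j| <= expmx_bound ^+ n.
Proof.
have B0 : 0 <= expmx_bound by rewrite /expmx_bound !addr_ge0.
elim: n i j => [|n IH] i j.
  by rewrite !expr0 mxE; case: eqP; rewrite ?normr1 ?normr0.
rewrite exprSr mxE sum_ord2; apply: le_trans (ler_normD _ _) _; rewrite !normrM exprSr.
have h0 := ler_wpM2r (normr_ge0 (A 0 j)) (IH i 0).
have h1 := ler_wpM2r (normr_ge0 (A 1 j)) (IH i 1).
apply: le_trans (lerD h0 h1) _; rewrite -mulrDr; apply: ler_wpM2l; first exact: exprn_ge0.
rewrite /expmx_bound.
have := normr_ge0 (A 0 0); have := normr_ge0 (A 0 1); have := normr_ge0 (A 1 0).
have := normr_ge0 (A 1 1).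
by case: (ord2E j) => ->; lra.
Qed.

Lemma expmx_coef_cvg i j (x : R) : cvgn (pseries (expmx_coef i j) x).
Proof.
apply: normed_cvg; apply: (@series_le_cvg _ _ (exp_coeff (expmx_bound * `|x|))).
- by move=> n /=.
- by move=> n; apply: exp_coeff_ge0; rewrite mulr_ge0 // /expmx_bound !addr_ge0.
- move=> n; rewrite /= /exp_coeff /= /expmx_coef !normrM normrX normfV exprMn.
  rewrite (ger0_norm (ler0n _ _)) mulrAC; apply: ler_wpM2r; first by rewrite invr_ge0.
  by apply: ler_wpM2r; [exact: exprn_ge0|exact: expmx_coef_bound].
exact: is_cvg_series_exp_coeff.
Qed.

Lemma pseries_comb (f g : nat -> R) (a b x : R) :
  pseries (fun n => f n * a + g n * b) x = (fun n => pseries f x n * a + pseries g x n * b).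
Proof.
apply/funext => n; rewrite /pseries /series /= !mulr_suml -big_split /=.
by apply: eq_bigr => k _; ring.
Qed.

Lemma pseries_comb_lim (f g : nat -> R) (a b x : R) :
  cvgn (pseries f x) -> cvgn (pseries g x) ->
  cvgn (pseries (fun n => f n * a + g n * b) x) /\
  limn (pseries (fun n => f n * a + g n * b) x) = limn (pseries f x) * a + limn (pseries g x) * b.
Proof.
move=> hf hg; rewrite pseries_comb.
have h : (fun n => pseries f x n * a + pseries g x n * b) @ \oo -->
    limn (pseries f x) * a + limn (pseries g x) * b.
  by apply: cvgD; apply: cvgM => //; exact: cvg_cst.
by split; [apply/cvg_ex; eexists; exact: h|exact: (cvg_lim (@norm_hausdorff _ _) h)].
Qed.

Lemma expmx_coef_diffs i j :
  pseries_diffs (expmx_coef i j) = (fun n => expmx_coef i 0 n * A 0 j + expmx_coef i 1 n * A 1 j).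
Proof.
apply/funext => n; rewrite /pseries_diffs /expmx_coef exprSr mxE sum_ord2 factS natrM invfM.
have n1 : n.+1%:R != 0 :> R by rewrite pnatr_eq0.
have n2 : n`!%:R != 0 :> R by rewrite pnatr_eq0 -lt0n fact_gt0.
move: (n.+1%:R) (n`!%:R) n1 n2 => N Fc n1 n2.
by field; rewrite n1 n2.
Qed.

Lemma expmxE t i j : expmx (t *: A) i j = limn (pseries (expmx_coef i j) t).
Proof.
pose L : 'M[R]_2 := \matrix_(i, j) limn (pseries (expmx_coef i j) t).
suff -> : expmx (t *: A) = L by rewrite mxE.
apply: cvg_lim; first exact: norm_hausdorff.
have ent n i' j' : series (fun n : nat => (n`!%:R)^-1 *: (t *: A) ^+ n) n i' j' =
    pseries (expmx_coef i' j') t n.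
  rewrite /pseries /series /= summxE; apply: eq_bigr => k _.
  by rewrite exprZn !mxE /expmx_coef; ring.
apply/cvgrPdist_le => e e0.
pose S n := series (fun n : nat => (n`!%:R)^-1 *: (t *: A) ^+ n) n.
have h i' j' : \forall n \near \oo, `|(L - S n) i' j'| <= e.
  have : pseries (expmx_coef i' j') t @ \oo --> L i' j' by rewrite mxE; exact: expmx_coef_cvg.
  move=> /cvgrPdist_le /(_ e e0); apply: filterS => n.
  have subE (M N : 'M[R]_2) : (M - N) i' j' = M i' j' - N i' j' by rewrite !mxE.
  by rewrite subE /S ent.
near=> n; have -> : forall M : 'M[R]_2, `|M| = mx_norm M by [].
rewrite mx_normrE; apply: bigmax_le; first exact: ltW.
have k00 : `|(L - S n) 0 0| <= e by near: n; exact: h.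
have k01 : `|(L - S n) 0 1| <= e by near: n; exact: h.
have k10 : `|(L - S n) 1 0| <= e by near: n; exact: h.
have k11 : `|(L - S n) 1 1| <= e by near: n; exact: h.
by move=> -[i' j'] _ /=; case: (ord2E i') => ->; case: (ord2E j') => ->.
Unshelve. all: by end_near. Qed.

(** Each entry is a power series in the time, differentiated term by term; [A ^+ n.+1 = A ^+ n * A]
    identifies the derived series. *)
Lemma expmx_derive t i j :
  is_derive t (1 : R) (fun s => expmx (s *: A) i j) ((expmx (t *: A) *m A) i j).
Proof.
have -> : (fun s => expmx (s *: A) i j) = (fun s => limn (pseries (expmx_coef i j) s)).
  by apply/funext => s; exact: expmxE.
have -> : (expmx (t *: A) *m A) i j = limn (pseries (pseries_diffs (expmx_coef i j)) t).
  have h0 : cvgn (pseries (expmx_coef i 0) t) by exact: expmx_coef_cvg.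
  have h1 : cvgn (pseries (expmx_coef i 1) t) by exact: expmx_coef_cvg.
  rewrite expmx_coef_diffs; have [_ ->] := pseries_comb_lim (A 0 j) (A 1 j) h0 h1.
  by rewrite mxE sum_ord2 !expmxE.
have cd i' j' x : cvgn (pseries (pseries_diffs (expmx_coef i' j')) x).
  have h0 : cvgn (pseries (expmx_coef i' 0) x) by exact: expmx_coef_cvg.
  have h1 : cvgn (pseries (expmx_coef i' 1) x) by exact: expmx_coef_cvg.
  by rewrite expmx_coef_diffs; have [] := pseries_comb_lim (A 0 j') (A 1 j') h0 h1.
apply: (@pseries_snd_diffs _ _ (`|t| + 1)).
- exact: expmx_coef_cvg.
- exact: cd.
- rewrite expmx_coef_diffs.
  rewrite (_ : pseries_diffs _ = (fun n => pseries_diffs (expmx_coef i 0) n * A 0 j + pseries_diffs (expmx_coef i 1) n * A 1 j)).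
    by have [] := pseries_comb_lim (A 0 j) (A 1 j) (cd i 0 (`|t| + 1)) (cd i 1 (`|t| + 1)).
  by apply/funext => n; rewrite /pseries_diffs; ring.
- by have := normr_ge0 t => h; rewrite [ltRHS]ger0_norm; lra.
Qed.

Lemma expmx0 : expmx (0 *: A) = 1%:M.
Proof.
apply/matrixP => i j; rewrite expmxE; apply: cvg_lim; first exact: norm_hausdorff.
apply/cvgrPdist_le => e e0; exists 1%N => // -[//|n] _ /=.
rewrite /pseries /series /= big_nat_recl // big1 ?addr0.
  by rewrite /expmx_coef !expr0 fact0 divr1 mulr1 subrr normr0 ltW.
by move=> k _; rewrite expr0n mulr0.
Qed.

End MatrixExponential.

Section RotationGenerator.
Variable R : realType.
Variable A : 'M[R]_2.
Hypothesis hA : generates_rotation A.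

Let y (v : 'cV[R]_2) t i := (expmx (t *: A) *m v) i 0.

Lemma expmx_orbit_derive v t i : is_derive t (1 : R) (fun s => y v s i) (y (A *m v) t i).
Proof.
rewrite /y mulmxA.
have -> : (fun s => (expmx (s *: A) *m v) i 0) =
    (fun s => expmx (s *: A) i 0 * v 0 0 + expmx (s *: A) i 1 * v 1 0).
  by apply/funext => s; rewrite mxE sum_ord2.
rewrite [(_ *m v) i 0]mxE sum_ord2.
have key k : is_derive t (1 : R) (fun s => expmx (s *: A) i k * v k 0) ((expmx (t *: A) *m A) i k * v k 0).
  apply: is_derive_eq (is_deriveM (expmx_derive A t i k) (is_derive_cst (v k 0) t 1)) _.
  by rewrite scaler0 add0r /GRing.scale /= mulrC.
exact: is_deriveD.
Qed.

Lemma expmx_orbit0 v i : y v 0 i = v i 0.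
Proof. by rewrite /y expmx0 mul1mx. Qed.

Lemma derive0_cst (f : R -> R) : (forall t, is_derive t (1 : R) f 0) -> forall t, f t = f 0.
Proof.
move=> h t.
have key a b : a <= b -> f b = f a.
  move=> ab; have hc : {within `[a, b], continuous f}.
    by apply: derivable_within_continuous => x _; have [] := h x.
  have [c _] := MVT_segment ab (fun x _ => h x) hc.
  by rewrite mul0r => /eqP; rewrite subr_eq0 => /eqP.
by case: (leP 0 t) => t0; [exact: key|rewrite (key t 0) // ltW].
Qed.

Lemma linear_ode (f : R -> R) (l : R) : (forall t, is_derive t (1 : R) f (l * f t)) ->
  forall t, f t = f 0 * expR (l * t).
Proof.
move=> h t.
have hd s : is_derive s (1 : R) (fun s => f s * expR (- l * s)) 0.
  have he : is_derive s (1 : R) (fun s => expR (- l * s)) (- l * expR (- l * s)).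
    have h1 : is_derive s (1 : R) (fun s => - l * s) (- l).
      apply/is_derive_epsP => e e0; exists 1 => // k _.
      rewrite (_ : _ - _ = 0) ?normr0 ?mulr_ge0 //; first exact: ltW.
      by rewrite /GRing.scale /=; ring.
    have := is_derive1_comp (is_derive_expR (- l * s)) h1.
    by rewrite /GRing.scale /= mulrC.
  apply: is_derive_eq (is_deriveM (h s) he) _.
  by rewrite /GRing.scale /=; ring.
have := derive0_cst hd t; rewrite mulr0 expR0 mulr1 mulNr expRN => <-.
by rewrite divfK // gt_eqF // expR_gt0.
Qed.

(** On an eigenvector the orbit is [expR (l * t)] times [v]. Periodicity forces [l = 0], and the
    orbit is then constant, against nontriviality. *)
Lemma no_real_eigenvalue (v : 'cV[R]_2) (l : R) : v != 0 -> A *m v != l *: v.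
Proof.
move=> v0; apply/eqP => Av.
have [[T [T0 hT]] [t ht]] := hA v0.
have yE s i : y v s i = v i 0 * expR (l * s).
  rewrite -(expmx_orbit0 v i); apply: (@linear_ode (fun s => y v s i)) => u.
  apply: is_derive_eq (expmx_orbit_derive v u i) _.
  by rewrite Av /y -scalemxAr mxE.
have [i vi] : exists i, v i 0 != 0.
  apply/existsP; apply: contraR v0; rewrite negb_exists => /forallP h.
  apply/eqP/matrixP => i j; rewrite ord1 mxE; apply/eqP; have := h i; by rewrite negbK.
have e1 : expR (l * T) = 1.
  have := congr1 (fun M : 'cV[R]_2 => M i 0) (hT 0); rewrite -/(y v _ i) -/(y v 0 i) !yE add0r mulr0 expR0.
  by move=> /(mulfI vi).
have l0 : l = 0.
  have : l * T = 0 by apply: expR_inj; rewrite e1 expR0.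
  by move=> /eqP; rewrite mulf_eq0 (gt_eqF T0) orbF => /eqP.
apply/negP: ht; rewrite negbK; apply/eqP/matrixP => k j; rewrite ord1.
by rewrite -/(y v t k) yE l0 mul0r expR0 mulr1.
Qed.

Lemma rotation_no_real_root (l : R) :
  l ^+ 2 - (A 0 0 + A 1 1) * l + (A 0 0 * A 1 1 - A 0 1 * A 1 0) != 0.
Proof.
apply/eqP => h.
have d0 : \det (A - l%:M)^T == 0.
  have l01 : lift (0 : 'I_2) (0 : 'I_1) = 1 by exact/val_inj.
  have l10 : lift (1 : 'I_2) (0 : 'I_1) = 0 by exact/val_inj.
  rewrite det_tr (expand_det_row _ 0) sum_ord2 /cofactor !det_mx11 !mxE /= l01 l10.
  apply/eqP; rewrite -h !mulr1n !mulr0n /= expr0 expr1; ring.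
have /det0P[u u0 hu] := d0.
have ut0 : u^T != 0 by apply: contra u0 => /eqP e; rewrite -(trmxK u) e trmx0.
have /negP := no_real_eigenvalue l ut0; apply.
have : (A - l%:M) *m u^T = 0 by rewrite -[_ - _]trmxK -trmx_mul hu trmx0.
by rewrite mulmxBl mul_scalar_mx => /eqP; rewrite subr_eq0.
Qed.

(** Without real roots the characteristic polynomial has negative discriminant, hence a positive
    determinant. The trace is obtained from the period of one single orbit. *)
Lemma rotation_trace_det : A 0 0 + A 1 1 = 0 /\ 0 < A 0 0 * A 1 1 - A 0 1 * A 1 0.
Proof.
set tau := A 0 0 + A 1 1; set del := A 0 0 * A 1 1 - A 0 1 * A 1 0.
have disc : tau ^+ 2 - 4 * del < 0.
  rewrite ltNge; apply/negP => h.
  have /negP := rotation_no_real_root ((tau + Num.sqrt (tau ^+ 2 - 4 * del)) / 2); apply.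
  have := sqr_sqrtr h; set q := Num.sqrt _ => hq; rewrite -/tau -/del; apply/eqP.
  have -> : ((tau + q) / 2) ^+ 2 - tau * ((tau + q) / 2) + del = (q ^+ 2 - tau ^+ 2 + 4 * del) / 4 by field.
  by rewrite hq; field.
have dpos : 0 < del by have := sqr_ge0 tau; lra.
split=> //.
have A10 : A 1 0 != 0.
  apply/eqP => e; have /negP := rotation_no_real_root (A 0 0); apply.
  by rewrite e; apply/eqP; ring.
pose v : 'cV[R]_2 := \col_i (i == 0)%:R.
have v0 : v != 0.
  apply/eqP => /matrixP /(_ 0 0); rewrite !mxE /= => /eqP; by rewrite oner_eq0.
have [[T [T0 hT]] _] := hA v0.
have yT t i : y v (t + T) i = y v t i by rewrite /y hT.
(* Differentiating the periodic orbit of [v] shows that [A *m v] also returns after the time [T]. *)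
have dT i : y (A *m v) T i = (A *m v) i 0.
  have d1 := expmx_orbit_derive v 0 i.
  have d2 : is_derive 0 (1 : R) (fun s => y v (s + T) i) (y (A *m v) T i).
    by apply: (@is_derive_shift _ _ (fun s => y v s i)); rewrite add0r; exact: expmx_orbit_derive.
  rewrite (_ : (fun s => y v (s + T) i) = (fun s => y v s i)) in d2; last by apply/funext => s.
  rewrite -(expmx_orbit0 (A *m v) i).
  by case: d1 => _ <-; case: d2 => _ <-.
pose E t i j := expmx (t *: A) i j.
have yE (u : 'cV[R]_2) t i : y u t i = E t i 0 * u 0 0 + E t i 1 * u 1 0.
  by rewrite /y mxE sum_ord2.
have E0 i j : E 0 i j = (i == j)%:R by rewrite /E expmx0 mxE.
have ET0 i : E T i 0 = (i == 0)%:R.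
  by have := yT 0 i; rewrite add0r !yE !mxE /= !mulr1 !mulr0 !addr0 E0.
(* [E T] fixes both [v] and [A *m v], which span the plane because [A 1 0] is nonzero; so [E T] is
   the identity. *)
have ET1 i : E T i 1 = (i == 1)%:R.
  have := dT i; rewrite yE !mxE !sum_ord2 !mxE /= !mulr1 !mulr0 !addr0 ET0 => h.
  apply: (mulIf A10); move: h; case: (ord2E i) => -> /=.
    by rewrite mul1r => /eqP; rewrite addrC -subr_eq0 addrK => /eqP ->; rewrite mul0r.
  by rewrite mul0r add0r mul1r.
(* Liouville's formula: the determinant of [E] has logarithmic derivative [tau], and it equals 1 at
   0 and at [T]. *)
pose d t := E t 0 0 * E t 1 1 - E t 0 1 * E t 1 0.
have dE t i j : is_derive t (1 : R) (fun s => E s i j) (E t i 0 * A 0 j + E t i 1 * A 1 j).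
  by apply: is_derive_eq (expmx_derive A t i j) _; rewrite mxE sum_ord2.
have dd t : is_derive t (1 : R) d (tau * d t).
  apply: is_derive_eq (is_deriveB (is_deriveM (dE t 0 0) (dE t 1 1)) (is_deriveM (dE t 0 1) (dE t 1 0))) _.
  by rewrite /d /tau /GRing.scale /=; ring.
have := linear_ode dd T; rewrite /d !ET0 !ET1 !E0 /= !mulr1 mulr0 subr0 mul1r => /esym h.
have : tau * T = 0 by apply: expR_inj; rewrite h expR0.
by move=> /eqP; rewrite mulf_eq0 (gt_eqF T0) orbF => /eqP.
Qed.
End RotationGenerator.

(** * The complex coordinate of the linear part *)

Lemma psubst2D (K B : comNzRingType) (f : {rmorphism K -> B}) a b (p q : {poly {poly K}}) :
  psubst2 f a b (p + q) = psubst2 f a b p + psubst2 f a b q.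
Proof. by rewrite /psubst2 /psubst /horner_morph /= rmorphD hornerD. Qed.

Lemma psubst2M (K B : comNzRingType) (f : {rmorphism K -> B}) a b (p q : {poly {poly K}}) :
  psubst2 f a b (p * q) = psubst2 f a b p * psubst2 f a b q.
Proof. by rewrite /psubst2 /psubst /horner_morph /= rmorphM hornerM. Qed.

Section SubstPoly.
Variable R : rcfType.
Local Notation C := R[i].
Local Notation P := {poly {poly C}}.
Implicit Types (p q a b : P) (x y c : C).

Definition ev2 x y p : C := psubst2 idfun x y p.

Lemma ev2D x y p q : ev2 x y (p + q) = ev2 x y p + ev2 x y q.
Proof. exact: psubst2D. Qed.
Lemma ev2M x y p q : ev2 x y (p * q) = ev2 x y p * ev2 x y q.
Proof. exact: psubst2M. Qed.
Lemma ev2X x y : ev2 x y 'X = x. Proof. exact: psubst2XZ. Qed.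
Lemma ev2W x y : ev2 x y 'X%:P = y. Proof. exact: psubst2XW. Qed.
Lemma ev2C x y c : ev2 x y (PC c) = c. Proof. exact: psubst2C. Qed.

Lemma ev2_affine x y u v c :
  ev2 x y (PC c + (PC u * 'X + PC v * 'X%:P)) = c + (u * x + v * y).
Proof.
rewrite ev2D; congr (_ + _); first exact: ev2C.
rewrite ev2D; congr (_ + _); rewrite ev2M; congr (_ * _).
- exact: ev2C.
- exact: ev2X.
- exact: ev2C.
- exact: ev2W.
Qed.

Definition subst_poly a b p : P := psubst2 (polyC \o polyC) a b p.

Lemma subst_polyB a b p q : subst_poly a b (p - q) = subst_poly a b p - subst_poly a b q.
Proof.
by rewrite /subst_poly /psubst2 /psubst /horner_morph /= (rmorphB (map_poly _)) hornerD hornerN.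
Qed.

Lemma ev2_subst x y a b p : ev2 x y (subst_poly a b p) = ev2 (ev2 x y a) (ev2 x y b) p.
Proof.
by apply: psubst2_rmorph => c; exact: psubst2C.
Qed.

Lemma wnorm_subst (r s : R) a b p : 0 <= r -> wnorm r a <= s -> wnorm r b <= s ->
  wnorm r (subst_poly a b p) <= wnorm s p.
Proof.
move=> r0 ha hb; apply: (psubst2_norm (ring_norm_wnorm r0) (@ring_norm_cnorm R)) => // x.
by rewrite -/(PC x) wnormC.
Qed.
End SubstPoly.

Section LinearCoordinate.
Variable R : realType.
Local Notation V := 'rV[R]_2.
Local Notation C := R[i].
Local Notation P := {poly {poly C}}.
Variables (al be ga w : R).
Hypotheses (w0 : 0 < w) (hw : w ^+ 2 = - al ^+ 2 - be * ga).

(* The left eigenvector [(ga, i w - al)] of [[al, be], [ga, - al]] for the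
   eigenvalue [i w], read as a complex coordinate of the plane. *)
Definition zcoord (v : V) : C := Complex (ga * v 0 0 - al * v 0 1) (w * v 0 1).
Definition xcoord (z : C) : V :=
  row2 ((complex.Re z + al * (complex.Im z / w)) / ga) (complex.Im z / w).

Local Notation zc := zcoord.
Local Notation xi := xcoord.

Lemma ga_neq0 : ga != 0.
Proof.
apply/eqP => g0; have := hw; rewrite g0 mulr0 subr0 => h.
have := sqr_ge0 al; have : 0 < w ^+ 2 by rewrite exprn_gt0.
by rewrite h; lra.
Qed.

Lemma xiK z : zc (xi z) = z.
Proof.
have g0 := ga_neq0; have w1 : w != 0 by rewrite gt_eqF.
case: z => a b; rewrite /zcoord /xcoord row20 row21 /=; apply/eqP; rewrite eq_complex /=.
by apply/andP; split; apply/eqP; field; rewrite ?g0 ?w1.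
Qed.

Lemma zcK v : xi (zc v) = v.
Proof.
have g0 := ga_neq0; have w1 : w != 0 by rewrite gt_eqF.
apply: rV2P; rewrite /xcoord /zcoord ?row20 ?row21 /=; field; by rewrite ?g0 ?w1.
Qed.

Lemma zcD u v : zc (u + v) = zc u + zc v.
Proof. by apply/eqP; rewrite eq_complex /= !mxE; apply/andP; split; apply/eqP; ring. Qed.

Lemma zcZ (t : R) v : zc (t *: v) = real_complex R t * zc v.
Proof. by apply/eqP; rewrite eq_complex /= !mxE; apply/andP; split; apply/eqP; ring. Qed.

Lemma zc0 : zc 0 = 0.
Proof. by rewrite /zcoord !mxE !mulr0 subr0. Qed.

Lemma xiD x y : xi (x + y) = xi x + xi y.
Proof. by rewrite -{1}(xiK x) -{1}(xiK y) -zcD zcK. Qed.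

Lemma xiZ (t : R) x : xi (real_complex R t * x) = t *: xi x.
Proof. by rewrite -{1}(xiK x) -zcZ zcK. Qed.

Lemma xi0 : xi 0 = 0.
Proof. by rewrite -zc0 zcK. Qed.

Definition kz : R := `|ga| + `|al| + w.

Lemma zc_norm v : cnorm (zc v) <= kz * `|v|.
Proof.
rewrite /zcoord /cnorm /=.
have h0 := norm_coord v 0; have h1 := norm_coord v 1.
have := ler_normB (ga * v 0 0) (al * v 0 1); rewrite !normrM (gtr0_norm w0).
have := ler_wpM2l (normr_ge0 ga) h0; have := ler_wpM2l (normr_ge0 al) h1.
have := ler_wpM2l (ltW w0) h1; rewrite /kz; lra.
Qed.

Definition kx : R := (1 + `|al| / w) / `|ga| + w^-1 + 1.

Lemma kx_gt0 : 0 < kx.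
Proof.
rewrite /kx; have : 0 <= (1 + `|al| / w) / `|ga| + w^-1; last by lra.
have := ltW w0 => w1; by rewrite !addr_ge0 ?divr_ge0 ?addr_ge0 ?divr_ge0 ?invr_ge0.
Qed.

Lemma xi_coord z : `|xi z 0 0| <= kx * cnorm z /\ `|xi z 0 1| <= kx * cnorm z.
Proof.
have n1 := Re_le_cnorm z; have n2 := Im_le_cnorm z.
have n0 := rn_ge0 (@ring_norm_cnorm R) z.
have w1 := ltW w0; have iw : 0 <= w^-1 by rewrite invr_ge0.
have b1 : `|complex.Im z / w| <= w^-1 * cnorm z.
  by rewrite normrM normfV (gtr0_norm w0) mulrC; apply: ler_wpM2l.
rewrite /xcoord row20 row21; split.
  rewrite normrM normfV.
  have k : `|complex.Re z + al * (complex.Im z / w)| <= (1 + `|al| / w) * cnorm z.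
    apply: le_trans (ler_normD _ _) _; rewrite normrM mulrDl mul1r; apply: lerD => //.
    by rewrite -mulrA; apply: ler_wpM2l.
  have ig : 0 <= `|ga|^-1 by rewrite invr_ge0.
  apply: le_trans (ler_wpM2r ig k) _.
  rewrite mulrAC; apply: ler_wpM2r => //; rewrite /kx; lra.
apply: le_trans b1 _; apply: ler_wpM2r => //; rewrite /kx.
have : 0 <= (1 + `|al| / w) / `|ga| by rewrite !divr_ge0 ?addr_ge0 ?divr_ge0.
lra.
Qed.

Lemma xi_norm z : `|xi z| <= kx * cnorm z.
Proof.
have [h0 h1] := xi_coord z.
apply/(norm_rV2_le _ _) => //.
by rewrite mulr_ge0 ?(rn_ge0 (@ring_norm_cnorm R)) // ltW // kx_gt0.
Qed.

Lemma hderiv_xi (u : R -> C) t l : hderiv u t l ->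
  is_derive t (1 : R) (fun s => xi (u s)) (xi l).
Proof.
move=> /hderiv_reim[dr di]; apply: is_derive_rV2 => j.
have dy : is_derive t (1 : R) (fun s => complex.Im (u s) / w) (complex.Im l / w).
  apply: is_derive_eq (is_deriveM di (is_derive_cst w^-1 t 1)) _.
  by rewrite scaler0 add0r /GRing.scale /= mulrC.
case: (ord2E j) => ->; last first.
  by rewrite (_ : (fun s => _) = (fun s => complex.Im (u s) / w)) ?row21 //;
    apply/funext => s; rewrite row21.
rewrite row20 (_ : (fun s => _) = (fun s => (complex.Re (u s) + al * (complex.Im (u s) / w)) / ga));
  last by apply/funext => s; rewrite row20.
have da : is_derive t (1 : R) (fun s => al * (complex.Im (u s) / w)) (al * (complex.Im l / w)).
  apply: is_derive_eq (is_deriveM (is_derive_cst al t 1) dy) _.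
  by rewrite scaler0 addr0.
have ds := is_deriveD dr da.
apply: is_derive_eq (is_deriveM ds (is_derive_cst ga^-1 t 1)) _.
by rewrite scaler0 add0r /GRing.scale /= mulrC.
Qed.

(** Around [q], the coordinate and its conjugate are affine in the two real increments. Substituting
    them into [p n] as two separate polynomials leads to [analytic_of_geometric]. *)
Lemma zc_analytic (p : nat -> P) (t A : R) (g : C -> R) q :
  geometric t A p ->
  (forall x, cnorm x <= t -> gcvg (fun n => ev x (p n)) (real_complex R (g x))) ->
  cnorm (zc q) < t -> analytic_at (fun v => g (zc v)) q.
Proof.
move=> hp hg hq.
have kz0 : 0 < kz by rewrite /kz; have := normr_ge0 ga; have := normr_ge0 al; have := w0; lra.
pose l : P := PC (real_complex R ga) * 'X + PC (Complex (- al) w) * 'X%:P.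
pose l' : P := PC (real_complex R ga) * 'X + PC (Complex (- al) (- w)) * 'X%:P.
(* The increments use half of the room left between [zc q] and the radius [t]. *)
pose r := (t - cnorm (zc q)) / (kz + kz).
have r0 : 0 < r by rewrite divr_gt0 ?subr_gt0 // addr_gt0.
have r0' := ltW r0; have hW := ring_norm_wnorm r0'.
have hkz : cnorm (zc q) + kz * r <= t.
  have e : kz * r = (t - cnorm (zc q)) / 2 by rewrite /r; field; rewrite gt_eqF //; lra.
  by rewrite e; lra.
have nX : wnorm r 'X <= r := wnormX r0'.
have nW : wnorm r 'X%:P <= r by rewrite -starX wnorm_star.
have nl : wnorm r l <= kz * r.
  apply: le_trans (rn_D hW _ _) _.
  have h1 := rn_M hW (PC (real_complex R ga)) 'X; have h2 := rn_M hW (PC (Complex (- al) w)) 'X%:P.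
  rewrite !wnormC // cnorm_real in h1 h2.
  have h3 := ler_wpM2l (normr_ge0 ga) nX.
  have h4 := ler_wpM2l (rn_ge0 (@ring_norm_cnorm R) (Complex (- al) w)) nW.
  apply: le_trans (lerD (le_trans h1 h3) (le_trans h2 h4)) _.
  by rewrite -mulrDl /kz /cnorm /= normrN (gtr0_norm w0) addrA.
have nl' : wnorm r l' <= kz * r.
  apply: le_trans (rn_D hW _ _) _.
  have h1 := rn_M hW (PC (real_complex R ga)) 'X; have h2 := rn_M hW (PC (Complex (- al) (- w))) 'X%:P.
  rewrite !wnormC // cnorm_real in h1 h2.
  have h3 := ler_wpM2l (normr_ge0 ga) nX.
  have h4 := ler_wpM2l (rn_ge0 (@ring_norm_cnorm R) (Complex (- al) (- w))) nW.
  apply: le_trans (lerD (le_trans h1 h3) (le_trans h2 h4)) _.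
  by rewrite -mulrDl /kz /cnorm /= !normrN (gtr0_norm w0) addrA.
pose a := PC (zc q) + l; pose b := PC (conjc (zc q)) + l'.
have na : wnorm r a <= t.
  apply: le_trans (rn_D hW _ _) _; rewrite (wnormC _ r0').
  exact: le_trans (lerD (lexx _) nl) hkz.
have nb : wnorm r b <= t.
  apply: le_trans (rn_D hW _ _) _; rewrite (wnormC _ r0') cnorm_conj.
  exact: le_trans (lerD (lexx _) nl') hkz.
apply: (@analytic_of_geometric R (fun n => subst_poly a b (p n)) r A) => //.
  by move=> n; rewrite -subst_polyB; apply: le_trans (hp n); exact: wnorm_subst.
move=> h hr.
set x0 := real_complex R (h 0 0); set x1 := real_complex R (h 0 1).
have xt : cnorm (zc (q + h)) <= t.
  rewrite zcD; apply: le_trans (rn_D (@ring_norm_cnorm R) _ _) _; apply: le_trans hkz.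
  by rewrite lerD2l; apply: le_trans (zc_norm h) _; apply: ler_wpM2l; exact: ltW.
have e1 : ev2 x0 x1 a = zc (q + h).
  rewrite ev2_affine /x0 /x1 zcD; congr (_ + _).
  by apply/eqP; rewrite eq_complex /=; apply/andP; split; apply/eqP; ring.
have e2 : ev2 x0 x1 b = conjc (zc (q + h)).
  rewrite ev2_affine /x0 /x1 zcD rmorphD; congr (_ + _).
  by apply/eqP; rewrite eq_complex /=; apply/andP; split; apply/eqP; ring.
have -> : (fun n => psubst2 idfun x0 x1 (subst_poly a b (p n))) = (fun n => ev (zc (q + h)) (p n)).
  by apply/funext => n; rewrite /ev -e2 -e1; exact: ev2_subst.
exact: hg.
Qed.

End LinearCoordinate.

(** * The field in the complex coordinate *)

Section RealSquareSums.
Variable R : realType.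
Local Notation C := R[i].
Local Notation P := {poly {poly C}}.
Implicit Types (a : nat -> nat -> R) (u v : P) (x : C).

Definition rpsum a n u v : P := psum ((polyC \o polyC) \o real_complex R) a n u v.

Lemma ev_sum x n (F : 'I_n -> P) : ev x (\sum_(i < n) F i) = \sum_(i < n) ev x (F i).
Proof.
elim: n F => [|n IH] F; first by rewrite !big_ord0 ev0.
by rewrite !big_ord_recr /= evD IH.
Qed.

Lemma evXn x u n : ev x (u ^+ n) = ev x u ^+ n.
Proof. by elim: n => [|n IH]; rewrite ?expr0 ?ev1 // !exprS evM IH. Qed.

Lemma psum_real a n (s t : R) : psum (real_complex R) a n (real_complex R s) (real_complex R t) =
  real_complex R (psum idfun a n s t).
Proof.
rewrite /psum (rmorph_sum (real_complex R)); apply: eq_bigr => i _.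
rewrite (rmorph_sum (real_complex R)); apply: eq_bigr => j _.
by rewrite !(rmorphM (real_complex R)) !(rmorphXn (real_complex R)).
Qed.

Lemma ev_rpsum x a n u v (s t : R) : ev x u = real_complex R s -> ev x v = real_complex R t ->
  ev x (rpsum a n u v) = real_complex R (psum idfun a n s t).
Proof.
move=> hu hv; rewrite -psum_real /rpsum /psum ev_sum; apply: eq_bigr => i _.
rewrite ev_sum; apply: eq_bigr => j _.
by rewrite !evM !evXn (evC x (real_complex R (a i j))) hu hv.
Qed.

Lemma rpsum_norm a n u v (r s : R) : 0 <= r -> wnorm r u <= s -> wnorm r v <= s ->
  wnorm r (rpsum a n u v) <= abs_sum a n s.
Proof.
move=> r0; apply: psum_norm; first exact: ring_norm_wnorm.
by move=> x; rewrite (wnormC (real_complex R x) r0) cnorm_real; exact: lexx.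
Qed.

Lemma rpsum_diff a n u v (r s M : R) : 0 <= r -> 0 < s -> (forall n, abs_sum a n s <= M) ->
  wnorm r u <= s / 2 -> wnorm r v <= s / 2 ->
  wnorm r (rpsum a n.+1 u v - rpsum a n u v) <= M * 2^-1 ^+ n.
Proof.
move=> r0 s0 hM; apply: psum_diff => //; first exact: ring_norm_wnorm.
by move=> x; rewrite (wnormC (real_complex R x) r0) cnorm_real; exact: lexx.
Qed.
End RealSquareSums.

Section Complexification.
Variable R : realType.
Local Notation V := 'rV[R]_2.
Local Notation C := R[i].
Local Notation P := {poly {poly C}}.

Variables (al be ga w : R).
Hypotheses (w0 : 0 < w) (hw : w ^+ 2 = - al ^+ 2 - be * ga).
Local Notation zc := (zcoord al ga w).
Local Notation xi := (xcoord al ga w).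

(** With [poly_x0], the two real coordinates of [xcoord] as polynomials in the complex coordinate
    and its conjugate. *)
Definition poly_x1 : P := PC (Complex 0 (- (2 * w)^-1)) * ('X - 'X%:P).
Definition poly_x0 : P := PC (real_complex R (2 * ga)^-1) * ('X + 'X%:P) +
  PC (real_complex R (al / ga)) * poly_x1.

Lemma ev_poly_x1 z : ev z poly_x1 = real_complex R (xi z 0 1).
Proof.
have w1 : w != 0 by rewrite gt_eqF.
rewrite /poly_x1 evM evC evB evX -starX ev_star evX /xcoord row21.
by case: z => x y; apply/eqP; rewrite eq_complex /=; apply/andP; split; apply/eqP; field.
Qed.

Lemma ev_poly_x0 z : ev z poly_x0 = real_complex R (xi z 0 0).
Proof.
have w1 : w != 0 by rewrite gt_eqF.
have g0 : ga != 0 := ga_neq0 w0 hw.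
rewrite /poly_x0 evD [ev z (_ * poly_x1)]evM ev_poly_x1 evM !evC evD evX -starX ev_star evX /xcoord row20 row21.
case: z => x y; apply/eqP; rewrite eq_complex /=; apply/andP; split; apply/eqP; field;
  by rewrite ?g0 ?w1.
Qed.

Lemma poly_x_norm : exists2 kap, 0 < kap & forall s, 0 < s ->
  wnorm s poly_x0 <= kap * s /\ wnorm s poly_x1 <= kap * s.
Proof.
pose c1 := cnorm (Complex 0 (- (2 * w)^-1) : C); pose c2 := cnorm (real_complex R (2 * ga)^-1).
pose c3 := cnorm (real_complex R (al / ga)).
have hC := @ring_norm_cnorm R.
have [p1 p2 p3] : [/\ 0 <= c1, 0 <= c2 & 0 <= c3] by split; exact: (rn_ge0 hC).
have p4 : 0 <= c1 * c3 by exact: mulr_ge0.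
exists (2 * c1 + 2 * c2 + 2 * (c1 * c3) + 1) => [|s s0]; first by lra.
have s0' := ltW s0; have hW := ring_norm_wnorm s0'.
have nX : wnorm s 'X <= s := wnormX s0'.
have nW : wnorm s 'X%:P <= s by rewrite -starX wnorm_star.
have h1 : wnorm s poly_x1 <= c1 * (2 * s).
  apply: le_trans (rn_M hW _ _) _; rewrite (wnormC _ s0'); apply: ler_wpM2l => //.
  by apply: le_trans (rn_B hW _ _) _; move: nX nW; move: (wnorm s 'X) (wnorm s 'X%:P) => x y; lra.
have h2 : wnorm s (PC (real_complex R (2 * ga)^-1) * ('X + 'X%:P)) <= c2 * (2 * s).
  apply: le_trans (rn_M hW _ _) _; rewrite (wnormC _ s0'); apply: ler_wpM2l => //.
  by apply: le_trans (rn_D hW _ _) _; move: nX nW; move: (wnorm s 'X) (wnorm s 'X%:P) => x y; lra.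
have h3 : wnorm s (PC (real_complex R (al / ga)) * poly_x1) <= c3 * (c1 * (2 * s)).
  by apply: le_trans (rn_M hW _ _) _; rewrite (wnormC _ s0'); apply: ler_wpM2l.
have q1 := mulr_ge0 p1 s0'; have q2 := mulr_ge0 p2 s0'; have q3 := mulr_ge0 p4 s0'.
have h4 := le_trans (rn_D hW _ _) (lerD h2 h3); rewrite -/poly_x0 in h4.
split; [apply: le_trans h4 _|apply: le_trans h1 _]; move: q1 q2 q3;
  clear -s0; move: c1 c2 c3 => c1 c2 c3; lra.
Qed.

Variable X : V -> V.
Hypotheses (hX : forall j, analytic_at (fun q => X q 0 j) 0) (X0 : X 0 = 0).
Hypotheses (D00 : DX X 0 0 0 = al) (D01 : DX X 0 0 1 = be).
Hypotheses (D10 : DX X 0 1 0 = ga) (D11 : DX X 0 1 1 = - al).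

Lemma complexify : exists K r1 A (F : nat -> P) (Fv : C -> C),
  [/\ 0 < K, 0 < r1 & 0 <= A] /\
  [/\ forall n, quadratic K r1 (F n), geometric r1 A F,
      forall x n, cnorm x <= r1 -> cnorm (ev x (F n) - Fv x) <= A * 2^-1 ^+ n &
      forall z, zc (X (xi z)) = Complex 0 w * (z + Fv z)].
Proof.
have combB (p q u v u' v' : P) : p * u + q * v - (p * u' + q * v') = p * (u - u') + q * (v - v').
  by ring.
have ev_comb x p q (u v : P) : ev x (PC p * u + PC q * v) = p * ev x u + q * ev x v.
  by rewrite evD !evM !evC.
have [a [r [M [r0 M0 hM ha]]]] := analytic_pairE hX.
have coef j := analytic_first_order_coef (f := fun q => X q 0 j) r0 M0 (hM j) (ha j).
have Mr : 0 <= M / r ^+ 2 by rewrite divr_ge0 // exprn_ge0 // ltW.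
have r2 : 0 < r / 2 by lra.
have jac := jacobian_first_order r2 Mr (fun j => (coef j).2).
have lin0 : a 0 1%N 0%N = al /\ a 0 0%N 1%N = be.
  by have [e1 e2] := jac 0; rewrite -e1 -e2.
have lin1 : a 1 1%N 0%N = ga /\ a 1 0%N 1%N = - al.
  by have [e1 e2] := jac 1; rewrite -e1 -e2.
have a00 j : a j 0%N 0%N = 0 by rewrite (coef j).1 X0 mxE.
have [kap kap0 hkap] := poly_x_norm.
(* [c0 * v0 + c1 * v1] is [zc v] divided by [Complex 0 w]; it is applied to the nonlinear part of
   [X]. *)
pose c0 : C := Complex 0 (- ga / w); pose c1 : C := Complex 1 (al / w).
pose F n : P := PC c0 * rpsum (tail2 (a 0)) n.+2 poly_x0 poly_x1 +
                PC c1 * rpsum (tail2 (a 1)) n.+2 poly_x0 poly_x1.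
pose Fv z : C := c0 * real_complex R (X (xi z) 0 0 - (al * xi z 0 0 + be * xi z 0 1)) +
                 c1 * real_complex R (X (xi z) 0 1 - (ga * xi z 0 0 - al * xi z 0 1)).
have hC := @ring_norm_cnorm R.
pose cc := cnorm c0 + cnorm c1.
have cc0 : 0 <= cc by apply: addr_ge0; exact: (rn_ge0 hC).
(* [kk] controls both the polynomials [poly_x0], [poly_x1] and the point [xi x], so that all stay
   within [r / 2], where the series converge geometrically. *)
pose kk := kap + kx al ga w.
have kk1 : kap <= kk by rewrite lerDl ltW // kx_gt0.
have kk2 : kx al ga w <= kk by rewrite lerDr ltW.
have kk0 : 0 < kk by apply: lt_le_trans kk1.
pose r1 := r / 2 / kk.
have r10 : 0 < r1 by rewrite divr_gt0.
have kr1 : kk * r1 = r / 2 by rewrite /r1 mulrC divfK // gt_eqF.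
pose K := cc * (M / r ^+ 2 * kap ^+ 2) + 1.
have K0 : 0 < K.
  have : 0 <= cc * (M / r ^+ 2 * kap ^+ 2) by apply: mulr_ge0 => //; apply: mulr_ge0 => //; apply: exprn_ge0; exact: ltW.
  by rewrite /K; lra.
have kapr s : 0 < s -> s <= r1 -> kap * s <= r / 2.
  by move=> s0 sr; rewrite -kr1; apply: ler_pM => //; exact: ltW.
have hMt j n : abs_sum (tail2 (a j)) n r <= M.
  by apply: le_trans (abs_sum_tail2_le _ _ (ltW r0)) (hM j n).
exists K, r1, (cc * (2 * M)), F, Fv; split; split=> //.
- by rewrite !mulr_ge0.
- move=> n s s0 sr; have s0' := ltW s0; have hW := ring_norm_wnorm s0'.
  have [n0 n1] := hkap s s0; have ks := kapr s s0 sr.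
  have ks0 : 0 <= kap * s by rewrite mulr_ge0 // ltW.
  have ksr : kap * s <= r by lra.
  have B j : wnorm s (rpsum (tail2 (a j)) n.+2 poly_x0 poly_x1) <= M / r ^+ 2 * (kap * s) ^+ 2.
    apply: le_trans (rpsum_norm _ _ s0' n0 n1) _.
    exact: abs_sum_tail2 (hM j) ks0 ksr.
  have t0 := le_trans (rn_M hW (PC c0) _) (ler_wpM2l (rn_ge0 hW _) (B 0)).
  have t1 := le_trans (rn_M hW (PC c1) _) (ler_wpM2l (rn_ge0 hW _) (B 1)).
  apply: le_trans (rn_D hW _ _) _; apply: le_trans (lerD t0 t1) _.
  rewrite !(wnormC _ s0') -mulrDl -/cc.
  rewrite (_ : cc * _ = cc * (M / r ^+ 2 * kap ^+ 2) * s ^+ 2); last by rewrite exprMn !mulrA.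
  by apply: ler_wpM2r; [exact: exprn_ge0|rewrite /K lerDl; exact: ler01].
- move=> n; have s0' := ltW r10; have hW := ring_norm_wnorm s0'.
  have [n0 n1] := hkap r1 r10; have ks := kapr r1 r10 (lexx _).
  have n0' := le_trans n0 ks; have n1' := le_trans n1 ks.
  have B j : wnorm r1 (rpsum (tail2 (a j)) n.+3 poly_x0 poly_x1 - rpsum (tail2 (a j)) n.+2 poly_x0 poly_x1)
      <= 2 * M * 2^-1 ^+ n.
    apply: le_trans (rpsum_diff n.+2 s0' r0 (hMt j) n0' n1') _.
    rewrite -[leLHS]mul1r -mulrA; apply: ler_pM => //; first by rewrite mulr_ge0 // half_ge0.
      by rewrite ler1n.
    apply: ler_wpM2l => //; apply: ler_wiXn2l; rewrite ?invr_ge0 // ?invf_le1 ?ler1n //.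
    by rewrite -addn2 leq_addr.
  have t0 := le_trans (rn_M hW (PC c0) _) (ler_wpM2l (rn_ge0 hW _) (B 0)).
  have t1 := le_trans (rn_M hW (PC c1) _) (ler_wpM2l (rn_ge0 hW _) (B 1)).
  have -> : F n.+1 - F n =
    PC c0 * (rpsum (tail2 (a 0)) n.+3 poly_x0 poly_x1 - rpsum (tail2 (a 0)) n.+2 poly_x0 poly_x1) +
    PC c1 * (rpsum (tail2 (a 1)) n.+3 poly_x0 poly_x1 - rpsum (tail2 (a 1)) n.+2 poly_x0 poly_x1).
    exact: combB.
  apply: le_trans (rn_D hW _ _) _; apply: le_trans (lerD t0 t1) _.
  by rewrite !(wnormC _ s0') -mulrDl mulrA.
- move=> x n xr.
  have hx : `|xi x| <= r / 2.
    apply: le_trans (xi_norm al ga w0 x) _; rewrite -kr1.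
    by apply: ler_pM => //; [exact: ltW (kx_gt0 al ga w0)|exact: (rn_ge0 hC)].
  rewrite ev_comb !(ev_rpsum _ _ (ev_poly_x0 x) (ev_poly_x1 x)).
  pose l j := a j 1%N 0%N * xi x 0 0 + a j 0%N 1%N * xi x 0 1.
  have B j : `|psum idfun (tail2 (a j)) n.+2 (xi x 0 0) (xi x 0 1) - (X (xi x) 0 j - l j)|
      <= 2 * M * 2^-1 ^+ n.
    have := ha j _ hx n.+2; rewrite add0r psum_tail2 a00 /= add0r => k.
    rewrite (_ : _ - _ = a j 1%N 0%N * xi x 0 0 + a j 0%N 1%N * xi x 0 1 +
      psum idfun (tail2 (a j)) n.+2 (xi x 0 0) (xi x 0 1) - X (xi x) 0 j); last by rewrite /l; ring.
    apply: le_trans k _; apply: ler_wpM2l; first by rewrite mulr_ge0.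
    apply: ler_wiXn2l; rewrite ?invr_ge0 // ?invf_le1 ?ler1n //.
    by rewrite -addn2 leq_addr.
  have e0 : X (xi x) 0 0 - (al * xi x 0 0 + be * xi x 0 1) = X (xi x) 0 0 - l 0.
    by rewrite /l lin0.1 lin0.2.
  have e1 : X (xi x) 0 1 - (ga * xi x 0 0 - al * xi x 0 1) = X (xi x) 0 1 - l 1.
    by rewrite /l lin1.1 lin1.2; ring.
  rewrite /Fv e0 e1.
  rewrite (_ : _ - _ = c0 * real_complex R (psum idfun (tail2 (a 0)) n.+2 (xi x 0 0) (xi x 0 1) - (X (xi x) 0 0 - l 0))
    + c1 * real_complex R (psum idfun (tail2 (a 1)) n.+2 (xi x 0 0) (xi x 0 1) - (X (xi x) 0 1 - l 1))); last first.
    by rewrite !(real_complexB (psum _ _ _ _ _)); ring.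
  apply: le_trans (rn_D hC _ _) _.
  have t0 := rn_M hC c0 (real_complex R (psum idfun (tail2 (a 0)) n.+2 (xi x 0 0) (xi x 0 1) - (X (xi x) 0 0 - l 0))).
  have t1 := rn_M hC c1 (real_complex R (psum idfun (tail2 (a 1)) n.+2 (xi x 0 0) (xi x 0 1) - (X (xi x) 0 1 - l 1))).
  rewrite cnorm_real in t0; rewrite cnorm_real in t1.
  have t0' := le_trans t0 (ler_wpM2l (rn_ge0 hC _) (B 0)).
  have t1' := le_trans t1 (ler_wpM2l (rn_ge0 hC _) (B 1)).
  by apply: le_trans (lerD t0' t1') _; rewrite -mulrDl mulrA.
- move=> z; have w1 : w != 0 by rewrite gt_eqF.
  have -> : z + Fv z = zc (xi z) + Fv z by rewrite (xiK w0 hw).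
  rewrite /Fv /c0 /c1 /zcoord.
  move: (xi z 0 0) (xi z 0 1) (X (xi z) 0 0) (X (xi z) 0 1) => x y u v.
  have hw' : w * w = - al ^+ 2 - be * ga by rewrite -hw expr2.
  apply/eqP; rewrite eq_complex /=; apply/andP; split; apply/eqP.
    transitivity (- (w * w) * y + (ga * (u - (al * x + be * y)) - al * (v - (ga * x - al * y)))).
      by rewrite hw'; ring.
    by field.
  by field.
Qed.
End Complexification.

Lemma is_derive_ge (R : realType) (g : R -> R) (l m d0 : R) : 0 < d0 ->
  is_derive (0 : R) (1 : R) g l -> (forall t, 0 < t <= d0 -> g 0 + m * t <= g t) -> m <= l.
Proof.
move=> d00 /is_derive_epsP H hg; rewrite leNgt; apply/negP => lm.
have e0 : 0 < (m - l) / 2 by lra.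
have [d d_gt0 hd] := H _ e0.
pose h := Num.min (d / 2) d0.
have h0 : 0 < h by rewrite lt_min d00 divr_gt0.
have hdl : h <= d / 2 by rewrite ge_min lexx.
have hd0 : h <= d0 by rewrite ge_min lexx orbT.
clearbody h.
have k1 : `|h| < d by rewrite gtr0_norm //; lra.
have := hd h k1; rewrite add0r (gtr0_norm h0) ler_norml => /andP[_].
have := hg h; rewrite h0 hd0 => /(_ isT); rewrite /GRing.scale /=.
have := mulr_gt0 e0 h0; lra.
Qed.

Lemma is_derive_constant (R : realType) (g : R -> R) (l c t : R) :
  is_derive t (1 : R) g l -> (forall s, g s = c) -> l = 0.
Proof.
move=> [_ <-] h; rewrite (_ : g = cst c); last by apply/funext.
exact: derive_cst.
Qed.

Section CisPeriod.
Variable R : realType.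
Implicit Types a b t : R.

Lemma cisD a b : cis (a + b) = cis a * cis b :> R[i].
Proof.
by apply/eqP; rewrite eq_complex /= cosD sinD; apply/andP; split; apply/eqP; ring.
Qed.

Lemma cis_period t (m : int) : cis (t + m%:~R * (pi *+ 2)) = cis t :> R[i].
Proof.
have hn a (n : nat) : cis (a + (pi *+ 2) *+ n) = cis a :> R[i].
  by rewrite /cis (periodicn (@cosD2pi R)) (periodicn (@sinD2pi R)).
case: m => n; first by rewrite mulr_natl hn.
rewrite NegzE mulrNz mulNr -{2}(subrK (n.+1%:~R * (pi *+ 2)) t) -[n.+1%:~R]/(n.+1%:R).
by rewrite mulr_natl hn.
Qed.

(** After removal of full turns the difference [u] lies in [[0, 2 pi)] with [cos u = 1]. If [u] were
    positive, so would be [sin (u / 2)], contradicting the half-angle formula for [cos u]. *)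
Lemma cis_eq a b : cis a = cis b :> R[i] -> exists m : int, a = b + m%:~R * (pi *+ 2).
Proof.
move=> hab.
have p2 : 0 < pi *+ 2 :> R by rewrite pmulrn_lgt0 // pi_gt0.
pose m := Num.floor ((a - b) / (pi *+ 2)); exists m.
have /andP[m1 m2] := floor_itv ((a - b) / (pi *+ 2)).
rewrite -/m ler_pdivlMr // in m1; rewrite -/m ltr_pdivrMr // intrD mulrDl mul1r in m2.
pose u := a - b - m%:~R * (pi *+ 2).
have cu : cos u = 1.
  have : cis (u + b) = cis b :> R[i].
    by rewrite -hab -[RHS](cis_period _ (- m)) mulrNz mulNr /u; congr cis; ring.
  rewrite cisD => e.
  have : cis u * cis b * cis (- b) = cis b * cis (- b) :> R[i] by rewrite e.
  rewrite -mulrA -cisD subrr {2 3}/cis cos0 sin0 mulr1.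
  by move/eqP; rewrite eq_complex /= => /andP[/eqP].
have [u0 u1] : 0 <= u /\ u < pi *+ 2 by rewrite /u; split; lra.
suff : u = 0 by rewrite /u; lra.
apply/eqP/contraT => un; have up : 0 < u by rewrite lt_neqAle eq_sym un.
have : 0 < sin (u / 2).
  apply: sin_gt0_pi; move: u1; rewrite mulr2n; move: (pi : R) => q; lra.
have := cosD (u / 2) (u / 2); rewrite (_ : u / 2 + u / 2 = u); last by field.
rewrite cu; have := cos2Dsin2 (u / 2); move: (cos _) (sin _) => x y h1 h2 h3.
by have := mulr_gt0 h3 h3; move: h1 h2; rewrite !expr2; lra.
Qed.
End CisPeriod.


(** * The normal form and its dynamics *)

Section NormalFormMap.
Variable R : realType.
Local Notation C := R[i].
Local Notation P := {poly {poly C}}.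
Let hC := @ring_norm_cnorm R.

Variables (K r1 A : R) (F : nat -> P) (Fv : C -> C).
Hypotheses (K0 : 0 < K) (A0 : 0 <= A).
Hypothesis F_quad : forall n, quadratic K r1 (F n).
Hypothesis F_geo : geometric r1 A F.
Hypothesis F_lim : forall x n, cnorm x <= r1 -> cnorm (ev x (F n) - Fv x) <= A * 2^-1 ^+ n.

Definition nf_phi n : P := 'X + (nf_seq F n).1.
Definition nf_mu n : P := (nf_seq F n).2.
Definition Phi (x : C) : C := clim (fun n => ev x (nf_phi n)).
Definition Mu (x : C) : C := clim (fun n => ev x (nf_mu n)).
(** The imaginary unit times [Ang] is the velocity of [Phi] along a circle ([Phi_circle]). The index
    [n.+1] is the one at which the stage equation [angular_phi] holds. *)
Definition Ang (x : C) : C := clim (fun n => ev x (angular (nf_phi n.+1))).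

Variable s0 : R.
Hypotheses (s00 : 0 < s0) (s0r : 4 * s0 <= r1) (s0K : 256 * (K * s0) <= 1).

Lemma sub_radius s : s <= s0 -> 4 * s <= r1 /\ 256 * (K * s) <= 1.
Proof.
move=> h; split; first by have := s0r; lra.
have := ler_wpM2l (ltW K0) h; have := s0K; lra.
Qed.

Lemma nf_phi_geo : geometric s0 (s0 + 16 * A) nf_phi.
Proof.
move=> n; rewrite /nf_phi (_ : _ - _ = (nf_seq F n.+1).1 - (nf_seq F n).1); last by ring.
exact: (nf_seq_geo1 K0 A0 F_quad F_geo s00 s0r s0K n).
Qed.

Lemma angular_phi n : angular (nf_phi n.+1) = nf_phi n.+1 +
  (nf_rhs (F n) (nf_seq F n) + (nf_seq F n.+1).2 * 'X).
Proof.
rewrite /nf_phi -angular_nf_seq angularD.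
by rewrite angularX; ring.
Qed.

Lemma nf_ang_geo : geometric s0 (5 * (s0 + 16 * A)) (fun n => angular (nf_phi n.+1)).
Proof.
move=> n; rewrite /nf_phi !angularD.
set a := angular (nf_seq F n.+2).1; set b := angular _; set c := angular _.
rewrite (_ : _ - _ = a - c); last by ring.
exact: (nf_seq_geo_angular K0 A0 F_quad F_geo s00 s0r s0K n).
Qed.

Lemma Phi_lim x : cnorm x <= s0 ->
  forall n, cnorm (ev x (nf_phi n) - Phi x) <= 4 * (s0 + 16 * A) * 2^-1 ^+ n.
Proof. by move=> xs; exact: ev_geometric xs nf_phi_geo. Qed.

Lemma Ang_lim x : cnorm x <= s0 ->
  forall n, cnorm (ev x (angular (nf_phi n.+1)) - Ang x) <= 4 * (5 * (s0 + 16 * A)) * 2^-1 ^+ n.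
Proof. by move=> xs; exact: ev_geometric xs nf_ang_geo. Qed.

Lemma Phi_gcvg x : cnorm x <= s0 -> gcvg (fun n => ev x (nf_phi n)) (Phi x).
Proof. by move=> xs; exists (4 * (s0 + 16 * A)); exact: Phi_lim. Qed.

Lemma nf_mu_geo : geometric s0 ((s0 + 16 * A) / s0) nf_mu.
Proof. by move=> n; exact: (nf_seq_geo2 K0 A0 F_quad F_geo s00 s0r s0K n). Qed.

Lemma Mu_gcvg x : cnorm x <= s0 -> gcvg (fun n => ev x (nf_mu n)) (Mu x).
Proof. by move=> xs; exact: ev_gcvg xs nf_mu_geo. Qed.

Lemma nf_quad n : quadratic (16 * K) s0 (nf_seq F n).1.
Proof.
move=> s s_gt0 ss; have [h1 h2] := sub_radius ss.
exact: (nf_seq_ball K0 A0 F_quad s_gt0 h1 h2 n).1.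
Qed.

Lemma nf_mu_norm n s : 0 < s -> s <= s0 -> wnorm s (nf_mu n) <= 16 * K * s.
Proof.
move=> s_gt0 ss; have [h1 h2] := sub_radius ss.
exact: (nf_seq_ball K0 A0 F_quad s_gt0 h1 h2 n).2.
Qed.

Lemma nf_phi_norm n s : 0 < s -> s <= s0 -> wnorm s (nf_phi n) <= 2 * s.
Proof.
move=> s_gt0 ss; have [h1 h2] := sub_radius ss.
by have [_ _] := nf_ball_small K0 A0 s_gt0 h1 h2 (nf_seq_ball K0 A0 F_quad s_gt0 h1 h2 n).
Qed.

Lemma Phi_norm x s : 0 < s -> s <= s0 -> cnorm x <= s -> cnorm (Phi x) <= 2 * s.
Proof.
move=> s_gt0 ss xs; apply: (gcvg_cnorm_le (Phi_gcvg (le_trans xs ss))) => n.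
by apply: le_trans (ev_norm _ xs) _; exact: nf_phi_norm.
Qed.

Lemma Mu_norm x s : 0 < s -> s <= s0 -> cnorm x <= s -> cnorm (Mu x) <= 16 * K * s.
Proof.
move=> s_gt0 ss xs; apply: (gcvg_cnorm_le (Mu_gcvg (le_trans xs ss))) => n.
by apply: le_trans (ev_norm _ xs) _; exact: nf_mu_norm.
Qed.

(** The displacement polynomials have norm at most [s0 / 16], divided by the half radius [s0 / 2] in
    the Lipschitz bound. A displacement with constant below 1 leaves [Phi] injective. *)
Lemma Phi_lip x y : cnorm x <= s0 / 2 -> cnorm y <= s0 / 2 ->
  cnorm (Phi x - Phi y - (x - y)) <= cnorm (x - y) / 4.
Proof.
move=> hx hy; have s0' := s00; have s2 : 0 < s0 / 2 by lra.
have xs : cnorm x <= s0 by lra.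
have ys : cnorm y <= s0 by lra.
have h := gcvgD (gcvgD (Phi_gcvg xs) (gcvgN (Phi_gcvg ys))) (gcvgN (gcvg_cst (x - y))).
apply: (gcvg_cnorm_le h) => n; rewrite /nf_phi !evD !evX.
rewrite (_ : _ - (x - y) = ev x (nf_seq F n).1 - ev y (nf_seq F n).1); last by ring.
apply: le_trans (ev_lip _ s2 hx hy) _.
rewrite (_ : 2 * (s0 / 2) = s0); last by field.
have hq : wnorm s0 (nf_seq F n).1 <= s0 / 16.
  apply: le_trans (nf_quad n s00 (lexx _)) _; rewrite (_ : 16 * K * s0 ^+ 2 = s0 * (16 * (K * s0))); last by ring.
  by apply: ler_wpM2l; [exact: ltW|have := s0K; lra].
rewrite -mulrA; apply: ler_wpM2l; first exact: (rn_ge0 hC).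
rewrite mulrC ler_pdivrMr //; lra.
Qed.

Lemma Phi_inj x y : cnorm x <= s0 / 2 -> cnorm y <= s0 / 2 -> Phi x = Phi y -> x = y.
Proof.
move=> hx hy e; have := Phi_lip hx hy; rewrite e subrr sub0r (rn_N hC) => h.
apply/eqP; rewrite -subr_eq0; apply/eqP; apply: cnorm_eq0; have := rn_ge0 hC (x - y); lra.
Qed.

(** Limit of the exact stage equation; the terms [Mu x * (Phi x - x)] and [Mu x * x] recombine into
    [Mu x * Phi x]. *)
Lemma Ang_eq x : cnorm x <= s0 -> Ang x = (1 + Mu x) * (Phi x + Fv (Phi x)).
Proof.
move=> xs; have s0' := s00; have r1' := s0r.
apply: (@gcvg_unique _ (fun n => ev x (angular (nf_phi n.+1)))).
  by exists (4 * (5 * (s0 + 16 * A))); exact: Ang_lim.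
have E n : ev x (angular (nf_phi n.+1)) = ev x (nf_phi n.+1) +
   (((1 + ev x (nf_mu n)) * ev (ev x (nf_phi n)) (F n) +
     ev x (nf_mu n) * (ev x (nf_phi n) - x)) + ev x (nf_mu n.+1) * x).
  have e : ev x (nf_seq F n).1 = ev x (nf_phi n) - x by rewrite /nf_phi evD evX; ring.
  rewrite angular_phi evD; congr (_ + _).
  rewrite evD [ev x (_ * 'X)]evM evX; congr (_ + _).
  by rewrite /nf_rhs evD !evM -/(nf_mu n) -/(nf_phi n) ev_scomp e evD ev1.
have -> : (1 + Mu x) * (Phi x + Fv (Phi x)) = Phi x + (((1 + Mu x) * Fv (Phi x) +
   Mu x * (Phi x - x)) + Mu x * x) by ring.
have -> : (fun n => ev x (angular (nf_phi n.+1))) = (fun n => ev x (nf_phi n.+1) +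
   (((1 + ev x (nf_mu n)) * ev (ev x (nf_phi n)) (F n) +
     ev x (nf_mu n) * (ev x (nf_phi n) - x)) + ev x (nf_mu n.+1) * x)) by apply/funext.
have hP := Phi_gcvg xs; have hM := Mu_gcvg xs.
apply: gcvgD; first exact: (gcvg_shift hP).
apply: gcvgD; last exact: (gcvgM (gcvg_shift hM) (gcvg_cst x)).
apply: gcvgD; last exact: (gcvgM hM (gcvgD hP (gcvgN (gcvg_cst x)))).
apply: gcvgM; first exact: (gcvgD (gcvg_cst 1) hM).
apply: (@gcvg_comp _ (2 * s0) (K * (4 * s0) ^+ 2) A) hP _; first by lra.
- by move=> n; rewrite mulrA -natrM; apply: F_quad; lra.
- by move=> n; apply: le_trans (ev_norm _ xs) _; exact: nf_phi_norm.
- exact: Phi_norm.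
- by move=> n; apply: F_lim; apply: le_trans (Phi_norm s00 (lexx _) xs) _; lra.
Qed.

Lemma Fv_norm x s : 0 < s -> s <= r1 -> cnorm x <= s -> cnorm (Fv x) <= K * s ^+ 2.
Proof.
move=> s_gt0 sr xs; have h : gcvg (fun n => ev x (F n)) (Fv x).
  by exists A => n; apply: F_lim; exact: le_trans sr.
apply: (gcvg_cnorm_le h) => n; apply: le_trans (ev_norm _ xs) _; exact: F_quad.
Qed.

Lemma nf_mu_diag n i j : i != j -> (nf_mu n)`_i`_j = 0.
Proof.
rewrite /nf_mu; case: n => [|n] ij; first by rewrite /= !coef0.
by rewrite /= coefN coefN coef_zdiv coef_cscale eqSS (negbTE ij) rmorph0 mul0r oppr0.
Qed.

(** Only monomials with equal exponents survive in [nf_mu] ([nf_mu_diag]), and on the real plane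
    these are powers of the squared modulus. *)
Lemma Mu_msq x y : msq x = msq y -> Mu x = Mu y.
Proof.
move=> h; congr (clim _); apply/funext => n.
have [m [h1 h2]] := poly2_bound (nf_mu n).
rewrite !(evE _ h1 h2); apply: eq_bigr => i _; apply: eq_bigr => j _.
have [->|ij] := eqVneq (i : nat) j; last by rewrite (nf_mu_diag _ ij) !mul0r.
by rewrite -!mulrA -!exprMn !mul_conj h.
Qed.

(** The radius [s0 / 2] allows for the factor 2 by which a rotation may enlarge [cnorm]. Convergence
    of the derivatives is [nf_ang_geo]. *)
Lemma Phi_circle x t : cnorm x <= s0 / 2 ->
  hderiv (fun u => Phi (x * cis u)) t (Complex 0 1 * Ang (x * cis t)).
Proof.
move=> hx; have rot u : cnorm (x * cis u) <= s0.
  apply: le_trans (rn_M hC _ _) _; have := ler_pM (rn_ge0 hC _) (rn_ge0 hC _) hx (cnorm_cis u).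
  by rewrite divfK.
have D0 : 0 <= s0 + 16 * A by have := A0; have := s00; lra.
apply: (@hderiv_limit R (fun n u => ev (x * cis u) (nf_phi n.+1))
  (fun n u => Complex 0 1 * ev (x * cis u) (angular (nf_phi n.+1)))
  (fun u => Phi (x * cis u)) (fun u => Complex 0 1 * Ang (x * cis u)) (t - 1) (t + 1)
  (4 * (5 * (s0 + 16 * A)))).
- by apply/andP; split; lra.
- by move=> n u _; exact: hderiv_circle.
- move=> n u _; apply: le_trans (Phi_lim (rot u) n.+1) _.
  have := mulr_ge0 D0 (half_ge0 R n); rewrite exprS; lra.
- by move=> n u _; rewrite -mulrBr cnorm_mul_i; exact: Ang_lim.
Qed.

(** Polynomials representing the imaginary part of [Mu], so that it is itself an analytic germ. *)
Definition im_mu n : P := PC (Complex 0 (- 2^-1)) * (nf_mu n - star (nf_mu n)).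

Lemma im_mu_geo : geometric s0 ((s0 + 16 * A) / s0) im_mu.
Proof.
move=> n; have hW := ring_norm_wnorm (ltW s00).
have -> : im_mu n.+1 - im_mu n = PC (Complex 0 (- 2^-1)) *
    ((nf_mu n.+1 - nf_mu n) - star (nf_mu n.+1 - nf_mu n)).
  by rewrite /im_mu starB; ring.
apply: le_trans (rn_M hW _ _) _; rewrite (wnormC _ (ltW s00)).
have -> : cnorm (Complex 0 (- 2^-1) : C) = 2^-1.
  by rewrite /cnorm /= normr0 add0r normrN ger0_norm // invr_ge0.
rewrite mulrC ler_pdivrMr //; apply: le_trans (rn_B hW _ _) _.
have k := nf_mu_geo n; rewrite (wnorm_star _ (ltW s00)).
by apply: le_trans (lerD k k) _; rewrite mulr_natr mulr2n.
Qed.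

Lemma im_mu_gcvg x : cnorm x <= s0 ->
  gcvg (fun n => ev x (im_mu n)) (real_complex R (complex.Im (Mu x))).
Proof.
move=> xs; have h := Mu_gcvg xs.
have e (z : C) : real_complex R (complex.Im z) = Complex 0 (- 2^-1) * (z - conjc z).
  by case: z => a b; apply/eqP; rewrite eq_complex /=; apply/andP; split; apply/eqP; field.
rewrite e (_ : (fun n => ev x (im_mu n)) =
  (fun n => Complex 0 (- 2^-1) * (ev x (nf_mu n) - conjc (ev x (nf_mu n))))); last first.
  by apply/funext => n; rewrite /im_mu evM evC evB ev_star.
exact: (gcvgM (gcvg_cst _) (gcvgD h (gcvgN (gcvg_conj h)))).
Qed.

(** * The inverse map and its squared modulus *)

Variable t0 : R.
Hypotheses (t00 : 0 < t0) (t0s : 4 * t0 <= s0) (t0K : 64 * (16 * K * t0) <= 1).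

Definition nf_psi n : P := 'X + inv_seq (fun n => (nf_seq F n).1) n.
Definition Psi (x : C) : C := clim (fun n => ev x (nf_psi n)).

Let K16 : 0 < 16 * K.
Proof. by rewrite mulr_gt0. Qed.
Let A16 : 0 <= s0 + 16 * A.
Proof. by have := A0; have := s00; lra. Qed.
Let G_geo : geometric s0 (s0 + 16 * A) (fun n => (nf_seq F n).1).
Proof. exact: (nf_seq_geo1 K0 A0 F_quad F_geo s00 s0r s0K). Qed.

Lemma inv_sub_radius s : s <= t0 -> 4 * s <= s0 /\ 64 * (16 * K * s) <= 1.
Proof.
move=> h; split; first by have := t0s; lra.
have := ler_wpM2l (ltW K0) h; have := t0K; lra.
Qed.

Lemma nf_psi_geo : geometric t0 (t0 + 4 * (s0 + 16 * A)) nf_psi.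
Proof.
move=> n; rewrite /nf_psi; set a := inv_seq _ _; set b := inv_seq _ _.
rewrite (_ : _ - _ = a - b); last by ring.
exact: (inv_seq_geo K16 A16 nf_quad G_geo t00 t0s t0K n).
Qed.

Lemma nf_psi_norm n s : 0 < s -> s <= t0 ->
  wnorm s (nf_psi n) <= 2 * s /\ wnorm s (nf_psi n - 'X) <= 64 * K * s ^+ 2.
Proof.
move=> s_gt0 ss; have [h1 h2] := inv_sub_radius ss.
have [a b] := inv_seq_norm K16 A16 nf_quad s_gt0 h1 h2 n; split=> //.
rewrite /nf_psi (_ : _ - 'X = inv_seq (fun n => (nf_seq F n).1) n); last by ring.
by apply: le_trans a _; rewrite -!mulrA mulrA -natrM.
Qed.

Lemma Psi_gcvg x : cnorm x <= t0 -> gcvg (fun n => ev x (nf_psi n)) (Psi x).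
Proof. by move=> xs; exact: ev_gcvg xs nf_psi_geo. Qed.

Lemma Psi_norm x s : 0 < s -> s <= t0 -> cnorm x <= s -> cnorm (Psi x) <= 2 * s.
Proof.
move=> s_gt0 ss xs; apply: (gcvg_cnorm_le (Psi_gcvg (le_trans xs ss))) => n.
by apply: le_trans (ev_norm _ xs) _; exact: (nf_psi_norm n s_gt0 ss).1.
Qed.

(** By the recursion of [inv_seq], [psi_(n+1) + (phi_n (psi_n) - psi_n)] is exactly [x] at each
    stage. *)
Lemma Phi_Psi x : cnorm x <= t0 -> Phi (Psi x) = x.
Proof.
move=> xs; have t0' := t00; have ts' := t0s.
have hPsi := Psi_gcvg xs; have hle := Psi_norm t00 (lexx _) xs.
have hle' : cnorm (Psi x) <= s0 by lra.
apply: (@gcvg_unique _ (fun n => ev x (nf_psi n.+1) + (ev (ev x (nf_psi n)) (nf_phi n)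
   - ev x (nf_psi n)))).
- rewrite -[Phi _](addrNK (Psi x)) addrC; apply: gcvgD; first exact: gcvg_shift hPsi.
  apply: gcvgD; last exact: gcvgN.
  apply: (@gcvg_comp _ (2 * t0) (8 * t0) (4 * (s0 + 16 * A))) hPsi _ => //; first by lra.
  + move=> n; have -> : 8 * t0 = 2 * (2 * (2 * t0)) by ring.
    by apply: nf_phi_norm; lra.
  + by move=> n; apply: le_trans (ev_norm _ xs) _; exact: (nf_psi_norm n t00 (lexx _)).1.
  + exact: Phi_lim.
- have -> : (fun n => ev x (nf_psi n.+1) + (ev (ev x (nf_psi n)) (nf_phi n)
     - ev x (nf_psi n))) = (fun=> x); last exact: gcvg_cst.
  apply/funext => n; rewrite {1}/nf_psi evD evX /= evN ev_scomp -/(nf_psi n).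
  by rewrite /nf_phi evD evX; ring.
Qed.

(** Both sides have the same image under the injective [Phi], by [Phi_Psi]; halving the radius keeps
    [Phi x] in the domain of [Psi]. *)
Lemma Psi_Phi x : cnorm x <= t0 / 2 -> Psi (Phi x) = x.
Proof.
move=> xs; have t0' := t00; have ts' := t0s.
have t2 : 0 < t0 / 2 by lra.
have t2s : t0 / 2 <= s0 by lra.
have h1 : cnorm (Phi x) <= t0 by have := Phi_norm t2 t2s xs; lra.
by have h2 := Psi_norm t00 (lexx _) h1; apply: Phi_inj; [lra|lra|exact: Phi_Psi].
Qed.

Definition first_integral_poly n : P := nf_psi n * star (nf_psi n).

Lemma first_integral_geo :
  geometric t0 (4 * t0 * (t0 + 4 * (s0 + 16 * A))) first_integral_poly.
Proof.
move=> n; have t0' := ltW t00; have hW := ring_norm_wnorm t0'.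
have -> : first_integral_poly n.+1 - first_integral_poly n =
  (nf_psi n.+1 - nf_psi n) * star (nf_psi n.+1) + nf_psi n * star (nf_psi n.+1 - nf_psi n).
  by rewrite /first_integral_poly starB; ring.
apply: le_trans (rn_D hW _ _) _.
have h1 := rn_M hW (nf_psi n.+1 - nf_psi n) (star (nf_psi n.+1)).
have h2 := rn_M hW (nf_psi n) (star (nf_psi n.+1 - nf_psi n)).
rewrite !(wnorm_star _ t0') in h1 h2.
have k := nf_psi_geo n.
have k1 := ler_pM (rn_ge0 hW _) (rn_ge0 hW _) k (nf_psi_norm n.+1 t00 (lexx _)).1.
have k2 := ler_pM (rn_ge0 hW _) (rn_ge0 hW _) (nf_psi_norm n t00 (lexx _)).1 k.
apply: le_trans (lerD (le_trans h1 k1) (le_trans h2 k2)) _.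
rewrite le_eqVlt; apply/orP; left; apply/eqP; ring.
Qed.

Lemma first_integral_gcvg x : cnorm x <= t0 ->
  gcvg (fun n => ev x (first_integral_poly n)) (real_complex R (msq (Psi x))).
Proof.
move=> xs; have h := Psi_gcvg xs; rewrite -mul_conj.
rewrite (_ : (fun n => _) = (fun n => ev x (nf_psi n) * conjc (ev x (nf_psi n)))); last first.
  by apply/funext => n; rewrite /first_integral_poly evM ev_star.
exact: gcvgM h (gcvg_conj h).
Qed.

(** The error is a sum of two products of a quadratic displacement with a factor of order [s]:
    [64 * 2 + 64 = 192]. *)
Lemma first_integral_error n s : 0 < s -> s <= t0 ->
  wnorm s (first_integral_poly n - 'X * star 'X) <= 192 * K * s ^+ 3.
Proof.
move=> s_gt0 ss; have s_ge0 := ltW s_gt0; have hW := ring_norm_wnorm s_ge0.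
have [h1 h2] := nf_psi_norm n s_gt0 ss.
rewrite (_ : _ - _ = (nf_psi n - 'X) * star (nf_psi n) + 'X * star (nf_psi n - 'X)); last first.
  by rewrite /first_integral_poly starB; ring.
apply: le_trans (rn_D hW _ _) _.
have k1 := rn_M hW (nf_psi n - 'X) (star (nf_psi n)).
have k2 := rn_M hW 'X (star (nf_psi n - 'X)).
rewrite !(wnorm_star _ s_ge0) in k1 k2.
have l1 := ler_pM (rn_ge0 hW _) (rn_ge0 hW _) h2 h1.
have l2 := ler_pM (rn_ge0 hW _) (rn_ge0 hW _) (wnormX s_ge0) h2.
apply: le_trans (lerD (le_trans k1 l1) (le_trans k2 l2)) _.
rewrite le_eqVlt; apply/orP; left; apply/eqP; ring.
Qed.

(** The Lipschitz bound doubles the radius in the cubic error, whence [192 * 8 = 1536]. A constant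
    of order [s ^+ 2] is negligible against the derivative of [msq], of order [s]. *)
Lemma first_integral_lip x y s : 0 < s -> 2 * s <= t0 -> cnorm x <= s -> cnorm y <= s ->
  `|(msq (Psi x) - msq x) - (msq (Psi y) - msq y)| <= 1536 * K * s ^+ 2 * cnorm (x - y).
Proof.
move=> s_gt0 ss xs ys; have xt : cnorm x <= t0 by lra.
have yt : cnorm y <= t0 by lra.
rewrite -cnorm_real !real_complexB -!mul_conj.
have hx := first_integral_gcvg xt; have hy := first_integral_gcvg yt.
rewrite -!mul_conj in hx hy.
have h := gcvgD (gcvgD hx (gcvgN (gcvg_cst (x * conjc x)))) (gcvgN (gcvgD hy (gcvgN (gcvg_cst (y * conjc y))))).
apply: (gcvg_cnorm_le h) => n.
have e z : ev z (first_integral_poly n) - z * conjc z = ev z (first_integral_poly n - 'X * star 'X).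
  by rewrite evB evM ev_star evX.
rewrite !e; apply: le_trans (ev_lip _ s_gt0 xs ys) _.
have s2 : 0 < 2 * s by lra.
apply: le_trans (ler_wpM2l _ (first_integral_error n s2 ss)) _.
  by rewrite divr_ge0 ?(rn_ge0 hC) // ltW.
rewrite le_eqVlt; apply/orP; left; apply/eqP; field; lra.
Qed.

(** * Tangential and radial parts of the field *)

Section Dynamics.
Variables (al be ga w : R) (X : 'rV[R]_2 -> 'rV[R]_2).
Hypotheses (w0 : 0 < w) (hw : w ^+ 2 = - al ^+ 2 - be * ga).
Local Notation V := 'rV[R]_2.
Local Notation zc := (zcoord al ga w).
Local Notation xi := (xcoord al ga w).
Hypothesis XE : forall z, zc (X (xi z)) = Complex 0 w * (z + Fv z).
Variable t1 : R.
Hypotheses (t10 : 0 < t1) (t1t : 8 * t1 <= t0) (t1K : 32 * (32 * (32 * (K * t1))) <= 1).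


Definition first_integral (v : V) : R := msq (Psi (zc v)).
Local Notation f := first_integral.

Lemma first_integral_analytic q : cnorm (zc q) < t0 -> analytic_at f q.
Proof.
move=> h; apply: (@zc_analytic R al ga w w0 first_integral_poly t0 _ (fun z => msq (Psi z)) q
  (first_integral_geo) _ h).
exact: (first_integral_gcvg).
Qed.

Lemma Mu_small x : cnorm x <= s0 / 2 -> cnorm (Mu x) <= 1 / 32.
Proof.
move=> hx; have s00' := s00; have s0K' := s0K.
have s2 : 0 < s0 / 2 by lra.
have s2s : s0 / 2 <= s0 by lra.
have := Mu_norm s2 s2s hx; lra.
Qed.

Lemma Mu_bound x : cnorm x <= s0 / 2 -> 0 < msq (1 + Mu x) <= 4 /\ 0 < 1 + complex.Re (Mu x).
Proof.
move=> /Mu_small hM.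
have re : 0 < 1 + complex.Re (Mu x).
  by have := Re_le_cnorm (Mu x); rewrite ler_norml => /andP[h _]; lra.
split=> //; apply/andP; split.
  rewrite /msq; have := sqr_ge0 (complex.Im (1 + Mu x)).
  have : 0 < complex.Re (1 + Mu x) ^+ 2 by rewrite exprn_gt0 //; case: (Mu x) re.
  lra.
apply: le_trans (msq_le_cnorm _) _.
have n2 : cnorm (1 + Mu x) <= 2.
  apply: le_trans (rn_D hC _ _) _; have := rn_1 hC; lra.
by have := ler_pM (rn_ge0 hC _) (rn_ge0 hC _) n2 n2; rewrite -natrM -expr2.
Qed.

(** By [Ang_eq] the field is [i w Ang / (1 + Mu)]. Multiplying by the conjugate of [1 + Mu]
    separates a part along [i Ang], tangent to the image of the circle, from a part along [Ang]
    proportional to [Im Mu]. *)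
Lemma field_normal_form x : cnorm x <= s0 / 2 ->
  X (xi (Phi x)) = w / msq (1 + Mu x) *:
    ((1 + complex.Re (Mu x)) *: xi (Complex 0 1 * Ang x) + complex.Im (Mu x) *: xi (Ang x)).
Proof.
move=> hx; have s00' := s00; have s0K' := s0K; have xs : cnorm x <= s0 by lra.
have N0 : msq (1 + Mu x) != 0 by rewrite gt_eqF // (andP (Mu_bound hx).1).1.
rewrite -[LHS](zcK w0 hw) XE -!(xiZ w0 hw) -!(xiD w0 hw) -(xiZ w0 hw); congr (xi _).
have := Ang_eq xs; rewrite -/(Ang x).
move: N0; case: (Mu x) => a b; move: (Phi x + Fv (Phi x)) (Ang x) => [c d] [u v] N0 [-> ->].
move: N0; rewrite /msq /= => N0.
by apply/eqP; rewrite eq_complex /=; apply/andP; split; apply/eqP; field; rewrite add0r in N0.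
Qed.

Lemma small_radius z : 0 < cnorm z -> cnorm z <= t1 ->
  [/\ cnorm z <= t0 / 8, 32 * (32 * (32 * (K * cnorm z))) <= 1 &
      cnorm (Psi z) <= 2 * cnorm z].
Proof.
move=> z0 zt; have t1t' := t1t; have t1K' := t1K; have t00' := t00.
have zt0 : cnorm z <= t0 / 8 by lra.
split=> //; first by have := ler_wpM2l (ltW K0) zt; lra.
by apply: (Psi_norm z0 _ (lexx _)); lra.
Qed.

(** So [Ang] is nearly the radius vector. The constant is 32 from [Mu], as [Psi] may double the
    norm, plus 1 from [Fv], plus 1 absorbing their product. *)
Lemma Ang_near z : 0 < cnorm z -> cnorm z <= t1 ->
  cnorm (Ang (Psi z) - z) <= 34 * (K * cnorm z) * cnorm z.
Proof.
move=> z0 zt; have [zt0 zK pz] := small_radius z0 zt.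
have t00' := t00; have t0s' := t0s; have s0r' := s0r.
have -> : Ang (Psi z) = (1 + Mu (Psi z)) * (z + Fv z).
  rewrite (Ang_eq); last by lra.
  by rewrite (Phi_Psi) //; lra.
have z2 : 0 < 2 * cnorm z by lra.
have z2s : 2 * cnorm z <= s0 by lra.
have zr : cnorm z <= r1 by lra.
have hM := Mu_norm z2 z2s pz.
have hF := Fv_norm z0 zr (lexx _).
rewrite (_ : _ - z = Mu (Psi z) * (z + Fv z) + Fv z); last by ring.
apply: le_trans (rn_D hC _ _) _.
have h1 := rn_M hC (Mu (Psi z)) (z + Fv z); have h2 := rn_D hC z (Fv z).
have h3 := ler_wpM2l (rn_ge0 hC (Mu (Psi z))) h2.
have h4 := ler_wpM2r (addr_ge0 (ltW z0) (rn_ge0 hC (Fv z))) hM.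
have kz0 : 0 <= K * cnorm z by rewrite mulr_ge0 // ltW.
have h5 := ler_wpM2l kz0 hF.
have h6 := ler_wpM2r (mulr_ge0 kz0 (ltW z0)) zK.
apply: le_trans (lerD (le_trans h1 (le_trans h3 h4)) hF) _.
move: h5 h6 (mulr_ge0 kz0 (ltW z0)); rewrite expr2; move: (cnorm (Fv z)) (cnorm z) => y x; move: K => k; lra.
Qed.

Lemma msqD_line (x d : C) (t : R) :
  msq (x + real_complex R t * d) = msq x + 2 * t * complex.Re (conjc x * d) + t ^+ 2 * msq d.
Proof. by case: x => a b; case: d => c e; rewrite /msq /=; ring. Qed.

(** In a direction close to [z], [msq] grows at a rate close to [2 * msq z], which is at least about
    [cnorm z ^+ 2]; [first_integral_lip] controls the correction. *)
Lemma radial_growth z t : 0 < cnorm z -> cnorm z <= t1 -> 0 < t <= 1 / 2 ->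
  msq (Psi z) + cnorm z ^+ 2 / 2 * t <= msq (Psi (z + real_complex R t * Ang (Psi z))).
Proof.
have fin (a b c d e u v y : R) : - u <= c - (e + 2 * t * a + y) - (d - e) ->
    u <= t * v -> 0 <= y -> t * (b / 2) <= t * (2 * a - v) -> d + b / 2 * t <= c by lra.
move=> z0 zt /andP[tp th]; have [zt0 zK pz] := small_radius z0 zt.
have hA := Ang_near z0 zt; set B := Ang (Psi z) in hA *.
have nB : cnorm B <= 2 * cnorm z.
  have := rn_D hC (B - z) z; rewrite subrK => k.
  have := ler_wpM2r (ltW z0) zK; lra.
have z2 : 0 < 2 * cnorm z by lra.
have z4 : 2 * (2 * cnorm z) <= t0 by lra.
have tB : cnorm (real_complex R t * B) <= t * cnorm B.
  by apply: le_trans (rn_M hC _ _) _; rewrite cnorm_real gtr0_norm.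
have nz : cnorm z <= 2 * cnorm z by lra.
have nzt : cnorm (z + real_complex R t * B) <= 2 * cnorm z.
  apply: le_trans (rn_D hC _ _) _; have := ler_wpM2l (ltW tp) nB.
  have := ler_wpM2r (ltW z0) th; lra.
have := first_integral_lip z2 z4 nzt nz.
rewrite (_ : z + _ - z = real_complex R t * B); last by ring.
rewrite msqD_line ler_norml => /andP[lo _].
have re : complex.Re (conjc z * (B - z)) >= - (34 * (K * cnorm z) * cnorm z ^+ 2).
  have := Re_le_cnorm (conjc z * (B - z)); rewrite ler_norml => /andP[k _].
  apply: le_trans k; rewrite lerN2; apply: le_trans (rn_M hC _ _) _.
  rewrite cnorm_conj; have := ler_wpM2l (ltW z0) hA; rewrite expr2; lra.
have reB : complex.Re (conjc z * B) = msq z + complex.Re (conjc z * (B - z)).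
  by case: (z) (B) => a b [c e]; rewrite /msq /=; ring.
have sq := msq_ge0 B; have t2 := mulr_ge0 (sqr_ge0 t) sq.
have mz := cnorm_le_msq z.
have k1 : 1536 * K * (2 * cnorm z) ^+ 2 * cnorm (real_complex R t * B) <=
    t * (8 * (1536 * (K * cnorm z) * cnorm z ^+ 2)).
  have -> : t * (8 * (1536 * (K * cnorm z) * cnorm z ^+ 2)) =
    1536 * K * (2 * cnorm z) ^+ 2 * (t * (2 * cnorm z)) by ring.
  apply: ler_wpM2l; first exact: (mulr_ge0 (mulr_ge0 (ler0n _ _) (ltW K0)) (sqr_ge0 _)).
  by apply: le_trans tB _; apply: (ler_wpM2l (ltW tp) nB).
(* [8 * 1536 + 2 * 34] is below [32 ^ 3 / 2]: this is the origin of the smallness condition on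
   [t1]. *)
have k2 : 8 * (1536 * (K * cnorm z) * cnorm z ^+ 2) + 2 * (34 * (K * cnorm z) * cnorm z ^+ 2)
    <= cnorm z ^+ 2 / 2.
  have := ler_wpM2r (sqr_ge0 (cnorm z)) zK.
  have := mulr_ge0 (mulr_ge0 (ltW K0) (ltW z0)) (sqr_ge0 (cnorm z)).
  move: (cnorm z ^+ 2) => y; rewrite -!mulrA; move: (K * _) => x; lra.
have k3 : cnorm z ^+ 2 / 2 <= 2 * complex.Re (conjc z * B) -
   8 * (1536 * (K * cnorm z) * cnorm z ^+ 2).
  rewrite reB; move: re mz k2; move: (complex.Re _) (cnorm z ^+ 2) (msq z) => a b c.
  move: (34 * _ * b) (8 * _) => u v; lra.
exact: (fin _ _ _ _ _ _ _ _ lo k1 t2 (ler_wpM2l (ltW tp) k3)).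
Qed.

(** [f] is constant on the image of a circle, and the direction is the velocity of that closed
    curve. *)
Lemma derive_tangential x : cnorm x <= t0 / 4 ->
  'D_(xi (Complex 0 1 * Ang x)) f (xi (Phi x)) = 0.
Proof.
move=> xt; have t00' := t00; have t0s' := t0s; have s00' := s00.
have xs : cnorm x <= s0 / 2 by lra.
have rot u : cnorm (x * cis u) <= t0 / 2.
  apply: le_trans (rn_M hC _ _) _; have := ler_pM (rn_ge0 hC _) (rn_ge0 hC _) xt (cnorm_cis u); lra.
have cst u : f (xi (Phi (x * cis u))) = msq x.
  rewrite /f (xiK w0 hw) (Psi_Phi) //.
  by rewrite msqM msq_cis mulr1.
have x1 : x * cis 0 = x by rewrite /cis cos0 sin0 mulr1.
have xt2 : cnorm x <= t0 / 2 by lra.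
have zn : cnorm (zc (xi (Phi x))) < t0.
  rewrite (xiK w0 hw); have t8 : 0 < t0 / 4 by lra.
  have t8s : t0 / 4 <= s0 by lra.
  have := Phi_norm t8 t8s xt; lra.
have [l0 [l1 [lE lC]]] := analytic_gradient (first_integral_analytic zn).
rewrite lE; set l := (X in X = _).
have dc := hderiv_xi al ga w (Phi_circle 0 xs).
rewrite x1 in dc.
have := lC _ 0 _ _ dc; rewrite x1 => /(_ erefl) d.
exact: (is_derive_constant d cst).
Qed.

(** [radial_growth] bounds one-sided difference quotients along a segment; the gradient of the
    analytic [f] converts the derivative there into the directional one. *)
Lemma derive_radial z : 0 < cnorm z -> cnorm z <= t1 ->
  cnorm z ^+ 2 / 2 <= 'D_(xi (Ang (Psi z))) f (xi z).
Proof.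
move=> z0 zt; have [zt0 zK pz] := small_radius z0 zt; have t00' := t00.
have zn : cnorm (zc (xi z)) < t0 by rewrite (xiK w0 hw); lra.
have [l0 [l1 [lE lC]]] := analytic_gradient (first_integral_analytic zn).
rewrite lE; set l := (X in _ <= X).
have dl : hderiv (fun t => z + real_complex R t * Ang (Psi z)) 0 (Ang (Psi z)).
  move=> e e0; exists 1 => // h _.
  rewrite (_ : _ - _ - _ = 0) ?(rn_0 hC) ?mulr_ge0 // ?ltW //.
  by rewrite add0r mul0r addr0; ring.
have d := lC _ 0 _ _ (hderiv_xi al ga w dl).
have z1 : z + real_complex R 0 * Ang (Psi z) = z by rewrite mul0r addr0.
rewrite z1 in d.
have h2 : 0 < 1 / 2 :> R by lra.
apply: (is_derive_ge h2 (d erefl)) => t tt.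
rewrite z1 /f !(xiK w0 hw); exact: radial_growth.
Qed.

(* As [0 < m], orbits spiral outwards or inwards according to the sign of [Im Mu]. *)
Lemma derive_along_field z : 0 < cnorm z -> cnorm z <= t1 ->
  exists2 m, w / 32 * msq (Psi z) <= m & 'D_(X (xi z)) f (xi z) = m * complex.Im (Mu (Psi z)).
Proof.
move=> z0 zt; have [zt0 zK pz] := small_radius z0 zt.
have t00' := t00; have t0s' := t0s; have s00' := s00; have s0K' := s0K.
have zn : cnorm (zc (xi z)) < t0 by rewrite (xiK w0 hw); lra.
have [l0 [l1 [lE lC]]] := analytic_gradient (first_integral_analytic zn).
have PP : Phi (Psi z) = z.
  by apply: (Phi_Psi); lra.
have := derive_radial z0 zt.
have pt : cnorm (Psi z) <= t0 / 4 by lra.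
have := derive_tangential pt.
have ps : cnorm (Psi z) <= s0 / 2 by lra.
have := field_normal_form ps; rewrite PP => ->.
rewrite !lE; move: (xi (_ * _)) (xi (Ang _)) => u v T N; rewrite !mxE.
have zz : 0 < cnorm z ^+ 2 / 2 by rewrite divr_gt0 // exprn_gt0.
(* Only the radial derivative contributes. The 32 combines [msq (1 + Mu) <= 4] with
   [msq (Psi z) <= 8 * (cnorm z ^+ 2 / 2)]. *)
exists (w / msq (1 + Mu (Psi z)) * (l0 * v 0 0 + l1 * v 0 1)); last first.
  move: T; move: (Mu (Psi z)) (w / _) => M c T.
  transitivity (c * ((1 + complex.Re M) * (l0 * u 0 0 + l1 * u 0 1) +
     complex.Im M * (l0 * v 0 0 + l1 * v 0 1))); first by ring.
  by rewrite T; ring.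
have pm : msq (Psi z) <= 8 * (cnorm z ^+ 2 / 2).
  apply: le_trans (msq_le_cnorm _) _.
  by have := ler_pM (rn_ge0 hC _) (rn_ge0 hC _) pz pz; rewrite !expr2; lra.
have [/andP[N0 N4] _] := Mu_bound ps.
have k : w / 4 <= w / msq (1 + Mu (Psi z)) by rewrite ler_pM2l // lef_pV2 ?posrE.
have w4 : 0 <= w / 4 by have := w0; lra.
have := ler_pM w4 (ltW zz) k N; have := ler_wpM2l w4 pm; lra.
Qed.

(** With [Im Mu = 0] the field is [Om] times the velocity of the parametrised circle, and [Om] is
    constant there because [Mu] is. That the period is least follows from the injectivity of [Phi]
    and [cis_eq]. *)
Lemma periodic_orbit_circle (U : set V) x : x != 0 -> cnorm x <= s0 / 4 ->
  complex.Im (Mu x) = 0 -> (forall u, U (xi (Phi (x * cis u)))) ->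
  periodic_orbit U X (range (fun t => xi (Phi (x * cis (w / (1 + complex.Re (Mu x)) * t))))).
Proof.
move=> x0 hx iM hU; have s00' := s00.
have rot u : cnorm (x * cis u) <= s0 / 2.
  apply: le_trans (rn_M hC _ _) _; have := ler_pM (rn_ge0 hC _) (rn_ge0 hC _) hx (cnorm_cis u); lra.
have xs : cnorm x <= s0 / 2 by lra.
have [/andP[N0 _] r0] := Mu_bound xs.
set Om := w / _; have Om0 : 0 < Om by rewrite divr_gt0.
have p2 : 0 < pi *+ 2 :> R by rewrite pmulrn_lgt0 // pi_gt0.
exists (pi *+ 2 / Om), (fun t => xi (Phi (x * cis (Om * t)))); split=> //.
- by rewrite divr_gt0.
- move=> t _; split; first exact: hU.
  rewrite (field_normal_form (rot _)).
  rewrite (Mu_msq (_ : msq (x * cis _) = msq x)); last by rewrite msqM msq_cis mulr1.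
  rewrite iM scale0r addr0 scalerA.
  have -> : w / msq (1 + Mu x) * (1 + complex.Re (Mu x)) = Om.
    move: iM r0; rewrite /Om /msq; case: (Mu x) => a b /= -> r0.
    by field; rewrite gt_eqF // add0r; rewrite addr0 in r0 *.
  rewrite -(xiZ w0 hw); apply: hderiv_xi.
  have h := Phi_circle (Om * t + 0) xs.
  have := hderiv_affine h; rewrite addr0; apply: hderiv_ext => u; by rewrite addr0.
- move=> s t; split=> [e|[m ->]].
    have {}e := congr1 zc e; rewrite !(xiK w0 hw) in e.
    have := Phi_inj (rot _) (rot _) e.
    move=> /(mulfI x0) /cis_eq [m hm]; exists m.
    apply: (mulfI (lt0r_neq0 Om0)); rewrite hm [Om * (t + _)]mulrDr; congr (_ + _).
    by field; rewrite gt_eqF.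
  congr (xi (Phi (_ * _))); rewrite [Om * (t + _)]mulrDr -[RHS](cis_period _ m).
  by congr (cis (_ + _)); field; rewrite gt_eqF.
Qed.

Lemma Phi0 : Phi 0 = 0.
Proof.
apply: cnorm_eq0; apply/le_anti; rewrite (rn_ge0 hC) andbT.
apply/ler_addgt0Pr => e e0; rewrite add0r.
have m0 : 0 < Num.min (e / 2) s0 by rewrite lt_min s00 divr_gt0.
have m1 : Num.min (e / 2) s0 <= s0 by rewrite ge_min lexx orbT.
have m2 : Num.min (e / 2) s0 <= e / 2 by rewrite ge_min lexx.
have n0 : cnorm (0 : C) <= Num.min (e / 2) s0 by rewrite (rn_0 hC) ltW.
have := Phi_norm m0 m1 n0; lra.
Qed.

Lemma first_integral_xi x : cnorm x <= t0 / 2 -> f (xi (Phi x)) = msq x.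
Proof.
move=> hx; rewrite /first_integral (xiK w0 hw).
by rewrite (Psi_Phi hx).
Qed.

Lemma cnorm_gt0 (z : C) : z != 0 -> 0 < cnorm z.
Proof.
by move=> h; rewrite lt_neqAle (rn_ge0 hC) andbT eq_sym; apply: contra_neq h; exact: cnorm_eq0.
Qed.

Lemma field_neq0 q : q != 0 -> cnorm (zc q) <= t1 -> X q != 0.
Proof.
move=> q0 hq; rewrite -(zcK w0 hw q); set z := zc q in hq *.
have z0 : z != 0 by apply: contra_neq q0 => e; rewrite -(zcK w0 hw q) -/z e (xi0 w0 hw).
have zp := cnorm_gt0 z0.
have [zt0 zK pz] := small_radius zp hq.
have t00' := t00; have t0s' := t0s; have s0r' := s0r; have w0' := w0.
have zr : cnorm z <= r1 by lra.
have hF := Fv_norm zp zr (lexx _).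
apply/eqP => e; have := XE z; rewrite e (zc0 al ga w) => /esym/eqP; rewrite mulf_eq0 => /orP[/eqP[]|].
  lra.
rewrite addr_eq0 => /eqP hz; have : cnorm z = cnorm (Fv z) by rewrite {1}hz (rn_N hC).
move=> k; rewrite -k in hF.
have := ler_wpM2r (ltW zp) zK; have := mulr_ge0 (ltW K0) (mulr_ge0 (ltW zp) (ltW zp)).
move: hF zp; rewrite expr2; move: (cnorm z) => y; lra.
Qed.

Lemma zc_small e : 0 < e -> exists2 d, 0 < d & forall h : V, `|h| <= d -> cnorm (zc h) <= e.
Proof.
move=> e0; have k0 : 0 < kz al ga w.
  by rewrite /kz; have := normr_ge0 ga; have := normr_ge0 al; have := w0; lra.
exists (e / kz al ga w) => [|h hh]; first by rewrite divr_gt0.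
apply: le_trans (zc_norm al ga w0 h) _.
by rewrite -(divfK (lt0r_neq0 k0) e) mulrC ler_wpM2r // ltW.
Qed.

Lemma center_of_vanishing (U : set V) (d : R) : nbhs (0 : V) U -> X 0 = 0 -> 0 < d ->
  (forall x, cnorm x <= d -> complex.Im (Mu x) = 0) ->
  center_at U X 0 /\ exists (V0 : set V) (g : V -> R),
    [/\ open_nbhs (0 : V) V0, V0 `<=` U & analytic_first_integral X 0 V0 g].
Proof.
move=> /nbhs_rV2P[dU dU0 hU] X0 d0 hM.
have kx0 := kx_gt0 al ga w0.
pose e := Num.min t1 (Num.min (d / 4) (dU / (4 * kx al ga w))).
have e0 : 0 < e by rewrite !lt_min t10 !divr_gt0 // mulr_gt0.
have et : e <= t1 by rewrite ge_min lexx.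
have ed : e <= d / 4 by rewrite !ge_min lexx orbT.
have eU : e * (4 * kx al ga w) <= dU.
  by rewrite -ler_pdivlMr ?mulr_gt0 // !ge_min lexx !orbT.
clearbody e.
have t00' := t00; have t0s' := t0s; have t1t' := t1t.
have inU z : cnorm z <= 4 * e -> U (xi z).
  move=> hz; rewrite -[xi z]add0r; apply: hU; apply: le_trans (xi_norm al ga w0 z) _.
  have := ler_wpM2l (ltW kx0) hz; lra.
have NM x : msq x < e ^+ 2 -> cnorm x <= 2 * e.
  move=> hx; rewrite -(@ler_pXn2r _ 2) ?nnegrE ?(rn_ge0 hC) ?mulr_ge0 // ?ltW //.
  have := cnorm_le_msq x; have := sqr_ge0 e; rewrite exprMn; lra.
have PU x : cnorm x <= 2 * e -> cnorm (Phi x) <= 4 * e.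
  move=> hx; have e2 : 0 < 2 * e by lra.
  have e2s : 2 * e <= s0 by lra.
  have := Phi_norm e2 e2s hx; lra.
split.
  split.
    split=> //; have [d1 d10 hd1] := zc_small t10.
    by apply/nbhs_rV2P; exists d1 => // h hh; rewrite add0r => h0; apply: field_neq0 => //; exact: hd1.
  (* The disc is taken round for [msq] rather than for [cnorm]: its invariance under [cis] keeps
     whole orbits inside the neighborhood. *)
  exists [set q | exists2 x, msq x < e ^+ 2 & q = xi (Phi x)]; split.
  - have e4 : 0 < e / 4 by lra.
    have [d1 d10 hd1] := zc_small e4.
    apply/nbhs_rV2P; exists d1 => // h /hd1 hz; rewrite add0r.
    exists (Psi (zc h)).
      have e4t : e / 4 <= t0 by lra.
      have := Psi_norm e4 e4t hz => hp.
      apply: le_lt_trans (msq_le_cnorm _) _.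
      rewrite ltr_pXn2r ?nnegrE ?(rn_ge0 hC) ?ltW //; lra.
    rewrite (Phi_Psi); last by lra.
    by rewrite (zcK w0 hw).
  - by move=> _ [x /NM hx ->]; apply: inU; exact: PU.
  - move=> _ [x hx ->] q0; have x0 : x != 0.
      by apply: contra_neq q0 => ->; rewrite Phi0 (xi0 w0 hw).
    have hx2 := NM x hx.
    have rot u : msq (x * cis u) < e ^+ 2 by rewrite msqM msq_cis mulr1.
    eexists; split.
    + apply: (periodic_orbit_circle x0); [lra|apply: hM; lra|].
      by move=> u; apply: inU; apply: PU; exact: NM.
    + by exists 0 => //=; rewrite mulr0 /cis cos0 sin0 mulr1.
    + by move=> _ [t _ <-]; exists (x * cis (w / (1 + complex.Re (Mu x)) * t)).
exists [set q | cnorm (zc q) < e], f; split.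
- split; last by rewrite /= (zc0 al ga w) (rn_0 hC).
  rewrite openE => q /= hq; have e1 : 0 < (e - cnorm (zc q)) / 2 by lra.
  have [d1 d10 hd1] := zc_small e1.
  apply/nbhs_rV2P; exists d1 => // h /hd1 hz /=; rewrite (zcD al ga w).
  by apply: le_lt_trans (rn_D hC _ _) _; lra.
- by move=> q /= hq; rewrite -(zcK w0 hw q); apply: inU; lra.
- split.
  + move=> q /= hq; apply: (first_integral_analytic); lra.
  + move=> q /= hq; have qt : cnorm (zc q) < t0 by lra.
    have [l0 [l1 [lE _]]] := analytic_gradient
      (first_integral_analytic qt).
    have [z0|z0] := eqVneq (zc q) 0.
      have -> : q = 0 by rewrite -(zcK w0 hw q) z0 (xi0 w0 hw).
      have := lE (X q); have -> : q = 0 by rewrite -(zcK w0 hw q) z0 (xi0 w0 hw).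
      by rewrite X0 => ->; rewrite !mxE !mulr0 addr0.
    have zp := cnorm_gt0 z0; have zt : cnorm (zc q) <= t1 by lra.
    have [m _] := derive_along_field zp zt.
    have [_ _ pz] := small_radius zp zt.
    by rewrite (zcK w0 hw) => ->; rewrite hM ?mulr0 //; lra.
  + move=> [a /nbhs_rV2P[d1 d10 hd1]].
    have f0 : f 0 = 0.
      rewrite -(xi0 w0 hw) -Phi0 first_integral_xi ?(rn_0 hC) ?divr_ge0 //; last exact: ltW.
      by rewrite /msq /= expr0n addr0.
    have a0 : a = 0.
      rewrite -f0 -[X in f X]addr0; apply/esym/hd1; rewrite normr0; exact: ltW.
    (* Nonconstancy: [f] vanishes at the origin and equals [y ^+ 2] at a point [xi (Phi y)] within
       distance [d1] of it. *)
    pose y := Num.min e (d1 / (4 * kx al ga w)).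
    have y0 : 0 < y by rewrite lt_min e0 divr_gt0 // mulr_gt0.
    have ye : y <= e by rewrite ge_min lexx.
    have yd : y * (4 * kx al ga w) <= d1.
      by rewrite -ler_pdivlMr ?mulr_gt0 // ge_min lexx orbT.
    clearbody y.
    have yn : cnorm (real_complex R y) <= y by rewrite cnorm_real gtr0_norm.
    have : f (0 + xi (Phi (real_complex R y))) = a.
      apply: hd1; apply: le_trans (xi_norm al ga w0 _) _.
      have ys : y <= s0 by lra.
      have hP := Phi_norm y0 ys yn.
      by have := ler_wpM2l (ltW kx0) hP; have := mulr_gt0 kx0 y0; lra.
    rewrite add0r first_integral_xi; last by lra.
    rewrite a0 /msq /= expr0n addr0 => /eqP; rewrite sqrf_eq0 => /eqP; lra.
Qed.

(** [Mu] depends on the squared modulus alone, so the one-variable dichotomy on the positive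
    half-axis decides everything. [zcoord 0 1 1] is the standard identification of the plane with
    [R[i]]. *)
Lemma im_Mu_dichotomy :
  (exists2 d, 0 < d & forall x, cnorm x <= d -> complex.Im (Mu x) = 0) \/
  (exists (b : bool) (k : nat) (c d : R), [/\ 0 < c, 0 < d & forall x, cnorm x <= d ->
     c * Num.sqrt (msq x) ^+ k <= (-1) ^+ b * complex.Im (Mu x)]).
Proof.
pose g (v : V) : R := complex.Im (Mu (zcoord 0 1 1 v)).
have z0 : cnorm (zcoord 0 1 1 (0 : V)) < s0 by rewrite (zc0 0 1 1) (rn_0 hC).
have hg : analytic_at g 0.
  exact: (@zc_analytic R 0 1 1 ltr01 im_mu s0 _ (fun x => complex.Im (Mu x)) 0
    (im_mu_geo) (im_mu_gcvg) z0).
have gE x : complex.Im (Mu x) = g (row2 (Num.sqrt (msq x)) 0).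
  congr complex.Im; apply: Mu_msq.
  rewrite /msq /= row20 row21 !mul0r !mul1r subr0 sqr_sqrtr; last exact: msq_ge0.
  by rewrite expr0n addr0.
have sq (x : C) (d : R) : cnorm x <= d -> 0 <= Num.sqrt (msq x) <= d.
  move=> hx; rewrite sqrtr_ge0 /=; have d0 := le_trans (rn_ge0 hC x) hx.
  rewrite -(ger0_norm d0) -sqrtr_sqr; apply: ler_wsqrtr.
  apply: le_trans (msq_le_cnorm x) _.
  by rewrite !expr2; apply: ler_pM; rewrite ?(rn_ge0 hC).
case: (analytic_axis_dichotomy hg) => [[d d0 h]|[b [k [c [d [c0 d0 h]]]]]].
  by left; exists d => // x hx; rewrite gE h // sq.
by right; exists b, k, c, d; split=> // x hx; rewrite gE; apply: h; exact: sq.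
Qed.

(** Time reversal preserves orbits, so the two signs of [Im Mu] can be treated as one. *)
Lemma orbit_in_sign (U : set V) (b : bool) p :
  orbit_in U (fun q => (-1) ^+ b *: X q) p = orbit_in U X p.
Proof.
case: b; last by congr (orbit_in U _ p); apply/funext => q; rewrite expr0 scale1r.
rewrite (_ : (fun q => _) = (fun q => - X q)); last first.
  by apply/funext => q; rewrite expr1 scaleN1r.
apply/seteqP; split; last exact: orbit_opp.
have := @orbit_opp R U (fun q => - X q) p.
by rewrite (_ : (fun q => - - X q) = X) //; apply/funext => q; rewrite opprK.
Qed.

Lemma no_orbit_near (U : set V) (b : bool) (k : nat) (c d : R) :
  open_nbhs (0 : V) U -> (forall p, U p -> forall j, analytic_at (fun q => X q 0 j) p) ->
  0 < c -> 0 < d ->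
  (forall x, cnorm x <= d -> c * Num.sqrt (msq x) ^+ k <= (-1) ^+ b * complex.Im (Mu x)) ->
  exists2 W, nbhs (0 : V) W & forall gamma, is_orbit U X gamma -> gamma `<=` W ->
    ~ gamma 0 -> False.
Proof.
move=> [oU U0] hX c0 d0 hM; have hU : nbhs (0 : V) U by exact: open_nbhs_nbhs.
 have t00' := t00; have t1t' := t1t; have t0s' := t0s; have s00' := s00.
have [rho [tau [rho0 tau0 hloc]]] := local_existence hU (hX _ U0).
(* Half of [d], because [Psi] may double the norm. *)
pose e := Num.min t1 (d / 2).
have e0 : 0 < e by rewrite lt_min t10 divr_gt0.
have et : e <= t1 by rewrite ge_min lexx.
have ed : e <= d / 2 by rewrite ge_min lexx orbT.
clearbody e; have [d1 d10 hd1] := zc_small e0.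
(* The first condition gives the growth estimates, the second the uniform existence time. *)
exists [set q | cnorm (zc q) <= e /\ `|q| <= rho].
  apply/nbhs_rV2P; exists (Num.min d1 rho); first by rewrite lt_min d10.
  by move=> h; rewrite add0r le_min => /andP[/hd1].
move=> _ [p Up ->]; pose Y q := (-1) ^+ b *: X q; rewrite -(orbit_in_sign U b) -/Y => sub n0.
have curveY (a : R) (cc : R -> V) : integral_curve U X `]- a, a[ cc ->
    exists cc' : R -> V, cc' 0 = cc 0 /\ integral_curve U Y `]- a, a[ cc'.
  rewrite /Y; case: (b) => h; last first.
    by exists cc; split=> // t /h[h1 h2]; rewrite expr0 scale1r.
  exists (fun t => cc (- t)); rewrite oppr0; split=> //.
  have := integral_curve_opp h; rewrite opprK => h' t /h'[h1 h2].
  by rewrite expr1 scaleN1r.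
have op : orbit_in U Y p p.
  have Up' : nbhs p U by exact: open_nbhs_nbhs.
  have [rp [tp [rp0 tp0 hp]]] := local_existence Up' (hX _ Up).
  have [|cc [cc0 hcc]] := hp p; first by rewrite subrr normr0 ltW.
  have [cc' [cc'0 hcc']] := curveY _ _ hcc.
  by apply: (orbit_base tp0 _ hcc'); rewrite cc'0.
have small q : orbit_in U Y p q ->
    [/\ 0 < cnorm (zc q), cnorm (zc q) <= t1, cnorm (Psi (zc q)) <= 2 * e,
        cnorm (Psi (zc q)) <= d & 0 < f q].
  move=> oq; have [qe _] := sub q oq; have qt : cnorm (zc q) <= t1 by lra.
  have z0 : zc q != 0.
    by apply/eqP => z0; apply: n0; rewrite -(xi0 w0 hw) -z0 (zcK w0 hw).
  have zp := cnorm_gt0 z0.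
  have [zt0 _ pz] := small_radius zp qt.
  split=> //; [lra|lra|].
  rewrite lt_neqAle msq_ge0 andbT eq_sym; apply: contra_neq z0 => /msq_eq0 e1.
  by rewrite -(Phi_Psi (x := zc q)) ?e1 ?Phi0 //; lra.
pose G q := 'D_(Y q) f q.
(* A lower bound for the speed that increases with the value [y] of [f]; where [f] is at least [f p]
   it is at least [lb (f p)], the constant that [escape] asks for. *)
pose lb y : R := w / 32 * y * (c * Num.sqrt y ^+ k).
have lb_le q : orbit_in U Y p q -> lb (f q) <= G q.
  move=> oq; have [zp zt _ pd fq] := small q oq.
  have qt : cnorm (zc q) < t0 by lra.
  have [l0 [l1 [lE _]]] := analytic_gradient
    (first_integral_analytic qt).
  have [m hm] := derive_along_field zp zt.
  rewrite (zcK w0 hw) => D.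
  have -> : G q = m * ((-1) ^+ b * complex.Im (Mu (Psi (zc q)))).
    rewrite mulrCA -D /G /Y !lE !mxE; ring.
  apply: ler_pM => //; first by rewrite mulr_ge0 ?divr_ge0 // ltW.
  - by rewrite mulr_ge0 ?exprn_ge0 ?sqrtr_ge0 // ltW.
  - exact: hM.
have fp : 0 < f p by have [] := small p op.
have lb_gt0 y : 0 < y -> 0 < lb y.
  by move=> y0; rewrite /lb !mulr_gt0 ?exprn_gt0 ?sqrtr_gt0 // invr_gt0.
apply: (@escape R U Y p f G tau ((2 * e) ^+ 2) (lb (f p)) op tau0 (lb_gt0 _ fp)).
- move=> q oq; have [_ qr] := sub q oq.
  have [|cc [cc0 hcc]] := hloc q; first by rewrite subr0.
  by have [cc' [cc'0 hcc']] := curveY _ _ hcc; exists cc'; rewrite cc'0.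
- move=> q oq; have [_ _ pe _ _] := small q oq.
  apply: le_trans (msq_le_cnorm _) _.
  by rewrite !expr2; apply: ler_pM; rewrite ?(rn_ge0 hC).
- move=> cc t oq dc; have [zp zt _ _ _] := small _ oq.
  have qt : cnorm (zc (cc t)) < t0 by lra.
  have [l0 [l1 [lE lC]]] := analytic_gradient
    (first_integral_analytic qt).
  by rewrite /G lE; exact: lC.
- move=> q oq; have [_ _ _ _ fq] := small q oq.
  exact: lt_le_trans (lb_gt0 _ fq) (lb_le q oq).
- move=> q oq le_f; apply: le_trans (lb_le q oq).
  have w32 : 0 <= w / 32 by rewrite divr_ge0 // ltW.
  rewrite /lb; apply: ler_pM.
  + by rewrite mulr_ge0 // ltW.
  + by rewrite mulr_ge0 ?exprn_ge0 ?sqrtr_ge0 // ltW.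
  + exact: ler_wpM2l.
  + apply: ler_wpM2l; first exact: ltW.
    by apply: lerXn2r; rewrite ?nnegrE ?sqrtr_ge0 // ler_wsqrtr.
Qed.

End Dynamics.
End NormalFormMap.

Theorem theorem2 (R : realType) (U : set 'rV[R]_2)
    (X : 'rV[R]_2 -> 'rV[R]_2)
    (hU : open_nbhs (0 : 'rV[R]_2) U)
    (hX : analytic_vector_field U X)
    (hX0 : X 0 = 0)
    (hrot : generates_rotation (DX X 0))
    (Sigma : set 'rV[R]_2) (hSigma : transverse_segment U X Sigma)
    (k : nat) (gamma : nat -> set 'rV[R]_2)
    (hgamma : forall nu : nat,
       is_orbit U X (gamma nu) /\ gamma nu `<=` U `\ (0 : 'rV[R]_2))
    (hord : forall nu : nat, order_bounded Sigma k (gamma nu))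
    (hlim : orbits_tend_to gamma 0) :
  center_at U X 0 /\
  exists (V : set 'rV[R]_2) (f : 'rV[R]_2 -> R),
    [/\ open_nbhs (0 : 'rV[R]_2) V, V `<=` U
      & analytic_first_integral X 0 V f].
Proof.
have [tr0 det0] := rotation_trace_det hrot.
set M := DX X 0 in tr0 det0; pose al := M 0 0; pose be := M 0 1; pose ga := M 1 0.
(* Trace zero gives the shape [[[al, be], [ga, - al]]], whose determinant is [w ^+ 2]. *)
have M11 : M 1 1 = - al by rewrite /al; lra.
have dg : 0 < - al ^+ 2 - be * ga by move: det0; rewrite M11 /al /be /ga expr2; lra.
pose w := Num.sqrt (- al ^+ 2 - be * ga).
have w0 : 0 < w by rewrite sqrtr_gt0.
have hw : w ^+ 2 = - al ^+ 2 - be * ga by rewrite sqr_sqrtr // ltW.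
have U0 : U 0 := hU.2.
have [K [r1 [A [F [Fv [[K0 r10 A0] [F_quad F_geo F_lim XE]]]]]]] :=
  @complexify R al be ga w w0 hw X (hX 0 U0) hX0 erefl erefl erefl M11.
(* Nested radii: [s0] for the normal form map, [t0] for its inverse, [t1] for the growth
   estimate. *)
pose s0 := Num.min (r1 / 4) (256 * K)^-1.
have K256 : 0 < 256 * K by apply: mulr_gt0 K0; rewrite ltr0n.
have s00 : 0 < s0 by rewrite lt_min divr_gt0 // invr_gt0.
have s0r : 4 * s0 <= r1 by rewrite mulrC -ler_pdivlMr // ge_min lexx.
have s0K : 256 * (K * s0) <= 1.
  by rewrite mulrA mulrC -ler_pdivlMr // div1r ge_min lexx orbT.
pose t0 := Num.min (s0 / 4) (64 * (16 * K))^-1.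
have K64 : 0 < 64 * (16 * K) by rewrite !mulr_gt0.
have t00 : 0 < t0 by rewrite lt_min divr_gt0 // invr_gt0.
have t0s : 4 * t0 <= s0 by rewrite mulrC -ler_pdivlMr // ge_min lexx.
have t0K : 64 * (16 * K * t0) <= 1.
  by rewrite mulrA mulrC -ler_pdivlMr // div1r ge_min lexx orbT.
pose t1 := Num.min (t0 / 8) (32 * (32 * (32 * K)))^-1.
have K32 : 0 < 32 * (32 * (32 * K)) by rewrite !mulr_gt0.
have t10 : 0 < t1 by rewrite lt_min divr_gt0 // invr_gt0.
have t1t : 8 * t1 <= t0 by rewrite mulrC -ler_pdivlMr // ge_min lexx.
have t1K : 32 * (32 * (32 * (K * t1))) <= 1.
  by rewrite !mulrA mulrC -ler_pdivlMr ?div1r -?mulrA // ge_min lexx orbT.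
have [[d d0 hM]|[b [m [c [d [c0 d0 hM]]]]]] := im_Mu_dichotomy K0 A0 F_quad F_geo s00 s0r s0K.
  exact: (center_of_vanishing K0 A0 F_quad F_geo F_lim s00 s0r s0K t00 t0s t0K w0 hw XE t10 t1t t1K
    (open_nbhs_nbhs hU) hX0 d0 hM).
have [W hW noW] := no_orbit_near K0 A0 F_quad F_geo F_lim s00 s0r s0K t00 t0s t0K w0 hw XE t10 t1t t1K
  hU hX c0 d0 hM.
have [nu _ hnu] := hlim W hW.
have [onu sub] := hgamma nu.
by case: (noW _ onu (hnu nu (leqnn nu))) => /sub[_ h]; apply: h.
Qed.
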